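(* Let $n\ge1$, $m\ge0$, and let $M^{n+1}=[a,+\infty)\times\mathbb{S}^n$ carry the anti-de Sitter–Schwarzschild metric $\bar g=dr^2+\lambda^2(r)g_{\mathbb{S}^n}$, where $\lambda$ satisfies $\lambda'(r)=\sqrt{1+\lambda^2-m\lambda^{1-n}}$ and $a$ satisfies $\lambda(a)=m^{\frac1{n+1}}$. Let $\Sigma$ be a star-shaped $C^1$ hypersurface in $M^{n+1}$ and $\Omega$ the domain bounded by $\Sigma$ and $\{a\}\times\mathbb{S}^n$. Then $$\Big(\int_\Sigma\lambda'(r)\,d\mu\Big)^2\ge\Big((n+1)\widehat\eta\Big(\int_\Omega\lambda'(r)\,dv\Big)+\frac{m(n+1)}{2}\int_\Omega\frac{\lambda'(r)}{\lambda^n(r)\sqrt{(\lambda'(r))^2-1}}\,dv\Big)^2+\Big((n+1)\omega_n^{\frac1n}\int_\Omega\lambda'(r)\,dv+\omega_n^{\frac{n+1}{n}}m\Big)^{\frac{2n}{n+1}},$$ where $\widehat\eta$ is determined by $$\widehat\eta\Big(\omega_n\int_{m^{1/(n+1)}}^t s^n\,ds\Big)=\omega_n\int_{m^{1/(n+1)}}^t\Lambda(s)s^n\,ds\qquad\forall\,t\ge m^{\frac1{n+1}},$$ with $\Lambda(t):=\frac{\sqrt{\Psi^2(t)-1}}{t}$ and $\Psi(t):=\lambda'\circ\lambda^{-1}(t)$. Equality holds if and only if $\Sigma$ is a radial coordinate slice $\{r_0\}\times\mathbb{S}^n$ with $r_0\in[a,+\infty)$.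
   Context: A hypersurface $\Sigma\subset M^{n+1}$ is star-shaped ($C^1$) if it can be written as $\Sigma=\{(r(\theta),\theta):\theta\in\mathbb{S}^n\}$ for a $C^1$ function $r$ on $\mathbb{S}^n$ with $r(\theta)\ge a$. $dv=\lambda^n dr\,d\sigma$ is the volume element ($d\sigma$ the area element of $\mathbb{S}^n$), $d\mu$ the induced area element of $\Sigma$, and $\omega_n$ the area of $\mathbb{S}^n$. *)

(* Defs.v *)
From HB Require Import structures.
From mathcomp Require Import all_boot all_order all_algebra.
From mathcomp Require Import all_classical all_reals all_analysis.
Set Implicit Arguments. Unset Strict Implicit. Unset Printing Implicit Defensive.
Import Order.TTheory GRing.Theory Num.Theory.
Import numFieldNormedType.Exports.
Local Open Scope classical_set_scope.
Local Open Scope ring_scope.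

Definition enorm (R : realType) (k : nat) (x : 'rV[R]_k) : R :=
  Num.sqrt (\sum_(i < k) x ord0 i ^+ 2).

Definition unitize (R : realType) (k : nat) (x : 'rV[R]_k) : 'rV[R]_k :=
  (enorm x)^-1 *: x.

Definition cons_rv (R : realType) (k : nat) (t : R) (y : 'rV[R]_k) : 'rV[R]_k.+1 :=
  row_mx (\row_(_ < 1) t) y.

(* Lebesgue integral on R^k, as the iterated one-dimensional Lebesgue integral
   (Fubini-Tonelli).  Used only for nonnegative integrands. *)
Fixpoint leb_iint (R : realType) (k : nat) : ('rV[R]_k -> \bar R) -> \bar R :=
  match k return ('rV[R]_k -> \bar R) -> \bar R with
  | 0 => fun f => f 0
  | k'.+1 => fun f =>
      (\int[@lebesgue_measure R]_(t in [set: R])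
          leb_iint (fun y : 'rV[R]_k' => f (cons_rv t y)))%E
  end.

(* Integral over the unit sphere S^n (in R^(n+1)) with respect to its standard
   area measure d sigma, via the cone formula
     int_{S^n} g dsigma = (n+1) * int_{0 < |x| <= 1} g(x/|x|) dx.
   Only the values of g on the sphere matter. *)
Definition sphere_int (R : realType) (n : nat) (g : 'rV[R]_n.+1 -> R) : R :=
  fine (((n.+1)%:R)%:E *
        leb_iint (fun x : 'rV[R]_n.+1 =>
          if (x != 0%R :> 'rV[R]_n.+1) && (enorm x <= 1)%R
          then (g (unitize x))%:E else 0%E))%E.

Definition omega (R : realType) (n : nat) : R := sphere_int (fun _ : 'rV[R]_n.+1 => 1).

Definition rint (R : realType) (c t : R) (f : R -> R) : R :=
  fine (\int[@lebesgue_measure R]_(s in [set` `[c, t]]) (f s)%:E)%E.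

Definition homog (R : realType) (n : nat) (r : 'rV[R]_n.+1 -> R) : 'rV[R]_n.+1 -> R :=
  fun x => r (unitize x).

(* |nabla r|^2 on S^n (spherical gradient = Euclidean gradient of the
   degree-0 homogeneous extension, at points of the sphere) *)
Definition grad_sq (R : realType) (n : nat) (r : 'rV[R]_n.+1 -> R) (th : 'rV[R]_n.+1) : R :=
  \sum_(i < n.+1) ('D_(delta_mx ord0 i) (homog r) th) ^+ 2.

(* r : S^n -> [a,oo) describes a star-shaped C^1 hypersurface {(r(th),th)} *)
Definition star_shaped_C1 (R : realType) (n : nat) (a : R) (r : 'rV[R]_n.+1 -> R) : Prop :=
  (forall th : 'rV[R]_n.+1, enorm th = 1 -> a <= r th) /\
  (forall x : 'rV[R]_n.+1, x != 0 -> differentiable (homog r) x) /\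
  (forall (i : 'I_n.+1) (x : 'rV[R]_n.+1), x != 0 ->
      {for x, continuous (fun y => 'D_(delta_mx ord0 i) (homog r) y)}).

(* int_Sigma f(r) dmu, with the induced area element of the graph
   dmu = lambda(r)^(n-1) sqrt(lambda(r)^2 + |nabla r|^2) dsigma *)
Definition surf_int (R : realType) (n : nat) (lam : R -> R) (r : 'rV[R]_n.+1 -> R)
    (f : R -> R) : R :=
  sphere_int (fun th => f (r th) * lam (r th) ^+ (n - 1)
                        * Num.sqrt (lam (r th) ^+ 2 + grad_sq r th)).

(* int_Omega f(r) dv, Omega = {(s,th) : a <= s <= r(th)}, dv = lambda^n dr dsigma *)
Definition vol_int (R : realType) (n : nat) (lam : R -> R) (a : R) (r : 'rV[R]_n.+1 -> R)
    (f : R -> R) : R :=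
  sphere_int (fun th => rint a (r th) (fun s => f s * lam s ^+ n)).

Definition lam_inv (R : realType) (lam : R -> R) (a t : R) : R :=
  xget a [set s | a <= s /\ lam s = t].

Definition Psi (R : realType) (lam : R -> R) (a t : R) : R := derive1 lam (lam_inv lam a t).
Definition Lambda (R : realType) (lam : R -> R) (a t : R) : R :=
  Num.sqrt (Psi lam a t ^+ 2 - 1) / t.

(* Main.v *)
Require Import Defs.
From HB Require Import structures.
From mathcomp Require Import all_boot all_order all_algebra.
From mathcomp Require Import all_classical all_reals all_analysis.
From mathcomp Require Import measurable_realfun.
From mathcomp Require Import ring lra.
Import Order.TTheory GRing.Theory Num.Theory.
Import numFieldNormedType.Exports.
Local Open Scope classical_set_scope.
Local Open Scope ring_scope.

(* Write P = lambda o r on the sphere, N = n + 1 and F(t) = t^n Lambda(t).  Since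
   lambda'^2 P^(2n) = P^(2n) + P^2 F(P)^2, the weighted area of the surface is
   int sqrt (f^2 + g^2) dsigma with f = P F(P) and g = P^(n-1) sqrt (P^2 + |grad P|^2),
   hence it is at least |(int f, int g)| by the Cauchy-Schwarz inequality.

   For f: the antiderivative T of F is convex as a function of t^N, so Jensen's
   inequality bounds int T(P) below by the term with eta-hat, and the singular integral
   supplies exactly the difference between f and N T(P).  For g: int g is the Euclidean
   area of the star-shaped graph of P over the sphere, to which the isoperimetric
   inequality applies; the latter comes from the Brunn-Minkowski inequality, applied to
   the region inside the graph and a small ball.

   In the equality case f / g is constant.  At a maximum point of P the gradient vanishes
   and f / g = P Lambda(P), while f / g <= P Lambda(P) elsewhere; as t Lambda(t) is
   increasing, P is maximal wherever it is not zero, so P is constant by connectedness. *)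

(** In terms of [P] the geometry becomes Euclidean. Since lambda' lambda^n dr = d(lambda^N) / N, the
    weighted volume plus [m] times the volume of the unit ball is the Euclidean volume inside the
    graph of [P]. The bracket raised to the power 2n/(n+1) is a constant times that volume, and its
    power is the square of the isoperimetric lower bound for int g. The factor m(n+1)/2 comes from
    (t F(t) - N T(t))' = (m N / 2) t^(n-1) / F(t), where N T' = N F; for m > 0 the right-hand side
    blows up at t = m^(1/N), where F vanishes, so the fundamental theorem is needed in an improper
    form. Convexity of T in t^N means that dT / d(t^N) = Lambda / N increases.

    A sphere integral is N times the integral of a 0-homogeneous function over the unit ball, so all
    measure theory happens on iterated one-dimensional integrals, and polar coordinates become a
    comparison on cones.

    The delicate case is m = 0: then lambda(a) = 0 and [P] may vanish. Hence the isoperimetric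
    inequality is first proved for P > 0 and then extended through P + d, monotonicity statements
    are cross-multiplied, and the equality case has to exclude zeros of [P] separately. *)

Set Implicit Arguments.
Unset Strict Implicit.
Unset Printing Implicit Defensive.


(** * Iterated Lebesgue integrals *)

Section iterated_integral.
Context {R : realType}.
Local Notation mu := (@lebesgue_measure R).

Lemma cons_rv0 k (t : R) (y : 'rV[R]_k) : cons_rv t y ord0 ord0 = t.
Proof.
have -> : (ord0 : 'I_k.+1) = lshift k (ord0 : 'I_1) by exact: val_inj.
exact: etrans (row_mxEl (\row_(_ < 1) t) y ord0 ord0) (mxE _ _ _ _).
Qed.

Lemma cons_rv_lift k (t : R) (y : 'rV[R]_k) i :
  cons_rv t y ord0 (lift ord0 i) = y ord0 i.
Proof.
have -> : lift ord0 i = rshift 1 i by exact: val_inj.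
exact: (row_mxEr (\row_(_ < 1) t) y ord0 i).
Qed.

Lemma cons_rvD k (s t : R) (x y : 'rV[R]_k) :
  cons_rv (s + t) (x + y) = cons_rv s x + cons_rv t y.
Proof.
apply/rowP => i; rewrite [RHS]mxE; case: (unliftP ord0 i) => [j|] ->.
  by rewrite !cons_rv_lift mxE.
by rewrite !cons_rv0.
Qed.

Lemma cons_rvZ k (c t : R) (y : 'rV[R]_k) :
  cons_rv (c * t) (c *: y) = c *: cons_rv t y.
Proof.
apply/rowP => i; rewrite [RHS]mxE; case: (unliftP ord0 i) => [j|] ->.
  by rewrite !cons_rv_lift mxE.
by rewrite !cons_rv0.
Qed.

(* Measurability of a function on row vectors, for the Borel sets of the
   coordinates: 'rV[R]_k carries no measurable structure. *)
Definition rv_measurable k d' (T' : measurableType d') (f : 'rV[R]_k -> T') :=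
  forall d (T : measurableType d) (u : T -> 'rV[R]_k),
    (forall i, measurable_fun setT (fun w => u w ord0 i)) ->
    measurable_fun setT (f \o u).

Lemma measurable_cons_rv k d (T : measurableType d) (s : T -> R)
    (u : T -> 'rV[R]_k) :
  measurable_fun setT s -> (forall i, measurable_fun setT (fun w => u w ord0 i)) ->
  forall i, measurable_fun setT (fun w => cons_rv (s w) (u w) ord0 i).
Proof.
move=> ms mu' i; case: (unliftP ord0 i) => [j|] ->.
  by rewrite (_ : (fun _ => _) = (fun w => u w ord0 j))//; apply/funext => w;
    rewrite cons_rv_lift.
by rewrite (_ : (fun _ => _) = s)//; apply/funext => w; rewrite cons_rv0.
Qed.

Lemma rv_measurable_cons k d' (T' : measurableType d') (f : 'rV[R]_k.+1 -> T') t :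
  rv_measurable f -> rv_measurable (fun y => f (cons_rv t y)).
Proof.
move=> mf d T u mu'; apply: (mf _ _ (fun w => cons_rv t (u w))).
exact: measurable_cons_rv.
Qed.

Lemma leb_iint_ge0 k (f : 'rV[R]_k -> \bar R) :
  (forall x, 0 <= f x)%E -> (0 <= leb_iint f)%E.
Proof.
elim: k f => [|k IH] f f0 //=; apply: integral_ge0 => t _; exact: IH.
Qed.

(** The induction on [k] needs a parameter: the first coordinate joins the parameter space, so that
    [T] becomes [T * R], and Tonelli gives the measurability of what remains. Joint measurability of
    [F] is expressed by composing with arbitrary measurable [v] and [u]. *)
Lemma measurable_leb_iint_param k d (T : measurableType d)
    (F : T -> 'rV[R]_k -> \bar R) :
  (forall w x, 0 <= F w x)%E ->
  (forall d' (T' : measurableType d') (v : T' -> T) (u : T' -> 'rV[R]_k),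
     measurable_fun setT v -> (forall i, measurable_fun setT (fun w => u w ord0 i)) ->
     measurable_fun setT (fun w => F (v w) (u w))) ->
  measurable_fun setT (fun w => leb_iint (F w)).
Proof.
elim: k d T F => [|k IH] d T F F0 mF.
  by apply: (mF _ _ id (fun=> 0)).
rewrite /=.
pose G := fun p : T * measurableTypeR R =>
  leb_iint (fun y => F p.1 (cons_rv p.2 y)).
have mG : measurable_fun setT G.
  apply: (IH _ _ (fun (p : T * measurableTypeR R) y => F p.1 (cons_rv p.2 y))).
    by move=> *; exact: F0.
  move=> d' T' v u mv mu'.
  apply: (mF _ _ (fun w => (v w).1) (fun w => cons_rv (v w).2 (u w))).
    exact: measurableT_comp.
  apply: measurable_cons_rv => //; exact: measurableT_comp.
by have := measurable_fun_fubini_tonelli_F (m2 := mu) G mG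
  (fun p => leb_iint_ge0 (fun x => F0 _ _)).
Qed.

Lemma measurable_leb_iint_cons k (f : 'rV[R]_k.+1 -> \bar R) :
  (forall x, 0 <= f x)%E -> rv_measurable f ->
  measurable_fun setT (fun t : measurableTypeR R => leb_iint (fun y => f (cons_rv t y))).
Proof.
move=> f0 mf; apply: (@measurable_leb_iint_param _ _ (measurableTypeR R)
  (fun t y => f (cons_rv t y))) => // d' T' v u mv mu'.
apply: (mf _ _ (fun w => cons_rv (v w) (u w))); exact: measurable_cons_rv.
Qed.

Lemma eq_leb_iint k (f g : 'rV[R]_k -> \bar R) : f =1 g -> leb_iint f = leb_iint g.
Proof. by move=> /funext ->. Qed.

Lemma le_leb_iint k (f g : 'rV[R]_k -> \bar R) :
  (forall x, 0 <= f x)%E -> rv_measurable f -> rv_measurable g ->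
  (forall x, f x <= g x)%E -> (leb_iint f <= leb_iint g)%E.
Proof.
elim: k f g => [|k IH] f g f0 mf mg fg //=.
have g0 x : (0 <= g x)%E by exact: le_trans (f0 x) (fg x).
apply: ge0_le_integral => //.
- by move=> t _; exact: leb_iint_ge0.
- exact: measurable_leb_iint_cons.
- exact: measurable_leb_iint_cons.
- by move=> t _; apply: IH => //; exact: rv_measurable_cons.
Qed.

Lemma leb_iint0 k : leb_iint (fun _ : 'rV[R]_k => 0%E) = 0%E.
Proof.
by elim: k => [|k IH] //=; apply: integral0_eq => t _; rewrite IH.
Qed.

Lemma leb_iintD k (f g : 'rV[R]_k -> \bar R) :
  (forall x, 0 <= f x)%E -> (forall x, 0 <= g x)%E ->
  rv_measurable f -> rv_measurable g ->
  leb_iint (fun x => f x + g x)%E = (leb_iint f + leb_iint g)%E.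
Proof.
elim: k f g => [|k IH] f g f0 g0 mf mg //=.
rewrite -ge0_integralD//.
- by apply: eq_integral => t _; rewrite IH//; exact: rv_measurable_cons.
- by move=> t _; exact: leb_iint_ge0.
- exact: measurable_leb_iint_cons.
- by move=> t _; exact: leb_iint_ge0.
- exact: measurable_leb_iint_cons.
Qed.

Lemma leb_iintZ k (c : R) (f : 'rV[R]_k -> \bar R) :
  0 <= c -> (forall x, 0 <= f x)%E -> rv_measurable f ->
  leb_iint (fun x => c%:E * f x)%E = (c%:E * leb_iint f)%E.
Proof.
move=> c0; elim: k f => [|k IH] f f0 mf //=.
rewrite -ge0_integralZl_EFin//.
- by apply: eq_integral => t _; rewrite IH//; exact: rv_measurable_cons.
- by move=> t _; exact: leb_iint_ge0.
- exact: measurable_leb_iint_cons.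
Qed.

(** The rescaled image measure gives every half-open interval its length; uniqueness of Lebesgue
    measure does the rest. *)
Lemma lebesgue_measure_scale (c : R) (c0 : 0 < c) (A : set R) : measurable A ->
  pushforward (mscale (NngNum (ltW c0)) mu) ( *%R c : _ -> measurableTypeR R) A = mu A.
Proof.
move=> mA; apply/esym/lebesgue_measure_unique => //= _ [[a b]] _ <-.
rewrite /pushforward /mscale/=.
rewrite (_ : _ @^-1` _ = `]c^-1 * a, c^-1 * b]%classic); last first.
  by apply/seteqP; split => t /=; rewrite !in_itv/= ltr_pdivrMl// ler_pdivlMl.
rewrite !lebesgue_measure_itv/= !lte_fin ltr_pM2l ?invr_gt0//.
case: ifPn => _; last by rewrite mule0.
by rewrite -EFinB -EFinM -mulrBr mulrA divff ?mul1r ?gt_eqF.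
Qed.

Lemma lebesgue_measure_shift (c : R) (A : set R) : measurable A ->
  mu ((fun t => t - c) @^-1` A) = mu A.
Proof.
move=> mA.
rewrite -[LHS]/(pushforward mu (fun t : measurableTypeR R => t - c : measurableTypeR R) A).
apply/esym/lebesgue_measure_unique => //=; first exact: measurable_funB.
move=> _ _ [[a b]] _ <-.
rewrite /pushforward (_ : _ @^-1` _ = `]a + c, b + c]%classic); last first.
  by apply/seteqP; split => t /=; rewrite !in_itv/= ltrBrDr lerBlDr.
by rewrite !lebesgue_measure_itv/= !lte_fin ltrD2r -!EFinB opprD addrACA subrr addr0.
Qed.

Lemma integral_scale (c : R) (f : R -> \bar R) : 0 < c ->
  (forall t, 0 <= f t)%E -> measurable_fun setT (f : measurableTypeR R -> \bar R) ->
  (\int[mu]_t f t = c%:E * \int[mu]_t f (c * t)%R)%E.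
Proof.
move=> c0 f0 mf.
transitivity (\int[pushforward (mscale (NngNum (ltW c0)) mu)
    ( *%R c : _ -> measurableTypeR R)]_t f t)%E.
  apply: eq_measure_integral => A mA _ /=.
  exact/esym/lebesgue_measure_scale.
rewrite ge0_integral_pushforward//= ?preimage_setT ?ge0_integral_mscale//.
by apply: measurableT_comp => //; exact: measurable_funM.
Qed.

(** Each of the [k] one-dimensional integrals contributes one factor [c]. This is what turns radii
    into powers in [vol_cone_ball]. *)
Lemma leb_iint_scale k (c : R) (f : 'rV[R]_k -> \bar R) : 0 < c ->
  (forall x, 0 <= f x)%E -> rv_measurable f ->
  (leb_iint f = (c ^+ k)%:E * leb_iint (fun x => f (c *: x)))%E.
Proof.
move=> c0; elim: k f => [|k IH] f f0 mf.
  by rewrite /= expr0 mul1e; congr f; apply/rowP => -[].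
rewrite /= (integral_scale c0); last 2 first.
- by move=> t; exact: leb_iint_ge0.
- exact: measurable_leb_iint_cons.
rewrite exprS EFinM -muleA; congr (_ * _)%E.
rewrite -ge0_integralZl_EFin//; last 3 first.
- by move=> t _; exact: leb_iint_ge0.
- apply: (@measurable_leb_iint_cons _ (fun x => f (c *: x))) => // d T u mu'.
  apply: (mf _ _ (fun w => c *: u w)) => i.
  rewrite (_ : (fun _ => _) = (fun w => c * u w ord0 i)); last first.
    by apply/funext => w; rewrite mxE.
  exact: measurable_funM.
- by rewrite exprn_ge0// ltW.
apply: eq_integral => t _.
rewrite (IH (fun y => f (cons_rv (c * t) y)))//; last exact: rv_measurable_cons.
by congr (_ * _)%E; apply: eq_leb_iint => y; rewrite cons_rvZ.
Qed.

End iterated_integral.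


(** * Measurability of functions continuous off the origin, and bounds by boxes *)

Section continuous_rv_measurable.
Context {R : realType}.
Local Notation mu := (@lebesgue_measure R).

(** An open set is the countable union of the cubes with rational centre and half-side 1/(j+1) that
    it contains; the preimage of a cube is a finite intersection of conditions on single
    coordinates. *)
Lemma measurable_preimage_open k d (T : measurableType d) (u : T -> 'rV[R]_k)
    (O : set 'rV[R]_k) :
  (forall i, measurable_fun setT (fun w => u w ord0 i)) ->
  open O -> measurable (u @^-1` O).
Proof.
move=> mu' oO.
pose J := ('rV[rat]_k * nat)%type.
pose B (p : J) := [set x : 'rV[R]_k |
  forall i, `|ratr (p.1 ord0 i) - x ord0 i| < p.2.+1%:R^-1].
pose F (p : J) : set T := if `[< B p `<=` O >] then u @^-1` B p else set0.
rewrite (_ : _ @^-1` _ = \bigcup_p F p).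
  apply: countable_bigcupT_measurable => [|p]; first exact: countableP.
  rewrite /F; case: asboolP => // _.
  rewrite (_ : _ @^-1` _ = \bigcap_(i in [set: 'I_k])
      [set w | `|ratr (p.1 ord0 i) - u w ord0 i| < p.2.+1%:R^-1]); last first.
    by apply/seteqP; split => w /= h i; [move=> _|]; exact: h.
  apply: fin_bigcap_measurable => // i _.
  have mf : measurable_fun setT (fun w => `|ratr (p.1 ord0 i) - u w ord0 i| < p.2.+1%:R^-1).
    apply: measurable_fun_ltr => //; apply: measurableT_comp => //.
    exact: measurable_funB.
  by have := mf measurableT [set true] I; rewrite setTI; congr (measurable _);
    apply/seteqP; split => w /=.
apply/seteqP; split => [w /= Ow|w [p _]]; last first.
  by rewrite /F; case: asboolP => // BO uB; exact: BO.
have /nbhs_ballP[e /= e0 eO] : nbhs (u w) O by exact: open_nbhs_nbhs.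
(* Half-side below e/2: [u w] and every point of the cube are this close to the rational centre, so
   the cube stays in the ball of radius [e]. *)
have [j je] : exists j : nat, j.+1%:R^-1 < e / 2.
  have /ltr_add_invr[j] : 0 < e / 2 by rewrite divr_gt0.
  by rewrite add0r => h; exists j.
have cP i : exists q : rat, `|ratr q - u w ord0 i| < j.+1%:R^-1.
  have /rat_in_itvoo[q] : u w ord0 i - j.+1%:R^-1 < u w ord0 i + j.+1%:R^-1.
    by rewrite ltrBlDr -addrA ltrDl -mulr2n pmulrn_lgt0 ?invr_gt0.
  rewrite in_itv/= => /andP[q1 q2]; exists q.
  by rewrite ltr_distl q1 q2.
have [c hc] := choice cP.
exists (\row_i c i, j) => //; rewrite /F asboolT/=.
  by move=> i; rewrite mxE.
move=> x xB; apply: eO; split => // i0 i; rewrite (ord1 i0) /ball/=.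
have := xB i; rewrite /= mxE => h1; have h2 := hc i.
rewrite (_ : _ - _ = (ratr (c i) - x ord0 i) - (ratr (c i) - u w ord0 i)); last by ring.
apply: le_lt_trans (ler_normB _ _) _; rewrite [e]splitr.
by apply: ltrD; apply: lt_trans je.
Qed.

(** Nothing is known at the origin, so the value there is fixed to be 0. The preimage of an open
    interval is then that of an open set, together with that of the origin if the interval contains
    0. *)
Lemma rv_measurable_continuous k (g : 'rV[R]_k -> R) :
  (forall x, x != 0 -> {for x, continuous g}) ->
  rv_measurable (fun x => if x != 0 then g x else 0).
Proof.
move=> cg d T u mu'.
apply: (measurability _ (RGenOpens.measurableE R)).
move=> _ [_ [a [b ->] <-]]; rewrite setTI.
have oN0 : open [set x : 'rV[R]_k | x != 0].
  rewrite (_ : mkset _ = ~` [set 0]); last by apply/seteqP; split => x /= /eqP.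
  exact/closed_openC/accessible_closed_set1/hausdorff_accessible/norm_hausdorff.
have oO : open [set x : 'rV[R]_k | x != 0 /\ g x \in `]a, b[].
  rewrite openE => x /= [x0 gx]; rewrite /interior/=.
  have h1 : \forall y \near x, y != 0 by exact: (open_nbhs_nbhs (conj oN0 x0)).
  have h2 : \forall y \near x, g y \in `]a, b[.
    exact: (cg x x0 [set t | t \in `]a, b[]) (near_in_itvoo gx).
  by near=> y; split; near: y.
have -> : ((fun x => if x != 0 then g x else 0) \o u) @^-1` `]a, b[%classic =
    u @^-1` [set x : 'rV[R]_k | x != 0 /\ g x \in `]a, b[] `|`
    (if 0 \in `]a, b[ then u @^-1` (~` [set x | x != 0]) else set0).
  apply/seteqP; split => w /=; rewrite ?inE.
    case: ifPn => [w0 h|/negPn w0 h]; first by left.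
    by right; rewrite ifT//= => /negP; apply.
  case; first by case=> -> .
  by case: ifPn => //= h; rewrite /setC/=; case: ifPn.
apply: measurableU; first exact: measurable_preimage_open.
case: ifPn => [_|_]; last exact: measurable0.
rewrite preimage_setC; apply: measurableC; exact: measurable_preimage_open mu' oN0.
Unshelve. all: by end_near.
Qed.

Lemma rv_measurable_enorm k : rv_measurable (@enorm R k).
Proof.
move=> d T u mu'.
have -> : @enorm R k \o u = Num.sqrt \o (fun w => \sum_(i < k) u w ord0 i ^+ 2) by [].
apply: measurableT_comp; first by apply: continuous_measurable_fun; exact: sqrt_continuous.
by apply: measurable_sum => i; exact: measurable_funX.
Qed.

Lemma rv_measurable_neq0 k : rv_measurable (fun x : 'rV[R]_k => x != 0).
Proof.
move=> d T u mu'.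
have h : measurable_fun setT (fun w => if u w != 0 then 1 else 0 : R).
  apply: (@rv_measurable_continuous k (fun=> 1)) => [x _|//].
  exact: (@cst_continuous _ _ (1 : R)).
have /= := measurable_fun_ltr (@measurable_cst _ _ _ _ setT (0 : R)) h.
congr (measurable_fun _ _); apply/funext => w /=.
by case: ifPn => _; rewrite ?ltr01 ?ltxx.
Qed.

Lemma leb_iint_box_ge k (f : 'rV[R]_k -> \bar R) (p : 'rV[R]_k) (c e : R) :
  rv_measurable f -> (forall x, 0 <= f x)%E -> 0 <= c -> 0 < e ->
  (forall x : 'rV[R]_k, (forall i, (p ord0 i <= x ord0 i <= p ord0 i + e)%R) -> c%:E <= f x)%E ->
  ((c * e ^+ k)%:E <= leb_iint f)%E.
Proof.
move=> + + c0 e0; elim: k f p => [|k IH] f p mf f0 cf.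
  by rewrite expr0 mulr1 /=; apply: cf => -[].
pose p0 := p ord0 ord0; pose p1 := p0 + e.
pose q : 'rV[R]_k := \row_i p ord0 (lift ord0 i).
have : (\int[mu]_(t in `[p0, p1]%classic) (c * e ^+ k)%:E
    <= leb_iint f)%E.
  apply: (@le_trans _ _ (\int[mu]_(t in `[p0, p1]%classic)
    leb_iint (fun y => f (cons_rv t y)))%E).
    apply: ge0_le_integral => //.
    - by move=> t _; rewrite lee_fin mulr_ge0// exprn_ge0// ltW.
    - apply: measurable_funTS; exact: measurable_leb_iint_cons.
    - move=> t /=; rewrite in_itv/= => tp.
      apply: (IH _ q) => //; first exact: rv_measurable_cons.
      move=> x xq; apply: cf => i; case: (unliftP ord0 i) => [j|] ->.
        by rewrite cons_rv_lift; have := xq j; rewrite mxE.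
      by rewrite cons_rv0.
  apply: ge0_subset_integral => //=.
    exact: measurable_leb_iint_cons.
  by move=> t _; exact: leb_iint_ge0.
rewrite integral_cst//= lebesgue_measure_itv/= lte_fin ltrDl e0.
by rewrite -EFinB /p1 addrAC subrr add0r -EFinM exprSr mulrA.
Qed.

Lemma leb_iint_box_le k (f : 'rV[R]_k -> \bar R) (c e : R) :
  rv_measurable f -> (forall x, 0 <= f x)%E -> 0 <= c -> 0 < e ->
  (forall x, f x <= c%:E)%E ->
  (forall x : 'rV[R]_k, (exists i, (e < `|x ord0 i|)%R) -> f x = 0)%E ->
  (leb_iint f <= (c * (2 * e) ^+ k)%:E)%E.
Proof.
move=> + + c0 e0; elim: k f => [|k IH] f mf f0 fc fe.
  by rewrite expr0 mulr1 /=; exact: fc.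
pose e1 := - e.
have -> : leb_iint f = (\int[mu]_(t in `[e1, e]%classic)
    leb_iint (fun y => f (cons_rv t y)))%E.
  rewrite /= [RHS]integral_mkcond; apply: eq_integral => t _; rewrite patchE.
  case: ifPn => // /negP; rewrite inE/= in_itv/= => te.
  apply: etrans (leb_iint0 k); apply: eq_leb_iint => y; apply: fe; exists ord0.
  by rewrite cons_rv0 ltNge ler_norml; apply/negP.
apply: (@le_trans _ _ (\int[mu]_(t in `[e1, e]%classic) (c * (2 * e) ^+ k)%:E)%E).
  apply: ge0_le_integral => //.
  - by move=> t _; exact: leb_iint_ge0.
  - apply: measurable_funTS; exact: measurable_leb_iint_cons.
  - move=> t _; apply: IH => //; first exact: rv_measurable_cons.
    by move=> x [i xi]; apply: fe; exists (lift ord0 i); rewrite cons_rv_lift.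
rewrite integral_cst//= lebesgue_measure_itv/= lte_fin gtrN//.
by rewrite /e1 opprK -EFinD -mulr2n -(mulr_natl e) -EFinM exprSr mulrA.
Qed.

End continuous_rv_measurable.


(** * Brunn-Minkowski inequality *)

Section brunn_minkowski.
Context {R : realType}.
Local Notation mu := (@lebesgue_measure R).

(** One-dimensional Brunn-Minkowski. With [a0] close to sup A and [b0] close to inf B, the
    translates A + b0 and B + a0 lie in C and are almost disjoint: the first stays below sup A + b0,
    the second above a0 + inf B. *)
Lemma lebesgue_measureD_ge (A B C : set R) (e : R) :
  measurable A -> measurable B -> measurable C -> A !=set0 -> B !=set0 ->
  (forall a, A a -> `|a| <= e) -> (forall b, B b -> `|b| <= e) ->
  (forall a b, A a -> B b -> C (a + b)) -> (mu A + mu B <= mu C)%E.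
Proof.
move=> mA mB mC A0 B0 Ae Be ABC.
have supA : has_sup A.
  by split=> //; exists e => a /Ae; rewrite ler_norml => /andP[].
have infB : has_inf B.
  by split=> //; exists (- e) => b /Be; rewrite ler_norml => /andP[].
(* Each of the two translates gives up [J], whose length is at most 2d; the total loss 4d has to be
   [e']. *)
apply/lee_addgt0Pr => e' e'0; pose d := e' / 4.
have d0 : 0 < d by rewrite divr_gt0.
have [a0 Aa0 a0d] := sup_adherent d0 supA.
have [b0 Bb0 b0d] := inf_adherent d0 infB.
(* The two translates of A and B inside C overlap at most in J. *)
pose J : set R := `[a0 + inf B, sup A + b0]%classic.
have muJ : (mu J <= (2 * d)%:E)%E.
  rewrite lebesgue_measure_itv/= lte_fin; case: ifPn => _; rewrite -?EFinB lee_fin; lra.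
pose C1 := (fun t => t - b0) @^-1` A; pose C2 := (fun t => t - a0) @^-1` B.
have mshift (c : R) D : measurable D -> measurable ((fun t : R => t - c) @^-1` D).
  move=> mD; rewrite -[X in measurable X]setTI.
  by apply: (measurable_funB (@measurable_id _ _ setT) (measurable_cst c)).
have mJ : measurable J by exact: measurable_itv.
have mC1 : measurable C1 by exact: mshift.
have mC2 : measurable C2 by exact: mshift.
have split_J D : measurable D -> (mu D <= mu (D `\` J) + (2 * d)%:E)%E.
  move=> mD; apply: (@le_trans _ _ (mu (D `\` J) + mu J)%E); last exact: leeD.
  apply: (@le_trans _ _ (mu ((D `\` J) `|` J))).
    apply: le_measure; rewrite ?inE//.
      by apply: measurableU => //; exact: measurableD.
    by move=> t Dt; case: (pselect (J t)) => Jt; [right|left].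
  by apply: measureU2 => //; exact: measurableD.
rewrite -(lebesgue_measure_shift b0 mA) -(lebesgue_measure_shift a0 mB).
apply: le_trans (leeD (split_J _ mC1) (split_J _ mC2)) _.
rewrite addeACA -EFinD (_ : 2 * d + 2 * d = e'); last by rewrite /d; field.
rewrite leeD2r// -measureU//; last 3 first.
- exact: measurableD.
- exact: measurableD.
- apply/seteqP; split=> // t [[/= At nJ] [/= Bt _]]; apply: nJ.
  rewrite /J/= in_itv/=; apply/andP; split.
    by rewrite addrC -lerBrDr; apply: ge_inf => //; case: infB.
  by rewrite -lerBlDr; apply: ub_le_sup => //; case: supA.
apply: le_measure; rewrite ?inE//.
  by apply: measurableU => //; exact: measurableD.
move=> t [[/= At _]|[/= Bt _]].
  by rewrite -(subrK b0 t); exact: ABC.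
by rewrite -(subrK a0 t) addrC; exact: ABC.
Qed.

Local Notation GR := (measurableTypeR R).

(** The region under the graph, cut off at height 1, to which Tonelli is applied. *)
Let level (F : GR -> \bar R) : set (GR * GR) :=
  [set p | 0 < p.2 < 1 /\ (p.2%:E < F p.1)%E].

Let measurable_level F : measurable_fun setT F -> measurable (level F).
Proof.
move=> mF.
have m1 : measurable_fun setT (fun p : GR * GR => (0 < p.2) && (p.2 < 1)).
  by apply: measurable_and; apply: measurable_fun_ltr.
have m2 : measurable_fun setT (fun p : GR * GR => (p.2%:E < F p.1)%E).
  apply: measurable_fun_lte => //; last exact: measurableT_comp.
  by apply/measurable_EFinP.
have /(_ measurableT [set true] I) := measurable_and m1 m2.
rewrite setTI; congr (measurable _); apply/seteqP; split => p /=; rewrite /level/=.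
  by move/andP.
by case=> -> ->.
Qed.

Lemma layer_cake_unit (F : GR -> \bar R) : measurable_fun setT F ->
  (forall t, 0 <= F t)%E -> (forall t, F t <= 1)%E ->
  (\int[mu]_t F t = \int[mu]_(s in `]0%R, 1%R[) mu [set t | s%:E < F t])%E.
Proof.
move=> mF F0 F1; have mL := measurable_level mF.
transitivity (\int[mu]_t \int[mu]_s (\1_(level F) (t, s))%:E)%E.
  apply: eq_integral => t _; rewrite integral_indic//=; last first.
    by have := measurable_xsection t mL; rewrite xsectionE.
  have := F0 t; have := F1 t; case Ft : (F t) => [r| |]// r1 r0.
  rewrite (_ : (fun _ => _) `&` _ = `]0, r[%classic).
    rewrite lebesgue_measure_itv/= lte_fin -EFinB subr0.
    by move: r0; rewrite lee_fin le_eqVlt => /orP[/eqP <-|->//]; rewrite ltxx.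
  apply/seteqP; split => s; rewrite /level/= in_itv/= Ft lte_fin.
    by case=> -[/andP[-> _] ->].
  by move=> /andP[s0 sr]; rewrite s0 (lt_le_trans sr).
rewrite (fubini_tonelli (fun p : GR * GR => (\1_(level F) p)%:E))//=; last first.
  by apply/measurable_EFinP; exact: measurable_indic.
rewrite [RHS]integral_mkcond; apply: eq_integral => s _; rewrite patchE.
rewrite integral_indic//; last by have := measurable_ysection s mL; rewrite ysectionE.
rewrite setIT; case: ifPn => [|/negP]; rewrite inE/= in_itv/= => s01.
  congr (mu _); apply/seteqP; split => t /=; first by case.
  by move=> sF; split.
rewrite (_ : (fun _ => _) = set0) ?measure0//; apply/seteqP; split => t//=.
by case.
Qed.
(** A variant of the Prekopa-Leindler inequality for functions normalised to supremum 1: the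
    superlevel sets satisfy {F > s} + {G > s} <= {H > s}, so one-dimensional Brunn-Minkowski applies
    at each level and the levels are integrated. Every level below 1 must be reached by both
    functions, since Brunn-Minkowski fails for empty sets. *)
Lemma integral_layer_superadditive (F G H : GR -> \bar R) (e : R) :
  measurable_fun setT F -> measurable_fun setT G -> measurable_fun setT H ->
  (forall t, 0 <= F t <= 1)%E -> (forall t, 0 <= G t <= 1)%E ->
  (forall t, 0 <= H t)%E ->
  (forall t, e < `|t| -> F t = 0%E) -> (forall t, e < `|t| -> G t = 0%E) ->
  (forall s, 0 < s < 1 -> exists t, (s%:E < F t)%E) ->
  (forall s, 0 < s < 1 -> exists t, (s%:E < G t)%E) ->
  (forall s t u, 0 < s < 1 -> (s%:E < F t)%E -> (s%:E < G u)%E -> (s%:E <= H (t + u)%R)%E) ->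
  (\int[mu]_t F t + \int[mu]_t G t <= \int[mu]_t H t)%E.
Proof.
move=> mF mG mH F01 G01 H0 Fe Ge Fs Gs FGH.
have F0 t : (0 <= F t)%E by case/andP: (F01 t).
have F1 t : (F t <= 1)%E by case/andP: (F01 t).
have G0 t : (0 <= G t)%E by case/andP: (G01 t).
have G1 t : (G t <= 1)%E by case/andP: (G01 t).
(* Truncating at 1 only lowers the integral, and makes the layer-cake formula over levels in ]0, 1[
   available. *)
pose K t := mine (H t) 1%E.
have mK : measurable_fun setT K by apply: measurable_mine.
have msup (P : GR -> \bar R) (s : R) : measurable_fun setT P ->
    measurable [set t | (s%:E < P t)%E].
  move=> mP; have := emeasurable_fun_o_infty measurableT mP s%:E.
  by rewrite setTI.
have mlev (P : GR -> \bar R) : measurable_fun setT P ->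
    measurable_fun setT (fun s : GR => mu [set t | (s%:E < P t)%E]).
  move=> mP.
  have mA : measurable [set p : GR * GR | (p.2%:E < P p.1)%E].
    have m2 : measurable_fun setT (fun p : GR * GR => (p.2%:E < P p.1)%E).
      apply: measurable_fun_lte; last exact: measurableT_comp.
      by apply/measurable_EFinP.
    have /(_ measurableT [set true] I) := m2; rewrite setTI.
    by congr (measurable _); apply/seteqP; split => p /=.
  have := measurable_fun_ysection mu mA; congr (measurable_fun _ _).
  by apply/funext => s /=; rewrite ysectionE.
apply: (@le_trans _ _ (\int[mu]_t K t)%E); last first.
  apply: ge0_le_integral => // t _; rewrite /K ?le_min ?H0 ?lee01//.
  by rewrite ge_min lexx.
rewrite !layer_cake_unit//; last 2 first.
- by move=> t; rewrite le_min H0 lee01.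
- by move=> t; rewrite ge_min lexx orbT.
rewrite -ge0_integralD//; last 2 first.
- by apply: measurable_funTS; exact: mlev.
- by apply: measurable_funTS; exact: mlev.
apply: ge0_le_integral => //.
- by move=> s _; rewrite adde_ge0.
- apply: measurable_funTS; apply: emeasurable_funD; exact: mlev.
- by apply: measurable_funTS; exact: mlev.
move=> s /=; rewrite in_itv/= => s01; have /andP[s0 s1] := s01.
(* The hypothesis on [H] yields only a weak inequality; applying it at a level [r'] strictly between
   s and min (F t) (G u) restores strictness. *)
have FGK t u : (s%:E < F t)%E -> (s%:E < G u)%E -> (s%:E < K (t + u)%R)%E.
  move=> sF sG; have : (s%:E < mine (F t) (G u))%E by rewrite lt_min sF.
  have : (mine (F t) (G u) <= 1)%E by rewrite ge_min F1.
  case E : mine => [r| |]//; rewrite lee_fin lte_fin => r1 sr.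
  have [r' sr' r'r] : exists2 r', s < r' & r' < r.
    by exists ((s + r) / 2); rewrite ?midf_lt//; lra.
  have r'FG : (r'%:E < mine (F t) (G u))%E by rewrite E lte_fin.
  rewrite lt_min in r'FG; case/andP: r'FG => r'F r'G.
  have := @FGH r' t u _ r'F r'G; rewrite (lt_trans s0 sr') (lt_le_trans r'r r1).
  move=> /(_ isT) r'H; rewrite /K lt_min lte_fin s1 andbT.
  by apply: lt_le_trans r'H; rewrite lte_fin.
have [[t Ft] [u Gu]] := (Fs s s01, Gs s s01).
apply: (@lebesgue_measureD_ge _ _ _ e) => //; rewrite ?/K; try exact: msup.
- by exists t.
- by exists u.
- by move=> v /=; apply: contraTle => /Fe ->; rewrite lte_fin -leNgt ltW.
- by move=> v /=; apply: contraTle => /Ge ->; rewrite lte_fin -leNgt ltW.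
Qed.

End brunn_minkowski.


(** * Brunn-Minkowski in all dimensions, by slicing *)

Section brunn_minkowski_vol.
Context {R : realType}.
Local Notation mu := (@lebesgue_measure R).

Definition vol k (A : 'rV[R]_k -> bool) : \bar R :=
  leb_iint (fun x => if A x then 1%E else 0%E).

Lemma rv_measurable_indic k (A : 'rV[R]_k -> bool) : rv_measurable A ->
  rv_measurable (fun x => if A x then 1%E else 0%E : \bar R).
Proof. by move=> mA d T u mu'; apply: measurable_fun_ifT => //; exact: mA. Qed.

Lemma vol_ge0 k (A : 'rV[R]_k -> bool) : (0 <= vol A)%E.
Proof. by apply: leb_iint_ge0 => x; case: ifP. Qed.

Lemma le_vol k (A B : 'rV[R]_k -> bool) : rv_measurable A -> rv_measurable B ->
  (forall x, A x -> B x) -> (vol A <= vol B)%E.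
Proof.
move=> mA mB AB; apply: le_leb_iint; try exact: rv_measurable_indic.
  by move=> x; case: ifP.
by move=> x; case: ifPn => [/AB ->//|_]; case: ifP.
Qed.

Lemma vol_box_le k (A : 'rV[R]_k -> bool) (e : R) : rv_measurable A -> 0 < e ->
  (forall x, A x -> forall i, `|x ord0 i| <= e) -> (vol A <= ((2 * e) ^+ k)%:E)%E.
Proof.
move=> mA e0 Ae; rewrite -[(2 * e) ^+ k]mul1r.
apply: leb_iint_box_le => //; first exact: rv_measurable_indic.
- by move=> x; case: ifP.
- by move=> x; case: ifP.
- by move=> x [i]; case: ifPn => // /Ae /(_ i) h; rewrite ltNge h.
Qed.

(** The graph of x^(k+1) lies above its tangent at [t]. In the induction step the previous
    inequality times [u] is combined with (k+1) t^k (u - t)^2 >= 0. *)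
Lemma exprS_tangent (k : nat) (u t : R) : 0 <= u -> 0 <= t ->
  k.+1%:R * u * t ^+ k <= u ^+ k.+1 + k%:R * t ^+ k.+1.
Proof.
move=> u0 t0; elim: k => [|k IH]; first by rewrite expr0 expr1 !mul1r mul0r mulr1 addr0.
have := ler_wpM2l u0 IH.
have : 0 <= k.+1%:R * t ^+ k * (u - t) ^+ 2.
  by rewrite mulr_ge0 ?sqr_ge0// mulr_ge0// exprn_ge0.
rewrite !(exprS _ k.+1) !(exprS _ k) -!natr1.
by set U := u ^+ k; set V := t ^+ k; set n := k%:R; lra.
Qed.

(** The perspective a^(k+1) / p^k of a convex power is subadditive. Both terms are bounded below by
    tangents at the common ratio t = (a+b)/(p+q), and the sum of these bounds is exactly (a+b)
    t^k. *)
Lemma expr_perspective_le (k : nat) (a b p q : R) : 0 < a -> 0 < b -> 0 < p -> 0 < q ->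
  (a + b) ^+ k.+1 <= (p + q) ^+ k * (a ^+ k.+1 / p ^+ k + b ^+ k.+1 / q ^+ k).
Proof.
move=> a0 b0 p0 q0; set t := (a + b) / (p + q).
have pq0 : 0 < p + q by exact: addr_gt0.
have t0 : 0 <= t by rewrite divr_ge0// ltW// addr_gt0.
have tang x y : 0 < x -> 0 < y ->
    k.+1%:R * x * t ^+ k - k%:R * y * t ^+ k.+1 <= x ^+ k.+1 / y ^+ k.
  move=> x0 y0; have u0 : 0 <= x / y by rewrite divr_ge0// ltW.
  have := ler_wpM2r (ltW y0) (exprS_tangent k u0 t0).
  rewrite (expr_div_n x y) (exprS y) => h.
  rewrite -subr_ge0; rewrite -subr_ge0 in h; apply: le_trans h _.
  rewrite le_eqVlt; apply/orP; left; apply/eqP; field.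
  by rewrite expf_neq0 ?gt_eqF.
have h : (a + b) * t ^+ k <= a ^+ k.+1 / p ^+ k + b ^+ k.+1 / q ^+ k.
  have e1 : (p + q) * t ^+ k.+1 = (a + b) * t ^+ k.
    by rewrite exprS mulrA /t; congr (_ * _); field; rewrite gt_eqF.
  have := lerD (tang a p a0 p0) (tang b q b0 q0).
  apply: le_trans; rewrite [leRHS](_ : _ = (k.+1%:R * ((a + b) * t ^+ k)) -
    k%:R * ((p + q) * t ^+ k.+1)); last by ring.
  by rewrite e1 -natr1; set X := _ * t ^+ k; lra.
apply: le_trans (ler_wpM2l (exprn_ge0 k (ltW pq0)) h).
rewrite mulrCA -exprMn (_ : (p + q) * t = a + b) ?exprS//.
by rewrite /t; field; rewrite gt_eqF.
Qed.

(** Supplies the normalising constant for slice volumes: after division by [s], every level in ]0,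
    1[ is reached, as [integral_layer_superadditive] requires. *)
Lemma ereal_sup_fin_approx (T : Type) (F : T -> \bar R) (M : R) :
  (forall t, 0 <= F t <= M%:E)%E -> (exists t, 0 < F t)%E ->
  exists2 s : R, 0 < s & (forall t, F t <= s%:E)%E /\
    (forall x : R, 0 < x < 1 -> exists t, ((x * s)%:E < F t)%E).
Proof.
move=> FM [t0 Ft0]; pose S := ereal_sup (range F).
have FS t : (F t <= S)%E by apply: ereal_sup_ubound; exists t.
have SM : (S <= M%:E)%E.
  by apply: ge_ereal_sup => _ [t _ <-]; case/andP: (FM t).
have S0 : (0 < S)%E by exact: lt_le_trans (FS t0).
case ES : S FS SM S0 => [s| |]// FS SM S0; exists s => //; split=> // x /andP[x0 x1].
have : ((x * s)%:E < S)%E by rewrite ES lte_fin gtr_pMl.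
by move=> /ereal_sup_gt[_ [t _ <-] h]; exists t.
Qed.

Lemma root_exists (k : nat) (x : R) : 0 < x -> exists2 y : R, 0 < y & y ^+ k.+1 = x.
Proof.
move=> x0; exists (x `^ (k.+1%:R)^-1); first exact: powR_gt0.
by rewrite -powR_mulrn ?powR_ge0// -powRrM mulVf ?powRr1// ltW.
Qed.

(** Slices are normalised by their largest volumes [MA] and [MB], and the integrated slices are
    recombined with [expr_perspective_le]. The factor [c] makes the induction close: slices at a
    common relative level s have volumes at least c p^(k+1) and c 1^(k+1) with the same c = s MB. *)
Lemma brunn_minkowski_scaled k (A B C : 'rV[R]_k.+1 -> bool) (c a b e : R) :
  rv_measurable A -> rv_measurable B -> rv_measurable C ->
  0 < c -> 0 < a -> 0 < b -> 0 < e ->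
  (forall x, A x -> forall i, `|x ord0 i| <= e) ->
  (forall x, B x -> forall i, `|x ord0 i| <= e) ->
  (forall x y, A x -> B y -> C (x + y)) ->
  ((c * a ^+ k.+1)%:E <= vol A)%E -> ((c * b ^+ k.+1)%:E <= vol B)%E ->
  ((c * (a + b) ^+ k.+1)%:E <= vol C)%E.
Proof.
elim: k A B C c a b => [|k IH] A B C c a b mA mB mC c0 a0 b0 e0 Ae Be ABC vA vB.
  pose P (A : 'rV[R]_1 -> bool) := [set t : R | A (cons_rv t 0)].
  have volP A' : rv_measurable A' -> measurable (P A') /\ vol A' = mu (P A').
    move=> mA'; have mPA : measurable (P A').
      have := mA' _ _ (fun t : measurableTypeR R => cons_rv t 0).
      move=> /(_ _ measurableT [set true] I); rewrite setTI; apply.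
      by apply: measurable_cons_rv => // -[].
    split=> //; rewrite -[P A']setIT -integral_indic//.
    rewrite /vol /=; apply: eq_integral => t _; rewrite indicE /P.
    by case: ifPn => At; [rewrite mem_set | rewrite memNset//; exact/negP].
  have [mPA vPA] := volP _ mA; have [mPB vPB] := volP _ mB.
  have [mPC ->] := volP _ mC.
  move: vA vB; rewrite vPA vPB !expr1 mulrDr EFinD => vA vB.
  apply: le_trans (leeD vA vB) _.
  have ne D x : 0 < x -> ((c * x)%:E <= mu D)%E -> D !=set0.
    move=> x0 h; apply/set0P/negP => /eqP D0; move: h.
    by rewrite D0 measure0 lee_fin leNgt mulr_gt0.
  apply: (lebesgue_measureD_ge (e := e)) => //.
  - exact: ne vA.
  - exact: ne vB.
  - by move=> t /Ae /(_ ord0); rewrite cons_rv0.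
  - by move=> t /Be /(_ ord0); rewrite cons_rv0.
  - move=> s t As Bt; have := ABC _ _ As Bt.
    by rewrite -cons_rvD addr0.
pose sl (A : 'rV[R]_k.+2 -> bool) t := vol (fun y => A (cons_rv t y)).
have slE A' : vol A' = (\int[mu]_t sl A' t)%E by [].
have msl A' : rv_measurable A' -> measurable_fun setT (sl A' : measurableTypeR R -> \bar R).
  move=> mA'.
  apply: (measurable_leb_iint_cons (f := fun x => if A' x then 1%E else 0%E)).
    by move=> x; case: ifP.
  exact: rv_measurable_indic.
have sl0 A' t : (0 <= sl A' t)%E by exact: vol_ge0.
have sl_out (A' : 'rV[R]_k.+2 -> bool) t : (forall x : 'rV[R]_k.+2, A' x -> forall i, `|x ord0 i| <= e) ->
    e < `|t| -> sl A' t = 0%E.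
  move=> A'e et; rewrite -[RHS](@leb_iint0 R k.+1); apply: eq_leb_iint => y.
  by case: ifPn => // /A'e /(_ ord0); rewrite cons_rv0 leNgt et.
have slM (A' : 'rV[R]_k.+2 -> bool) : rv_measurable A' -> (forall x : 'rV[R]_k.+2, A' x -> forall i, `|x ord0 i| <= e) ->
    forall t, (0 <= sl A' t <= ((2 * e) ^+ k.+1)%:E)%E.
  move=> mA' A'e t; rewrite sl0/=; apply: vol_box_le => //.
    exact: (rv_measurable_cons (f := A')).
  by move=> y /A'e Ay i; rewrite -(cons_rv_lift t).
have slpos A' x : 0 < x -> ((c * x ^+ k.+2)%:E <= vol A')%E -> (exists t, 0 < sl A' t)%E.
  move=> x0 h; apply: contrapT => /forallNP sn; move: h.
  have cx : 0 < c * x ^+ k.+2 by apply: mulr_gt0 => //; exact: exprn_gt0.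
  rewrite slE integral0_eq ?lee_fin ?leNgt ?cx// => t _.
  by apply/eqP; rewrite eq_le sl0 leNgt andbT; apply/negP.
have [MA MA0 [slMA supA]] := ereal_sup_fin_approx (slM A mA Ae) (slpos A a a0 vA).
have [MB MB0 [slMB supB]] := ereal_sup_fin_approx (slM B mB Be) (slpos B b b0 vB).
(* [p] is the ratio of the linear sizes of the largest slices of A and B. The matching lower bound
   for slices of C is s MB (p+1)^(k+1) = s D. *)
have [p p0 pE] := root_exists k (divr_gt0 MA0 MB0).
pose D := MB * (p + 1) ^+ k.+1.
have D0 : 0 < D by rewrite mulr_gt0// exprn_gt0// addr_gt0.
have MAE : MA = MB * p ^+ k.+1 by rewrite pE mulrCA divff ?mulr1// gt_eqF.
have scale (M x : R) (y : \bar R) : 0 < M -> (x%:E < (M^-1)%:E * y)%E = ((x * M)%:E < y)%E.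
  by move=> M0; rewrite lte_pdivlMl// -EFinM mulrC.
have iA0 : 0 <= MA^-1 by rewrite invr_ge0 ltW.
have iB0 : 0 <= MB^-1 by rewrite invr_ge0 ltW.
have iD0 : 0 <= D^-1 by rewrite invr_ge0 ltW.
have key : ((MA^-1)%:E * vol A + (MB^-1)%:E * vol B <= (D^-1)%:E * vol C)%E.
  rewrite !slE -!ge0_integralZl_EFin//; try exact: msl.
  apply: (integral_layer_superadditive (e := e)).
  - by apply: measurable_funeM; exact: msl.
  - by apply: measurable_funeM; exact: msl.
  - by apply: measurable_funeM; exact: msl.
  - move=> t; rewrite mule_ge0//=.
    by rewrite -(@mulVf _ MA) ?gt_eqF// EFinM lee_pmul2l// lte_fin invr_gt0.
  - move=> t; rewrite mule_ge0//=.
    by rewrite -(@mulVf _ MB) ?gt_eqF// EFinM lee_pmul2l// lte_fin invr_gt0.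
  - by move=> t; rewrite mule_ge0.
  - by move=> t et; rewrite sl_out// mule0.
  - by move=> t et; rewrite sl_out// mule0.
  - by move=> s /supA[t h]; exists t; rewrite scale.
  - by move=> s /supB[t h]; exists t; rewrite scale.
  move=> s t u /andP[s0 s1]; rewrite !scale// => hA hB.
  have : ((s * MB * (p + 1) ^+ k.+1)%:E <= sl C (t + u)%R)%E.
    apply: (IH (fun y => A (cons_rv t y)) (fun y => B (cons_rv u y))) => //.
    - exact: (rv_measurable_cons (f := A)).
    - exact: (rv_measurable_cons (f := B)).
    - exact: (rv_measurable_cons (f := C)).
    - by rewrite mulr_gt0.
    - by move=> y /Ae Ay i; rewrite -(cons_rv_lift t).
    - by move=> y /Be By i; rewrite -(cons_rv_lift u).
    - by move=> x y Ax By; rewrite cons_rvD; exact: ABC.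
    - by rewrite -mulrA -MAE ltW.
    - by rewrite expr1n mulr1 ltW.
  rewrite -mulrA -/D => h.
  have : ((D^-1)%:E * (s * D)%:E <= (D^-1)%:E * sl C (t + u)%R)%E.
    by rewrite lee_pmul2l// lte_fin invr_gt0.
  by rewrite -EFinM mulrCA mulVf ?mulr1// gt_eqF.
have : ((D * (MA^-1 * (c * a ^+ k.+2) + MB^-1 * (c * b ^+ k.+2)))%:E <= vol C)%E.
  rewrite lee_pdivlMl// in key; apply: le_trans key.
  rewrite EFinM lee_pmul2l// ?lte_fin// EFinD !EFinM.
  by apply: leeD; rewrite lee_pmul2l// ?lte_fin ?invr_gt0// -EFinM.
apply: le_trans; rewrite lee_fin.
(* The weights of the perspective inequality are [p] and 1, since MA = MB p^(k+1). *)
have := ler_wpM2l (ltW c0) (expr_perspective_le k.+1 a0 b0 p0 ltr01).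
move/le_trans; apply; rewrite le_eqVlt; apply/orP; left; apply/eqP.
rewrite /D MAE expr1n; field.
by rewrite !gt_eqF// exprn_gt0.
Qed.

Lemma brunn_minkowski k (A B C : 'rV[R]_k.+1 -> bool) (a b e : R) :
  rv_measurable A -> rv_measurable B -> rv_measurable C ->
  0 < a -> 0 < b -> 0 < e ->
  (forall x, A x -> forall i, `|x ord0 i| <= e) ->
  (forall x, B x -> forall i, `|x ord0 i| <= e) ->
  (forall x y, A x -> B y -> C (x + y)) ->
  ((a ^+ k.+1)%:E <= vol A)%E -> ((b ^+ k.+1)%:E <= vol B)%E ->
  (((a + b) ^+ k.+1)%:E <= vol C)%E.
Proof.
move=> mA mB mC a0 b0 e0 Ae Be ABC vA vB; rewrite -[_ ^+ _]mul1r.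
by apply: (brunn_minkowski_scaled mA mB mC _ a0 b0 e0 Ae Be ABC); rewrite ?mul1r.
Qed.

End brunn_minkowski_vol.


(** * Euclidean norm and polar coordinates *)

Section euclidean_norm.
Context {R : realType}.
Implicit Types (k : nat).

Lemma cvg_sumr (T I : Type) (F : set_system T) {FF : Filter F} (r : seq I)
    (f : I -> T -> R) (l : I -> R) :
  (forall i, f i x @[x --> F] --> l i) ->
  \sum_(i <- r) f i x @[x --> F] --> \sum_(i <- r) l i.
Proof.
move=> fl; elim: r => [|i r IH].
  by rewrite big_nil; under eq_fun do rewrite big_nil; exact: cvg_cst.
by rewrite big_cons; under eq_fun do rewrite big_cons; exact: cvgD.
Qed.

Lemma cvg_exprn (T : Type) (F : set_system T) {FF : Filter F} (f : T -> R) (l : R) n :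
  f x @[x --> F] --> l -> f x ^+ n @[x --> F] --> l ^+ n.
Proof.
by move=> fl; apply: (@continuous_cvg _ _ _ _ _ f (fun t => t ^+ n) l) => //;
  exact: exprn_continuous.
Qed.

Definition dotr k (x y : 'rV[R]_k) : R := \sum_(i < k) x ord0 i * y ord0 i.

Lemma dotrC k (x y : 'rV[R]_k) : dotr x y = dotr y x.
Proof. by apply: eq_bigr => i _; rewrite mulrC. Qed.

Lemma dotrDl k (x y z : 'rV[R]_k) : dotr (x + y) z = dotr x z + dotr y z.
Proof. by rewrite /dotr -big_split; apply: eq_bigr => i _; rewrite mxE mulrDl. Qed.

Lemma dotrZl k c (x z : 'rV[R]_k) : dotr (c *: x) z = c * dotr x z.
Proof. by rewrite /dotr mulr_sumr; apply: eq_bigr => i _; rewrite mxE mulrA. Qed.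

Lemma dotrDr k (x y z : 'rV[R]_k) : dotr z (x + y) = dotr z x + dotr z y.
Proof. by rewrite dotrC dotrDl !(dotrC z). Qed.

Lemma dotrZr k c (x z : 'rV[R]_k) : dotr z (c *: x) = c * dotr z x.
Proof. by rewrite dotrC dotrZl dotrC. Qed.

Lemma dotrBl k (x y z : 'rV[R]_k) : dotr (x - y) z = dotr x z - dotr y z.
Proof. by rewrite -scaleN1r dotrDl dotrZl mulN1r. Qed.

Lemma dotrNr k (x z : 'rV[R]_k) : dotr z (- x) = - dotr z x.
Proof. by rewrite -scaleN1r dotrZr mulN1r. Qed.

Lemma sqr_enorm k (x : 'rV[R]_k) : enorm x ^+ 2 = dotr x x.
Proof.
rewrite sqr_sqrtr; first by apply: eq_bigr => i _; rewrite expr2.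
by apply: sumr_ge0 => i _; exact: sqr_ge0.
Qed.

Lemma enorm_ge0 k (x : 'rV[R]_k) : 0 <= enorm x. Proof. exact: sqrtr_ge0. Qed.

Lemma enormZ k c (x : 'rV[R]_k) : enorm (c *: x) = `|c| * enorm x.
Proof.
apply/eqP; rewrite -(@eqrXn2 _ 2) ?mulr_ge0 ?enorm_ge0//.
by rewrite exprMn !sqr_enorm dotrZl dotrZr real_normK ?num_real// expr2 mulrA.
Qed.

Lemma normr_coord_le_enorm k (x : 'rV[R]_k) i : `|x ord0 i| <= enorm x.
Proof.
rewrite -(@ler_pXn2r _ 2) ?nnegrE ?enorm_ge0// sqr_enorm real_normK ?num_real//.
rewrite /dotr (bigD1 i)//= -expr2 lerDl.
by apply: sumr_ge0 => j _; rewrite -expr2 sqr_ge0.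
Qed.

Lemma enorm_eq0 k (x : 'rV[R]_k) : (enorm x == 0) = (x == 0).
Proof.
apply/eqP/eqP => [x0|->]; last first.
  by rewrite /enorm big1 ?sqrtr0// => i _; rewrite mxE expr0n.
apply/rowP => i; rewrite mxE; apply/eqP; rewrite -normr_le0 -x0.
exact: normr_coord_le_enorm.
Qed.

Lemma enorm0 k : enorm (0 : 'rV[R]_k) = 0.
Proof. by apply/eqP; rewrite enorm_eq0. Qed.

Lemma enorm_gt0 k (x : 'rV[R]_k) : (0 < enorm x) = (x != 0).
Proof. by rewrite lt_def enorm_ge0 enorm_eq0 andbT. Qed.

Lemma dotr_le_enorm k (x y : 'rV[R]_k) : dotr x y <= enorm x * enorm y.
Proof.
have [->|x0] := eqVneq x 0.
  rewrite enorm0 mul0r le_eqVlt; apply/orP; left; apply/eqP/big1 => i _.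
  by rewrite mxE mul0r.
have [->|y0] := eqVneq y 0.
  rewrite enorm0 mulr0 le_eqVlt; apply/orP; left; apply/eqP/big1 => i _.
  by rewrite mxE mulr0.
have xy0 : 0 < enorm x * enorm y by rewrite mulr_gt0 ?enorm_gt0.
have := sqr_ge0 (enorm (enorm y *: x - enorm x *: y)).
rewrite sqr_enorm -scaleN1r !(dotrDl, dotrDr, dotrZl, dotrZr) -!sqr_enorm (dotrC y).
move=> h; rewrite -subr_ge0 -(@pmulr_rge0 _ (2 * (enorm x * enorm y))); last first.
  by rewrite mulr_gt0.
apply: le_trans h _; rewrite le_eqVlt; apply/orP; left; apply/eqP; ring.
Qed.

Lemma enormD k (x y : 'rV[R]_k) : enorm (x + y) <= enorm x + enorm y.
Proof.
rewrite -(@ler_pXn2r _ 2) ?nnegrE ?addr_ge0 ?enorm_ge0//.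
rewrite sqr_enorm !(dotrDl, dotrDr) -!sqr_enorm (dotrC y) sqrrD.
by have := dotr_le_enorm x y; lra.
Qed.

Lemma enormN k (x : 'rV[R]_k) : enorm (- x) = enorm x.
Proof. by rewrite -scaleN1r enormZ normrN1 mul1r. Qed.

Lemma enorm_continuous k : continuous (@enorm R k).
Proof.
move=> x; apply: (@continuous_comp _ _ _ (fun x : 'rV[R]_k => \sum_(i < k) x ord0 i ^+ 2)
  Num.sqrt); last exact: sqrt_continuous.
apply: (cvg_sumr (FF := nbhs_filter x)) => i.
by apply: (cvg_exprn (FF := nbhs_filter x)); exact: coord_continuous.
Qed.

Lemma enorm_unitize k (x : 'rV[R]_k) : x != 0 -> enorm (unitize x) = 1.
Proof.
by move=> x0; rewrite enormZ ger0_norm ?invr_ge0 ?enorm_ge0// mulVf// enorm_eq0.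
Qed.

Lemma unitize_neq0 k (x : 'rV[R]_k) : x != 0 -> unitize x != 0.
Proof. by move=> x0; rewrite -enorm_eq0 enorm_unitize// oner_eq0. Qed.

Lemma unitizeZ k c (x : 'rV[R]_k) : 0 < c -> unitize (c *: x) = unitize x.
Proof.
move=> c0; rewrite /unitize enormZ gtr0_norm// scalerA invfM mulrAC.
by rewrite mulVf ?mul1r// gt_eqF.
Qed.

Lemma unitize_id k (x : 'rV[R]_k) : enorm x = 1 -> unitize x = x.
Proof. by move=> x1; rewrite /unitize x1 invr1 scale1r. Qed.

Lemma unitize_continuous k (x : 'rV[R]_k) : x != 0 -> {for x, continuous (@unitize R k)}.
Proof.
move=> x0; apply: (cvgZ (FF := nbhs_filter x)); last exact: cvg_id.
apply: (cvgV (FF := nbhs_filter x)); first by rewrite enorm_eq0.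
exact: enorm_continuous.
Qed.

Lemma compact_annulus k (a b : R) : compact [set x : 'rV[R]_k | a <= enorm x <= b].
Proof.
apply: bounded_closed_compact.
  exists (Num.max b 0); split; first exact: num_real.
  move=> M bM x /= /andP[_ xb]; rewrite [leLHS]/Num.norm/= mx_normrE.
  have M0 : 0 <= M by rewrite ltW// (le_lt_trans _ bM)// le_max lexx orbT.
  apply/bigmax_leP; split=> //= -[i j] _ /=; rewrite (ord1 i).
  apply: le_trans (normr_coord_le_enorm _ _) (le_trans xb _).
  by rewrite ltW// (le_lt_trans _ bM)// le_max lexx.
rewrite (_ : mkset _ = @enorm R k @^-1` `[a, b]%classic); last first.
  by apply/seteqP; split => x /=; rewrite in_itv.
apply: preimage_closed; last exact: interval_closed.
by move=> x _; exact: enorm_continuous.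
Qed.

(** Heine-Cantor in a stronger form: [y] may lie outside [A], because [f] is continuous in the whole
    space at the points of [A]. Segments of thickened domains need this freedom. *)
Lemma unif_continuous_compact k (f : 'rV[R]_k -> R) (A : set 'rV[R]_k) (e : R) :
  compact A -> (forall x, A x -> {for x, continuous f}) -> 0 < e ->
  exists2 d : R, 0 < d & forall x y, A x -> enorm (y - x) < d -> `|f x - f y| < e.
Proof.
move=> /compact_near_coveringP cA cf e0.
pose P (d : R) (x : 'rV[R]_k) := forall y, enorm (y - x) < d -> `|f x - f y| < e.
have : \forall d \near 0^'+, A `<=` P d.
  apply: cA => x Ax.
  have e2 : 0 < e / 2 by rewrite divr_gt0.
  have /cvgrPdist_lt/(_ _ e2)/nbhs_ballP[d /= d0 dP] := cf x Ax.
  exists (ball x (d / 2), [set t | 0 < t < d / 2]) => /=.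
    split; first by apply: nbhsx_ballx; rewrite divr_gt0.
    by near=> t; apply/andP; split; near: t;
      [exact: nbhs_right_gt|apply: nbhs_right_lt; rewrite divr_gt0].
  move=> [x' t] [/= xx' /andP[t0 td]] y yx'.
  have fx' : `|f x - f x'| < e / 2.
    by apply: dP; apply: le_ball xx'; rewrite ler_pdivrMr// ler_pMr// ler1n.
  have fy : `|f x - f y| < e / 2.
    apply: dP; rewrite [d]splitr; apply: ball_triangle xx' _.
    split; first by rewrite divr_gt0.
    move=> i j; rewrite (ord1 i) /ball/= distrC.
    apply: le_lt_trans (lt_trans yx' td); apply: le_trans (normr_coord_le_enorm _ j).
    by rewrite !mxE.
  rewrite [e]splitr (_ : f x' - f y = (f x - f y) - (f x - f x')); last by ring.
  by apply: le_lt_trans (ler_normB _ _) _; exact: ltrD.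
move=> /(filterI (nbhs_right_gt 0)) /filter_ex[d [/= d0 AP]].
by exists d => // x y /AP; exact.
Unshelve. all: by end_near.
Qed.

End euclidean_norm.


Section polar.
Context {R : realType}.
Variable k : nat.
Local Notation V := ('rV[R]_k.+1).
Variables (u : V -> R) (M : R).
Hypothesis mu_ : rv_measurable u.
Hypothesis u0 : forall x, 0 <= u x.
Hypothesis uM : forall x, u x <= M.
Hypothesis uZ : forall c x, 0 < c -> u (c *: x) = u x.

Definition is_cone (C : V -> bool) := forall (c : R) x, 0 < c -> C (c *: x) = C x.

Definition cone_ball (C : V -> bool) (s : R) : V -> bool :=
  fun x => C x && (enorm x <= s).

Lemma rv_measurable_and (A B : V -> bool) :
  rv_measurable A -> rv_measurable B -> rv_measurable (fun x => A x && B x).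
Proof. by move=> mA mB d T v mv; apply: measurable_and; [exact: mA|exact: mB]. Qed.

Lemma rv_measurable_le (f g : V -> R) :
  rv_measurable f -> rv_measurable g -> rv_measurable (fun x => f x <= g x).
Proof. by move=> mf mg d T v mv; apply: measurable_fun_ler; [exact: mf|exact: mg]. Qed.

Lemma rv_measurable_lt (f g : V -> R) :
  rv_measurable f -> rv_measurable g -> rv_measurable (fun x => f x < g x).
Proof. by move=> mf mg d T v mv; apply: measurable_fun_ltr; [exact: mf|exact: mg]. Qed.

Lemma rv_measurable_cst d' (T' : measurableType d') (c : T') :
  rv_measurable (fun _ : V => c).
Proof. by move=> d T v mv; exact: measurable_cst. Qed.

Lemma rv_measurable_if_EFin (A : V -> bool) (f : V -> R) :
  rv_measurable A -> rv_measurable f ->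
  rv_measurable (fun x => if A x then (f x)%:E else 0%E : \bar R).
Proof.
move=> mA mf d T v mv; apply: measurable_fun_ifT => //; first exact: mA.
by apply/measurable_EFinP; exact: mf.
Qed.

Lemma rv_measurable_exprn (f : V -> R) n :
  rv_measurable f -> rv_measurable (fun x => f x ^+ n).
Proof. by move=> mf d T v mv; apply: measurable_funX; exact: mf. Qed.

Lemma rv_measurable_cone_ball C s : rv_measurable C -> rv_measurable (cone_ball C s).
Proof.
move=> mC; apply: rv_measurable_and => //; apply: rv_measurable_le.
  exact: rv_measurable_enorm.
exact: rv_measurable_cst.
Qed.

Lemma vol_cone_ball (C : V -> bool) (s : R) : rv_measurable C ->
  is_cone C -> 0 < s ->
  vol (cone_ball C s) = ((s ^+ k.+1)%:E * vol (cone_ball C 1))%E.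
Proof.
move=> mC CZ s0; rewrite [LHS](@leb_iint_scale _ _ s)//; last 2 first.
- by move=> x; case: ifP.
- by apply: rv_measurable_indic; exact: rv_measurable_cone_ball.
congr (_ * _)%E; apply: eq_leb_iint => x.
by rewrite /cone_ball CZ// enormZ gtr0_norm// ger_pMr.
Qed.

Lemma leb_iint_if_D (A B C : V -> bool) (f : V -> R) :
  rv_measurable A -> rv_measurable B -> rv_measurable C -> rv_measurable f ->
  (forall x, 0 <= f x) ->
  (forall x, C x = A x || B x) -> (forall x, ~~ (A x && B x)) ->
  (leb_iint (fun x => if C x then (f x)%:E else 0) =
   leb_iint (fun x => if A x then (f x)%:E else 0) +
   leb_iint (fun x => if B x then (f x)%:E else 0))%E.
Proof.
move=> mA mB mC mf f0 CAB AB.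
rewrite -leb_iintD; try (by exact: rv_measurable_if_EFin);
  try (by move=> x; case: ifP => // _; rewrite lee_fin).
apply: eq_leb_iint => x; rewrite CAB; have := AB x.
by case: (A x); case: (B x) => //=; rewrite ?adde0 ?add0e.
Qed.

(* A set function of a cone, comparable with the volume of the unit ball in that
   cone as soon as [u] is nearly constant on it. *)
Definition cone_content (X : (V -> bool) -> \bar R) :=
  (forall C, 0 <= X C)%E /\
  (forall A B C, rv_measurable A -> rv_measurable B -> rv_measurable C ->
    (forall x, C x = A x || B x) -> (forall x, ~~ (A x && B x)) ->
    X C = X A + X B)%E /\
  (forall C lo hi, rv_measurable C -> is_cone C ->
    (0 <= lo)%R -> (lo < hi)%R -> (forall x, C x -> (lo <= u x < hi)%R) ->
    (lo ^+ k.+1)%:E * vol (cone_ball C 1) <= X C <= (hi ^+ k.+1)%:E * vol (cone_ball C 1))%E.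

Lemma cone_content_vol : cone_content (fun C => vol (fun x => C x && (enorm x <= u x))).
Proof.
split; first by move=> C; exact: vol_ge0.
have mK : rv_measurable (fun x => enorm x <= u x).
  by apply: rv_measurable_le => //; exact: rv_measurable_enorm.
split=> [A B C mA mB mC CAB AB|C lo hi mC CZ lo0 lohi Cu].
  apply: (@leb_iint_if_D _ _ _ (fun=> 1)) => //; try exact: rv_measurable_and.
  - exact: rv_measurable_cst.
  - by move=> x; rewrite CAB andb_orl.
  - by move=> x; apply: contra (AB x) => /andP[/andP[-> _] /andP[-> _]].
have hi0 : 0 < hi by exact: le_lt_trans lohi.
apply/andP; split.
  move: lo0; rewrite le_eqVlt => /orP[/eqP <-|lo0].
    by rewrite expr0n mul0e vol_ge0.
  rewrite -vol_cone_ball//; apply: le_vol.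
  - exact: rv_measurable_cone_ball.
  - exact: rv_measurable_and.
  - by move=> x /andP[Cx xlo]; rewrite Cx/= (le_trans xlo)//; case/andP: (Cu x Cx).
rewrite -vol_cone_ball//; apply: le_vol.
- exact: rv_measurable_and.
- exact: rv_measurable_cone_ball.
- move=> x /andP[Cx xu]; rewrite /cone_ball Cx/= (le_trans xu)// ltW//.
  by case/andP: (Cu x Cx).
Qed.

Lemma cone_content_int : cone_content (fun C =>
  leb_iint (fun x => if cone_ball C 1 x then (u x ^+ k.+1)%:E else 0%E)).
Proof.
have uk0 x : 0 <= u x ^+ k.+1 by exact: exprn_ge0.
split; first by move=> C; apply: leb_iint_ge0 => x; case: ifP => // _; rewrite lee_fin.
have muk : rv_measurable (fun x => u x ^+ k.+1) by exact: rv_measurable_exprn.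
split=> [A B C mA mB mC CAB AB|C lo hi mC CZ lo0 lohi Cu].
  apply: leb_iint_if_D => //; try exact: rv_measurable_cone_ball.
  - by move=> x; rewrite /cone_ball CAB andb_orl.
  - by move=> x; apply: contra (AB x) => /andP[/andP[-> _] /andP[-> _]].
have hi0 : 0 < hi by exact: le_lt_trans lohi.
have mCB := @rv_measurable_cone_ball C 1 mC.
have volE (c : R) : 0 <= c -> (c%:E * vol (cone_ball C 1))%E =
    leb_iint (fun x => if cone_ball C 1 x then c%:E else 0%E).
  move=> c0; rewrite -leb_iintZ//; last 2 first.
  - by move=> x; case: ifP.
  - exact: rv_measurable_indic.
  by apply: eq_leb_iint => x; case: ifP => _; rewrite ?mule1 ?mule0.
rewrite !volE ?exprn_ge0//; last exact: ltW.
apply/andP; split; apply: le_leb_iint;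
  try (by apply: rv_measurable_if_EFin => //; exact: rv_measurable_cst).
- by move=> x; case: ifP => // _; rewrite lee_fin exprn_ge0.
- move=> x; case: ifPn => // /andP[/Cu/andP[lou _] _].
  by rewrite lee_fin lerXn2r ?nnegrE.
- by move=> x; case: ifP => // _; rewrite lee_fin.
- move=> x; case: ifPn => // /andP[/Cu/andP[_ uhi] _].
  by rewrite lee_fin lerXn2r ?nnegrE// ltW.
Qed.

Lemma vol_unit_ball_fin : (vol (fun x : V => (enorm x <= 1)%R) < +oo)%E.
Proof.
apply: (@le_lt_trans _ _ ((2 * 1) ^+ k.+1)%:E); last exact: ltry.
apply: vol_box_le => //.
  by apply: rv_measurable_le; [exact: rv_measurable_enorm|exact: rv_measurable_cst].
by move=> x x1 i; apply: le_trans x1; exact: normr_coord_le_enorm.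
Qed.

Lemma exprnD_le (p h : R) n : 0 <= p -> 0 <= h ->
  (p + h) ^+ n.+1 <= p ^+ n.+1 + n.+1%:R * h * (p + h) ^+ n.
Proof.
move=> p0 h0; have := exprS_tangent n p0 (addr_ge0 p0 h0).
rewrite (exprS (p + h)) -!natr1; set X := (p + h) ^+ n; set Y := p ^+ _.
by lra.
Qed.

(** The space is cut into cones on which [u] varies by at most [d]. There both contents lie between
    lo^(k+1) and hi^(k+1) times the cone's share of the unit ball, so the total discrepancy is
    O(d). *)
Lemma le_cone_content X Y : cone_content X -> cone_content Y ->
  (X xpredT <= Y xpredT)%E.
Proof.
move=> [X0 [XD Xb]] [Y0 [YD Yb]].
have M0 : 0 <= M by apply: le_trans (u0 0) (uM 0).
(* Bounds the slope of t^(k+1) on [0, M+1], the range of all the levels j d that occur. *)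
set kap := k.+1%:R * (M + 1) ^+ k.
have kap0 : 0 <= kap by rewrite mulr_ge0// exprn_ge0// addr_ge0.
pose lev d j (x : V) := u x < j%:R * d.
have mlev d j : rv_measurable (lev d j).
  by apply: rv_measurable_lt => //; exact: rv_measurable_cst.
have levZ d j : is_cone (lev d j) by move=> c x c0; rewrite /lev uZ.
pose Z C := vol (cone_ball C 1).
have ZD A B C : rv_measurable A -> rv_measurable B -> rv_measurable C ->
    (forall x, C x = A x || B x) -> (forall x, ~~ (A x && B x)) -> (Z C = Z A + Z B)%E.
  move=> mA mB mC CAB AB.
  apply: (@leb_iint_if_D _ _ _ (fun=> 1)) => //; try exact: rv_measurable_cone_ball.
  - exact: rv_measurable_cst.
  - by move=> x; rewrite /cone_ball CAB andb_orl.
  - by move=> x; apply: contra (AB x) => /andP[/andP[-> _] /andP[-> _]].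
have step d j : 0 < d -> d <= 1 -> j%:R * d <= M + 1 ->
    (X (lev d j) <= Y (lev d j) + (kap * d)%:E * Z (lev d j))%E.
  move=> d0 d1; elim: j => [|j IH] jM.
    have [|_] := andP (Xb (lev d 0) 0 1 (mlev d 0) (levZ d 0) (lexx 0) ltr01 _).
      by move=> x; rewrite /lev mul0r ltNge u0.
    have -> : vol (cone_ball (lev d 0) 1) = 0%E.
      rewrite -[RHS](@leb_iint0 R k.+1); apply: eq_leb_iint => x.
      by rewrite /cone_ball /lev mul0r ltNge u0.
    by rewrite mule0 => h; apply: le_trans h _; rewrite adde_ge0// mule_ge0 ?vol_ge0// lee_fin mulr_ge0// ltW.
  set S := fun x => (j%:R * d <= u x) && (u x < j.+1%:R * d).
  have mS : rv_measurable S.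
    apply: rv_measurable_and; last exact: mlev.
    by apply: rv_measurable_le => //; exact: rv_measurable_cst.
  have SZ : is_cone S by move=> c x c0; rewrite /S uZ.
  have jd : j%:R * d < j.+1%:R * d by rewrite ltr_pM2r// ltr_nat.
  have jd0 : 0 <= j%:R * d by rewrite mulr_ge0// ltW.
  have levS x : lev d j.+1 x = lev d j x || S x.
    rewrite /lev /S; by case: (ltP (u x) (j%:R * d)) => //= h; rewrite (lt_trans h jd).
  have disj x : ~~ (lev d j x && S x).
    by rewrite /lev /S ltNge; case: (_ <= _).
  rewrite (XD (lev d j) S)// (YD (lev d j) S)// (ZD (lev d j) S)//.
  have dk0 : (0 <= (kap * d)%:E)%E by rewrite lee_fin mulr_ge0// ltW.
  rewrite ge0_muleDr ?vol_ge0// addeACA; apply: leeD.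
    by apply: IH; apply: le_trans jM; exact: ltW.
  have Sb x : S x -> j%:R * d <= u x < j.+1%:R * d by [].
  have /andP[_ XS] := Xb S _ _ mS SZ jd0 jd Sb.
  have /andP[YS _] := Yb S _ _ mS SZ jd0 jd Sb.
  apply: le_trans XS _; apply: le_trans (leeD2r _ YS).
  rewrite -ge0_muleDl ?lee_fin ?exprn_ge0//.
  apply: lee_wpmul2r; first exact: vol_ge0.
  rewrite -EFinD lee_fin; have := exprnD_le k jd0 (ltW d0).
  have -> : j%:R * d + d = j.+1%:R * d by rewrite -natr1 mulrDl mul1r.
  move=> h; apply: le_trans h _; rewrite lerD2l /kap [leRHS]mulrAC.
  apply: ler_wpM2l; first by rewrite mulr_ge0// ltW.
  by rewrite lerXn2r ?nnegrE ?mulr_ge0 ?addr_ge0// ltW.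
apply/lee_addgt0Pr => e e0.
have Zfin : (Z xpredT < +oo)%E.
  by apply: le_lt_trans vol_unit_ball_fin; exact: lexx.
have [z z0 ZE] : exists2 z : R, 0 <= z & Z xpredT = z%:E.
  move: Zfin (vol_ge0 (cone_ball xpredT 1)); rewrite -/(Z xpredT).
  by case: (Z xpredT) => [z| |]//= _; rewrite lee_fin => z0; exists z.
pose d := Num.min 1 (e / (kap * z + 1)).
have kz : 0 < kap * z + 1 by rewrite ltr_wpDl// mulr_ge0.
have d0 : 0 < d by rewrite lt_min ltr01 divr_gt0.
have d1 : d <= 1 by rewrite ge_min lexx.
(* The first [j] with j d > M: the level cone is then everything, while j d <= M + 1 keeps [kap]
   valid. *)
pose j := (Num.truncn (M / d)).+1.
have Mj : M < j%:R * d by rewrite -ltr_pdivrMr// truncnS_gt.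
have jM : j%:R * d <= M + 1.
  rewrite /j -natr1 mulrDl mul1r; apply: lerD => //.
  by rewrite -ler_pdivlMr// truncn_le// divr_ge0// ltW.
have levT : lev d j = xpredT.
  by apply/funext => x; rewrite /lev (le_lt_trans (uM x)).
have := step d j d0 d1 jM; rewrite levT ZE => h; apply: le_trans h _.
rewrite leeD2l// -EFinM lee_fin mulrAC.
apply: (@le_trans _ _ (kap * z * (e / (kap * z + 1)))).
  by apply: ler_wpM2l; [exact: mulr_ge0|rewrite /d ge_min lexx orbT].
by rewrite mulrA ler_pdivrMr// mulrDr mulr1 mulrC lerDl ltW.
Qed.

(** Both sides are values of cone contents on the whole space, and any two cone contents dominate
    each other. This replaces integration in polar coordinates. *)
Lemma vol_polar : vol (fun x => enorm x <= u x) =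
  leb_iint (fun x => if enorm x <= 1 then (u x ^+ k.+1)%:E else 0%E).
Proof.
by apply/eqP; rewrite eq_le; apply/andP; split;
  [exact: (le_cone_content cone_content_vol cone_content_int)
  |exact: (le_cone_content cone_content_int cone_content_vol)].
Qed.

End polar.


(** The origin is left out, as in [sphere_int], because 0-homogeneous functions have no meaningful
    value there. *)
Definition bint_fun (R : realType) (k : nat) (f : 'rV[R]_k.+1 -> R)
    (x : 'rV[R]_k.+1) : \bar R :=
  if (x != 0) && (enorm x <= 1) then (f x)%:E else 0%E.

(* Locked: otherwise conversion tests between integrals unfold [leb_iint]. *)
HB.lock Definition bint (R : realType) (k : nat) (f : 'rV[R]_k.+1 -> R) : R :=
  fine (leb_iint (bint_fun f)).

(** * Integration of 0-homogeneous functions *)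

Section ball_integral.
Context {R : realType}.
Variable k : nat.
Local Notation V := ('rV[R]_k.+1).

(* Continuous functions on the sphere, as 0-homogeneous functions off the origin. *)
Definition sph_cont (f : V -> R) :=
  (forall x, x != 0 -> {for x, continuous f}) /\
  (forall (c : R) x, 0 < c -> f (c *: x) = f x).

Definition sph_nneg (f : V -> R) := forall x, x != 0 -> 0 <= f x.

Lemma sph_cont_unitize f x : sph_cont f -> x != 0 -> f (unitize x) = f x.
Proof. by move=> [_ fZ] x0; rewrite /unitize fZ// invr_gt0 enorm_gt0. Qed.

Lemma sph_cont_cst c : sph_cont (fun=> c).
Proof. by split=> // x _; exact: cst_continuous. Qed.

Lemma sph_contD f g : sph_cont f -> sph_cont g -> sph_cont (fun x => f x + g x).
Proof.
move=> [cf fZ] [cg gZ]; split=> [x x0|c x c0]; last by rewrite fZ// gZ.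
by apply: (cvgD (FF := nbhs_filter x)); [exact: cf|exact: cg].
Qed.

Lemma sph_contM f g : sph_cont f -> sph_cont g -> sph_cont (fun x => f x * g x).
Proof.
move=> [cf fZ] [cg gZ]; split=> [x x0|c x c0]; last by rewrite fZ// gZ.
by apply: (cvgM (FF := nbhs_filter x)); [exact: cf|exact: cg].
Qed.

Lemma sph_contX f n : sph_cont f -> sph_cont (fun x => f x ^+ n).
Proof.
move=> [cf fZ]; split=> [x x0|c x c0]; last by rewrite fZ.
by apply: (cvg_exprn (FF := nbhs_filter x)); exact: cf.
Qed.

Lemma sph_cont_comp f (g : R -> R) : sph_cont f ->
  (forall x, x != 0 -> {for f x, continuous g}) -> sph_cont (fun x => g (f x)).
Proof.
move=> [cf fZ] cg; split=> [x x0|c x c0]; last by rewrite fZ.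
by apply: continuous_comp; [exact: cf|exact: cg].
Qed.

Lemma sph_cont_sqrt f : sph_cont f -> sph_cont (fun x => Num.sqrt (f x)).
Proof. by move=> cf; apply: sph_cont_comp => // x _; exact: sqrt_continuous. Qed.

Lemma sph_cont_sum (I : Type) (r : seq I) (f : I -> V -> R) :
  (forall i, sph_cont (f i)) -> sph_cont (fun x => \sum_(i <- r) f i x).
Proof.
move=> cf; split=> [x x0|c x c0]; last first.
  by apply: eq_bigr => i _; case: (cf i) => _ ->.
by apply: (cvg_sumr (FF := nbhs_filter x)) => i; case: (cf i) => + _; exact.
Qed.

Lemma sph_max f : sph_cont f ->
  exists2 t : V, enorm t = 1 & forall x, x != 0 -> f x <= f t.
Proof.
move=> [cf fZ]; pose A := [set x : V | 1 <= enorm x <= 1].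
have A0 x : A x -> x != 0.
  by move=> /andP[x1 _]; rewrite -enorm_gt0 (lt_le_trans ltr01).
have Ane : A !=set0.
  have e0 : (delta_mx ord0 ord0 : V) != 0.
    apply/eqP => /rowP /(_ ord0); rewrite !mxE !eqxx => /eqP.
    by rewrite oner_eq0.
  by exists (unitize (delta_mx ord0 ord0)); rewrite /A/= enorm_unitize// lexx.
have wf : {within A, continuous f}.
  by apply: continuous_in_subspaceT => x /set_mem /A0; exact: cf.
have [t /set_mem At ft] := compact_EVT_max Ane (@compact_annulus R _ 1 1) wf.
exists t; first by apply/eqP; rewrite eq_le andbC.
move=> x x0; rewrite -(sph_cont_unitize (conj cf fZ))//; apply: ft.
by apply/mem_set; rewrite /A/= enorm_unitize// lexx.
Qed.

Lemma sph_bounded f : sph_cont f ->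
  exists2 M : R, 0 < M & forall x, x != 0 -> `|f x| <= M.
Proof.
move=> cf; have cnf : sph_cont (fun x => `|f x|).
  by apply: sph_cont_comp => // x _; exact: norm_continuous.
have [t _ tM] := sph_max cnf; exists (`|f t| + 1); first by rewrite ltr_wpDl.
by move=> x /tM h; apply: le_trans h _; rewrite lerDl.
Qed.

Lemma rv_measurable_sph f : sph_cont f ->
  rv_measurable (fun x => if x != 0 then f x else 0).
Proof. by move=> [cf _]; exact: rv_measurable_continuous. Qed.

Lemma rv_measurable_bint_fun f : sph_cont f -> rv_measurable (bint_fun f).
Proof.
move=> cf; rewrite (_ : bint_fun f = fun x =>
    if (x != 0) && (enorm x <= 1) then (if x != 0 then f x else 0)%:E else 0%E).
  apply: rv_measurable_if_EFin; last exact: rv_measurable_sph.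
  apply: rv_measurable_and; first exact: rv_measurable_neq0.
  by apply: rv_measurable_le; [exact: rv_measurable_enorm|exact: rv_measurable_cst].
by apply/funext => x; rewrite /bint_fun; case: ifP => // /andP[->].
Qed.

Lemma bint_fun_ge0 f x : sph_nneg f -> (0 <= bint_fun f x)%E.
Proof. by move=> f0; rewrite /bint_fun; case: ifP => // /andP[/f0]; rewrite lee_fin. Qed.

(** The integrand is bounded and supported in a cube, so the integral is finite and [fine] loses
    nothing. *)
Lemma leb_iint_bint f : sph_cont f -> sph_nneg f -> leb_iint (bint_fun f) = (bint f)%:E.
Proof.
move=> cf f0; have [M M0 fM] := sph_bounded cf; rewrite bint.unlock fineK// ge0_fin_numE; last first.
  by apply: leb_iint_ge0 => x; exact: bint_fun_ge0.
apply: (@le_lt_trans _ _ (M * (2 * 1) ^+ k.+1)%:E); last exact: ltry.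
apply: leb_iint_box_le => //; first exact: rv_measurable_bint_fun.
- by move=> x; exact: bint_fun_ge0.
- exact: ltW.
- move=> x; rewrite /bint_fun; case: ifP => [/andP[x0 _]|_]; rewrite lee_fin; last exact: ltW.
  by apply: le_trans (fM x x0); exact: ler_norm.
- move=> x [i xi]; rewrite /bint_fun ifF//; apply/negP => /andP[_].
  by rewrite leNgt (lt_le_trans xi)// normr_coord_le_enorm.
Qed.

Lemma bint_ge0 (f : V -> R) : sph_nneg f -> 0 <= bint f.
Proof. by move=> f0; rewrite bint.unlock; apply/fine_ge0/leb_iint_ge0 => x; exact: bint_fun_ge0. Qed.

Lemma eq_bint (f g : V -> R) : (forall x, x != 0 -> f x = g x) -> bint f = bint g.
Proof.
move=> fg; rewrite bint.unlock; congr fine; apply: eq_leb_iint => x; rewrite /bint_fun.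
by case: ifP => // /andP[/fg ->].
Qed.

Lemma le_bint f g : sph_cont f -> sph_cont g -> sph_nneg f ->
  (forall x, x != 0 -> f x <= g x) -> bint f <= bint g.
Proof.
move=> cf cg f0 fg; have g0 : sph_nneg g.
  by move=> x x0; apply: le_trans (f0 x x0) (fg x x0).
rewrite -lee_fin -!leb_iint_bint//; apply: le_leb_iint; try exact: rv_measurable_bint_fun.
  by move=> x; exact: bint_fun_ge0.
by move=> x; rewrite /bint_fun; case: ifP => // /andP[/fg]; rewrite lee_fin.
Qed.

Lemma bintD f g : sph_cont f -> sph_cont g -> sph_nneg f -> sph_nneg g ->
  bint (fun x => f x + g x) = bint f + bint g.
Proof.
move=> cf cg f0 g0; apply: EFin_inj; rewrite EFinD -!leb_iint_bint//; last 2 first.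
- exact: sph_contD.
- by move=> x x0; rewrite addr_ge0 ?f0 ?g0.
rewrite -leb_iintD; try exact: rv_measurable_bint_fun;
  try by move=> x; exact: bint_fun_ge0.
by apply: eq_leb_iint => x; rewrite /bint_fun; case: ifP => //; rewrite adde0.
Qed.

Lemma bintZ c f : 0 <= c -> sph_cont f -> sph_nneg f ->
  bint (fun x => c * f x) = c * bint f.
Proof.
move=> c0 cf f0; apply: EFin_inj; rewrite EFinM -!leb_iint_bint//; last 2 first.
- by apply: sph_contM => //; exact: sph_cont_cst.
- by move=> x x0; rewrite mulr_ge0 ?f0.
rewrite -leb_iintZ//; last 2 first.
- by move=> x; exact: bint_fun_ge0.
- exact: rv_measurable_bint_fun.
by apply: eq_leb_iint => x; rewrite /bint_fun; case: ifP => //; rewrite mule0.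
Qed.

Lemma bint_gt0 f t : sph_cont f -> sph_nneg f -> t != 0 -> 0 < f t -> 0 < bint f.
Proof.
move=> cf f0 t0 ft; have [cf1 fZ] := cf.
(* Half-way along the ray of [t]: [f] has the same value there, and a small cube at [p] avoids both
   the origin and the boundary of the ball. *)
pose p := (2^-1 : R) *: unitize t.
have p0 : p != 0 by rewrite scaler_eq0 negb_or invr_neq0 ?unitize_neq0// pnatr_eq0.
have fp : f p = f t by rewrite fZ ?invr_gt0// sph_cont_unitize.
have ep : enorm p = 2^-1 by rewrite enormZ enorm_unitize// mulr1 gtr0_norm// invr_gt0.
have nf : \forall y \near p, f t / 2 < f y.
  apply: (cf1 p p0 [set s | f t / 2 < s]); apply: lt_nbhsr.
  by rewrite fp ltr_pdivrMr// ltr_pMr// ltr1n.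
have ne : \forall y \near p, enorm y < 1.
  apply: (enorm_continuous (x := p) (t := [set s | s < 1])).
  by apply: lt_nbhsl; rewrite ep invf_lt1// ltr1n.
have ne0 : \forall y \near p, 0 < enorm y.
  apply: (enorm_continuous (x := p) (t := [set s | 0 < s])).
  by apply: lt_nbhsr; rewrite ep invr_gt0.
have nA : nbhs p [set y | f t / 2 < f y /\ (enorm y < 1 /\ 0 < enorm y)].
  by near=> y; split; [near: y|split; near: y].
have /nbhs_ballP[d /= d0 dP] := nA.
have d2 : 0 < d / 2 by rewrite divr_gt0.
rewrite -lte_fin -leb_iint_bint//.
apply: (@lt_le_trans _ _ (f t / 2 * (d / 2) ^+ k.+1)%:E).
  by rewrite lte_fin mulr_gt0 ?exprn_gt0// divr_gt0.
apply: (@leb_iint_box_ge _ _ _ p) => //.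
- exact: rv_measurable_bint_fun.
- by move=> x; exact: bint_fun_ge0.
- by rewrite divr_ge0// ltW.
move=> x xp; have : ball p d x.
  split=> // i j; rewrite (ord1 i) /ball/= distrC ger0_norm ?subr_ge0; last by case/andP: (xp j).
  rewrite ltrBlDl; case/andP: (xp j) => _ h; apply: le_lt_trans h _.
  by rewrite ltrD2l ltr_pdivrMr// ltr_pMr// ltr1n.
move=> /dP[fx [ex1 ex0]]; rewrite /bint_fun ifT; first by rewrite lee_fin ltW.
by rewrite -enorm_gt0 ex0 ltW.
Unshelve. all: by end_near.
Qed.

End ball_integral.


(** * Gradients of 0-homogeneous functions *)

Section spherical_gradient.
Context {R : realType}.
Variable k : nat.
Local Notation V := ('rV[R]_k.+1).

Definition sph_C1 (P : V -> R) :=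
  [/\ sph_cont P, (forall x, x != 0 -> differentiable P x) &
  (forall (i : 'I_k.+1) x, x != 0 ->
     {for x, continuous (fun y => 'D_(delta_mx ord0 i) P y)})].

Definition grad (P : V -> R) (x : V) : V := \row_i 'D_(delta_mx ord0 i) P x.

(** Partial derivatives of a 0-homogeneous function are homogeneous of degree -1; evaluating them at
    [unitize x] makes the squared gradient 0-homogeneous again. *)
Definition sph_grad_sq (P : V -> R) (x : V) : R :=
  \sum_(i < k.+1) ('D_(delta_mx ord0 i) P (unitize x)) ^+ 2.

Lemma diff_grad (P : V -> R) (x v : V) : differentiable P x -> 'd P x v = dotr (grad P x) v.
Proof.
move=> dP; rewrite {1}(row_sum_delta v) linear_sum; apply: eq_bigr => i _.
by rewrite linearZ/= -deriveE// !mxE mulrC.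
Qed.

Lemma derive_scale (P : V -> R) (c : R) (x v : V) : (forall y, P (c *: y) = P y) ->
  c != 0 -> differentiable P (c *: x) -> 'D_v P (c *: x) = c^-1 * 'D_v P x.
Proof.
move=> PZ c0 dcx.
have <- : 'D_(c *: v) P (c *: x) = 'D_v P x.
  rewrite /derive (_ : (fun h : R => _) =
    (fun h => h^-1 *: ((P \o shift x) (h *: v) - P x)))//.
  apply/funext => h /=; rewrite PZ; congr (_ *: (_ - _)).
  by rewrite scalerA (mulrC h) -scalerA -scalerDr PZ.
by rewrite !deriveE// linearZ/= mulrA mulVf// mul1r.
Qed.

(** Euler's identity in degree 0: [P] is constant along rays, so its radial derivative vanishes. *)
Lemma sph_euler P x : sph_C1 P -> x != 0 -> dotr (grad P x) x = 0.
Proof.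
move=> [[_ PZ] dP _] x0; rewrite -diff_grad -?deriveE; try exact: dP.
have nP : \forall h \near (0 : R)^', P (h *: x + x) = P x.
  near=> h; rewrite -{2}[x]scale1r -scalerDl PZ//.
  by rewrite -ltrBlDr sub0r; near: h; apply: nbhs_dnbhs; apply: lt_nbhsr; rewrite oppr_lt0.
apply/cvg_lim => //; apply: cvg_near_cst.
near=> h; rewrite /= (_ : P (h *: x + x) = P x) ?subrr ?scaler0//.
by near: h.
Unshelve. all: by end_near.
Qed.

Lemma grad_unitize P x : sph_C1 P -> x != 0 ->
  sph_grad_sq P x = enorm x ^+ 2 * dotr (grad P x) (grad P x).
Proof.
move=> [[_ PZ] dP _] x0; rewrite mulr_sumr; apply: eq_bigr => i _.
have e0 : enorm x != 0 by rewrite enorm_eq0.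
have -> : 'D_(delta_mx ord0 i) P (unitize x) = enorm x * 'D_(delta_mx ord0 i) P x.
  rewrite /unitize derive_scale ?invr_neq0 ?invrK//; last first.
  - by apply: dP; exact: unitize_neq0.
  by move=> y; rewrite PZ// invr_gt0 enorm_gt0.
by rewrite !mxE exprMn -[in RHS]expr2.
Qed.

Lemma sph_cont_grad_sq P : sph_C1 P -> sph_cont (sph_grad_sq P).
Proof.
move=> [_ _ cD]; apply: sph_cont_sum => i; apply: (@sph_contX _ _ (fun x => 'D_(delta_mx ord0 i) P (unitize x))); split.
  move=> x x0; apply: (@continuous_comp _ _ _ (@unitize R k.+1)
    (fun y => 'D_(delta_mx ord0 i) P y)); first exact: unitize_continuous.
  exact: (cD i _ (unitize_neq0 x0)).
by move=> c x c0; rewrite unitizeZ.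
Qed.

Lemma sph_grad_sq_ge0 P x : 0 <= sph_grad_sq P x.
Proof. by apply: sumr_ge0 => i _; exact: sqr_ge0. Qed.

(** The vector is the gradient of |x| - P x, an outward normal to {|x| <= P x} at boundary points.
    By [sph_euler] its two parts are orthogonal, and Pythagoras gives the length. *)
Lemma enorm_unitize_sub_grad P x : sph_C1 P -> x != 0 ->
  enorm (unitize x - grad P x) = Num.sqrt (1 + sph_grad_sq P x / enorm x ^+ 2).
Proof.
move=> cP x0; have e0 : enorm x != 0 by rewrite enorm_eq0.
rewrite grad_unitize// mulrC mulKf ?expf_neq0// -(ger0_norm (enorm_ge0 _)) -sqrtr_sqr.
congr Num.sqrt; have u1 := enorm_unitize x0.
have ug : dotr (unitize x) (grad P x) = 0.
  by rewrite /unitize dotrZl dotrC sph_euler// mulr0.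
move: (unitize x) u1 ug => u u1 ug.
rewrite sqr_enorm -scaleN1r !(dotrDl, dotrDr, dotrZl, dotrZr) -(sqr_enorm u) u1.
by rewrite (dotrC (grad P x) u) ug; ring.
Qed.

Lemma is_derive_line (P : V -> R) (x z : V) (t : R) : differentiable P (x + t *: z) ->
  is_derive t (1 : R) (fun s => P (x + s *: z)) ('D_z P (x + t *: z)).
Proof.
move=> dPt; pose phi (s : R) : R := P (x + s *: z).
have E : (fun h : R => h^-1 *: ((phi \o shift t) (h *: (1 : R)) - phi t)) =
    (fun h : R => h^-1 *: ((P \o shift (x + t *: z)) (h *: z) - P (x + t *: z))).
  apply/funext => h /=; rewrite /phi; congr (_ *: (P _ - _)).
  by rewrite [h *: 1]mulr1 scalerDl addrCA.
split; first by rewrite /derivable E; exact: diff_derivable.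
by rewrite /derive E.
Qed.

Lemma segment_mvt (P : V -> R) (x z : V) : (forall t : R, 0 <= t <= 1 -> x + t *: z != 0) ->
  (forall y, y != 0 -> differentiable P y) ->
  exists2 t : R, 0 <= t <= 1 & P (x + z) - P x = dotr (grad P (x + t *: z)) z.
Proof.
move=> seg0 dP; pose phi (t : R) : R := P (x + t *: z).
have dphi (t : R) : 0 <= t <= 1 -> is_derive t (1 : R) phi (dotr (grad P (x + t *: z)) z).
  move=> t01; have dPt := dP _ (seg0 t t01).
  by rewrite -diff_grad// -deriveE//; exact: is_derive_line.
have [t] : exists2 t, t \in `[0, 1] & phi 1 - phi 0 = dotr (grad P (x + t *: z)) z * (1 - 0).
  apply: MVT_segment => // [t|].
    by rewrite in_itv/= => /andP[t0 t1]; apply: dphi; rewrite !ltW.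
  apply: continuous_in_subspaceT => t /set_mem; rewrite /= in_itv/= => /dphi[d1 _].
  exact/differentiable_continuous/derivable1_diffP.
rewrite in_itv/= /phi scale1r scale0r addr0 subr0 mulr1 => t01 h.
by exists t.
Qed.

End spherical_gradient.


(** * Isoperimetric inequality for star-shaped domains *)

Section isoperimetric.
Context {R : realType}.
Variable k : nat.
Local Notation V := ('rV[R]_k.+1).
Implicit Types P u : V -> R.

(** The value 0 at the origin puts the origin in the star-shaped set, whatever [u] is there. *)
Definition cone_radius u (x : V) : R := if x != 0 then u x else 0.

Lemma vol_star_shaped u : sph_cont u -> sph_nneg u ->
  vol (fun x => enorm x <= cone_radius u x) = (bint (fun x => u x ^+ k.+1))%:E.
Proof.
move=> cu u0; have [M M0 uM] := sph_bounded cu.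
have uN x : 0 <= cone_radius u x by rewrite /cone_radius; case: ifP => // /u0.
have uM' x : cone_radius u x <= M.
  rewrite /cone_radius; case: ifP => [/uM|_]; last exact: ltW.
  by apply: le_trans; exact: ler_norm.
have uZ (c : R) x : 0 < c -> cone_radius u (c *: x) = cone_radius u x.
  move=> c0; rewrite /cone_radius scaler_eq0 gt_eqF//=; case: ifP => // _.
  by case: cu => _ ->.
rewrite (vol_polar (rv_measurable_sph cu) uN uM' uZ).
rewrite -leb_iint_bint; last 2 first.
- exact: sph_contX.
- by move=> x x0; rewrite exprn_ge0// u0.
apply: eq_leb_iint => x; rewrite /bint_fun /cone_radius.
by case: (x != 0); case: (enorm x <= 1) => //; rewrite expr0n.
Qed.

Lemma enorm_le_coord (v : V) (c : R) : (forall i, `|v ord0 i| <= c) ->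
  enorm v <= k.+1%:R * c.
Proof.
move=> vc; have c0 : 0 <= c by exact: le_trans (vc ord0).
rewrite -(@ler_pXn2r _ 2) ?nnegrE ?enorm_ge0 ?mulr_ge0// sqr_enorm.
apply: (@le_trans _ _ (\sum_(i < k.+1) c ^+ 2)).
  apply: ler_sum => i _; rewrite -expr2 -(@real_normK _ (v _ _)) ?num_real//.
  by rewrite lerXn2r ?nnegrE.
rewrite sumr_const card_ord -(mulr_natl (c ^+ 2)) exprMn; apply: ler_wpM2r; first exact: sqr_ge0.
by rewrite expr2 ler_peMl// ler1n.
Qed.

Lemma uniform_finite (n : nat) (Q : 'I_n -> R -> Prop) :
  (forall i (d d' : R), 0 < d' -> d' <= d -> Q i d -> Q i d') ->
  (forall i, exists2 d, 0 < d & Q i d) -> exists2 d, 0 < d & forall i, Q i d.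
Proof.
move=> Qmono Qex.
have /choice[f fP] : forall i, exists d : R, 0 < d /\ Q i d.
  by move=> i; have [d d0 Qd] := Qex i; exists d.
pose d := \big[Num.min/1]_i f i.
have d0 : 0 < d.
  rewrite /d; apply: (big_ind (fun x => 0 < x)) => // [x y x0 y0|i _].
    by rewrite lt_min x0.
  by case: (fP i).
exists d => // i; have [fi Qi] := fP i; apply: Qmono Qi => //.
exact: bigmin_le_cond.
Qed.

Lemma grad_unif_continuous P (a b e : R) : sph_C1 P -> 0 < a -> 0 < e ->
  exists2 d : R, 0 < d & forall x y : V, a <= enorm x <= b -> enorm (y - x) < d ->
    enorm (grad P x - grad P y) <= e.
Proof.
move=> [_ _ cD] a0 e0; pose e' := e / k.+1%:R.
have e'0 : 0 < e' by rewrite divr_gt0.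
have [d d0 dP] : exists2 d : R, 0 < d & forall i : 'I_k.+1,
    forall x y : V, a <= enorm x <= b -> enorm (y - x) < d ->
    `|'D_(delta_mx ord0 i) P x - 'D_(delta_mx ord0 i) P y| < e'.
  apply: uniform_finite => [i d d' d'0 d'd h x y xab /lt_le_trans/(_ d'd)|i].
    exact: h.
  apply: (@unif_continuous_compact _ _ _ _ e' (@compact_annulus R _ a b)) => // x /andP[ax _].
  by apply: cD; rewrite -enorm_gt0 (lt_le_trans a0).
exists d => // x y xab yx; apply: (@le_trans _ _ (k.+1%:R * e')).
  by apply: enorm_le_coord => i; rewrite !mxE ltW// dP.
by rewrite /e' mulrCA mulfV ?mulr1// pnatr_eq0.
Qed.

(** The ratio between the area element of the graph of [P] and that of the sphere of radius [P x];
    on the graph it is also the length of the gradient of |x| - P x. *)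
Definition area_factor P (x : V) : R := Num.sqrt (1 + sph_grad_sq P x / P x ^+ 2).

(* [e * area_factor P] is, to first order in [e], how far a thickening by a ball of
   radius [e] moves the boundary of {|x| <= P x} outwards along the rays. *)
Lemma thicken_star_shaped P (eta : R) : sph_C1 P -> (forall x, x != 0 -> 0 < P x) ->
  0 < eta -> exists2 e0 : R, 0 < e0 & forall (e : R) (y z : V), 0 < e <= e0 ->
    enorm y <= cone_radius P y -> enorm z <= e ->
    enorm (y + z) <= cone_radius (fun x => P x + e * (area_factor P x + eta)) (y + z).
Proof.
move=> cP Ppos eta0; have [cP0 dP _] := cP.
have [M M0 PM] := sph_bounded cP0.
have [r0 r00 Pr] : exists2 r0 : R, 0 < r0 & forall x, x != 0 -> r0 <= P x.
  have cNP : sph_cont (fun x => - P x).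
    by apply: sph_cont_comp => // x _; exact: opp_continuous.
  have [t t1 Pt] := sph_max cNP; exists (P t); last by move=> x /Pt; rewrite lerN2.
  by apply: Ppos; rewrite -enorm_gt0 t1.
have [d d0 dG] := @grad_unif_continuous P r0 (M + 1) eta cP r00 eta0.
exists (Num.min (d / 2) (Num.min 1 (r0 / 2))).
  by rewrite !lt_min ltr01 !divr_gt0.
move=> e y z /andP[e0]; rewrite !le_min => /and3P[ed e1 er] yP ze.
have erd : r0 / 2 < r0 by rewrite ltr_pdivrMr// ltr_pMr// ltr1n.
have edd : d / 2 < d by rewrite ltr_pdivrMr// ltr_pMr// ltr1n.
set x := y + z; have yE : y = x - z by rewrite /x addrK.
rewrite /cone_radius; case: ifPn => [x0|/negPn/eqP ->]; last by rewrite enorm0.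
have af0 : 0 <= area_factor P x by exact: sqrtr_ge0.
have aeta0 : 0 <= area_factor P x + eta by rewrite addr_ge0// ltW.
(* Only points that have left the original set matter; they satisfy |x| > r0, and as |z| <= r0/2 the
   segment from [x] to [y] avoids the origin, which the mean value theorem needs. *)
case: (leP (enorm x) (P x)) => [xP|Px].
  by apply: le_trans xP _; rewrite lerDl mulr_ge0// ltW.
have xr0 : r0 <= enorm x by apply: ltW; exact: le_lt_trans (Pr x x0) Px.
have y0 : y != 0.
  rewrite -enorm_gt0; have := enormD y z; rewrite -/x => xyz.
  by clear -xyz ze er xr0 erd r00; lra.
move: yP; rewrite /cone_radius y0 => yP.
have yM : enorm y <= M.
  by apply: le_trans yP (le_trans (ler_norm _) (PM y y0)).
have xM : enorm x <= M + 1.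
  have := enormD y z; rewrite -/x => xyz.
  by clear -xyz yM ze e1; lra.
have segE (t : R) : 0 <= t <= 1 -> enorm (t *: - z) <= e.
  move=> /andP[t0 t1]; rewrite enormZ enormN ger0_norm//.
  by apply: le_trans ze; rewrite ler_piMl// enorm_ge0.
have seg0 (t : R) : 0 <= t <= 1 -> x + t *: - z != 0.
  move=> t01; rewrite -enorm_gt0; have := enormD (x + t *: - z) (- (t *: - z)).
  rewrite addrK enormN; have tz := segE t t01 => xyz.
  by clear -tz xyz er erd r00 xr0; lra.
have [t t01 Pxy] := segment_mvt seg0 dP.
set xi := x + t *: - z in Pxy.
have Gxi : enorm (grad P x - grad P xi) <= eta.
  apply: dG; first by rewrite xr0.
  by rewrite /xi addrC addKr; have tz := segE t t01; clear -tz ed edd d0; lra.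
have th1 : dotr (unitize x) x = enorm x.
  rewrite /unitize dotrZl -sqr_enorm expr2 mulrA mulVf ?mul1r//.
  by rewrite enorm_eq0.
have thy : dotr (unitize x) y <= enorm y.
  by have := dotr_le_enorm (unitize x) y; rewrite enorm_unitize// mul1r.
have Px2 : 0 < P x ^+ 2 by rewrite exprn_gt0// Ppos.
(* The normal has length sqrt (1 + |grad|^2 / |x|^2), and |x| > P x outside the set. *)
have sg : enorm (unitize x - grad P x) <= area_factor P x.
  rewrite enorm_unitize_sub_grad// ler_sqrt ?lerD2l; last first.
    by rewrite addr_ge0// divr_ge0 ?sph_grad_sq_ge0// ltW.
  apply: ler_wpM2l; first exact: sph_grad_sq_ge0.
  rewrite lef_pV2 ?posrE//; last by rewrite exprn_gt0// enorm_gt0.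
  by rewrite lerXn2r ?nnegrE ?enorm_ge0// ltW// Ppos.
have d1 : dotr (unitize x - grad P x) z <= e * area_factor P x.
  apply: le_trans (dotr_le_enorm _ _) _; rewrite mulrC.
  by apply: ler_pM => //; exact: enorm_ge0.
have d2 : dotr (grad P x - grad P xi) z <= e * eta.
  apply: le_trans (dotr_le_enorm _ _) _; rewrite mulrC.
  by apply: ler_pM => //; exact: enorm_ge0.
(* With theta = x/|x| this gives |x| <= |y| + theta.z <= P y + theta.z, and P y = P x - grad
   P(xi).z. The excess over P x is therefore (theta - grad P x).z + (grad P x - grad P xi).z,
   bounded by [d1] and [d2]. *)
have dz : dotr (unitize x) x = dotr (unitize x) y + dotr (unitize x) z.
  by rewrite -dotrDr.
move: d1 d2 Pxy; rewrite -yE !dotrBl dotrNr mulrDr -th1 dz => d1 d2 Pxy.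
move: (dotr (unitize x) y) (dotr (unitize x) z) (dotr (grad P x) z)
  (dotr (grad P xi) z) (e * area_factor P x) (e * eta) thy d1 d2 Pxy.
move: (P x) (P y) (enorm y) yP => px py ey yP uy uz gx gxi A B thy d1 d2 Pxy.
clear -yP thy d1 d2 Pxy; lra.
Qed.

End isoperimetric.


Lemma exprD_ge (R : realType) (p h : R) n : 0 <= p -> 0 <= h ->
  p ^+ n.+1 + n.+1%:R * h * p ^+ n <= (p + h) ^+ n.+1.
Proof.
move=> p0 h0; have := exprS_tangent n (addr_ge0 p0 h0) p0.
rewrite mulrDr mulrDl (exprS p n) -(natr1 n).
by set A := p ^+ n; set B := (p + h) ^+ _; lra.
Qed.

Section isoperimetric_inequality.
Context {R : realType}.
Variable k : nat.
Local Notation V := ('rV[R]_k.+1).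
Implicit Types P : V -> R.

Lemma sph_cont_area_factor P : sph_C1 P -> (forall x, x != 0 -> 0 < P x) ->
  sph_cont (area_factor P).
Proof.
move=> cP Ppos; have [cP0 _ _] := cP.
apply/sph_cont_sqrt/sph_contD; first exact: sph_cont_cst.
apply: sph_contM; first exact: sph_cont_grad_sq.
apply: (@sph_cont_comp _ _ (fun x => P x ^+ 2) (fun t => t^-1)); first exact: sph_contX.
move=> x x0; apply: inv_continuous.
by rewrite expf_neq0// gt_eqF// Ppos.
Qed.

(** The summands are the region inside the graph and the ball of radius [e], of volumes a^(k+1) and
    (e b)^(k+1); [thicken_star_shaped] encloses their sum in a star-shaped set whose volume is
    computable. *)
Lemma brunn_minkowski_thicken P (eta a b : R) :
  sph_C1 P -> (forall x, x != 0 -> 0 < P x) -> 0 < eta -> 0 < a -> 0 < b ->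
  a ^+ k.+1 = bint (fun x => P x ^+ k.+1) -> b ^+ k.+1 = bint (fun _ : V => 1) ->
  exists2 e0 : R, 0 < e0 & forall e, 0 < e <= e0 ->
    (a + e * b) ^+ k.+1 <=
    bint (fun x => (P x + e * (area_factor P x + eta)) ^+ k.+1).
Proof.
move=> cP Ppos eta0 a0 b0 aE bE; have [cP0 _ _] := cP.
have [e0 e00 thick] := thicken_star_shaped cP Ppos eta0.
exists e0 => // e ee0; have [e_gt0 _] := andP ee0.
have [M M0 PM] := sph_bounded cP0.
have cw : sph_cont (fun x => P x + e * (area_factor P x + eta)).
  apply: sph_contD => //; apply: sph_contM; first exact: sph_cont_cst.
  by apply: sph_contD; [exact: sph_cont_area_factor|exact: sph_cont_cst].
have P0 : sph_nneg P by move=> x /Ppos /ltW.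
have w0 : sph_nneg (fun x => P x + e * (area_factor P x + eta)).
  move=> x x0; rewrite addr_ge0 ?P0// mulr_ge0 ?(ltW e_gt0)// addr_ge0 ?(ltW eta0)//.
  exact: sqrtr_ge0.
have mK u : sph_cont u -> rv_measurable (fun x : V => enorm x <= cone_radius u x).
  move=> cu; apply: rv_measurable_le; first exact: rv_measurable_enorm.
  exact: rv_measurable_sph.
have mB (s : R) : rv_measurable (fun x : V => enorm x <= s).
  by apply: rv_measurable_le; [exact: rv_measurable_enorm|exact: rv_measurable_cst].
have volB : vol (fun x : V => enorm x <= e) = ((e * b) ^+ k.+1)%:E.
  rewrite -[LHS]/(vol (cone_ball xpredT e)) vol_cone_ball//; last first.
    exact: rv_measurable_cst.
  rewrite exprMn EFinM; congr (_ * _)%E; rewrite bE.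
  rewrite (_ : bint _ = bint (fun _ : V => 1 ^+ k.+1)); last first.
    by apply: eq_bint => x _; rewrite expr1n.
  rewrite -vol_star_shaped; last 2 first.
  - exact: sph_cont_cst.
  - by move=> x _; exact: ler01.
  apply: eq_leb_iint => x; rewrite /cone_ball /cone_radius/=.
  congr (if _ then _ else _); have [->|//] := eqVneq x 0.
  by rewrite enorm0 lexx ler01.
rewrite -lee_fin -vol_star_shaped//.
apply: (@brunn_minkowski _ _ (fun x => enorm x <= cone_radius P x)
  (fun x => enorm x <= e) _ _ _ (M + e)); rewrite ?mulr_gt0 ?addr_gt0//.
- exact: mK.
- exact: mK.
- move=> x xP i; apply: le_trans (normr_coord_le_enorm _ _) _.
  apply: le_trans xP _; rewrite /cone_radius; case: ifP => [x0|_]; last first.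
    by rewrite addr_ge0// ltW.
  apply: le_trans (ler_norm _) (le_trans (PM x x0) _).
  by rewrite lerDl ltW.
- move=> x xe i; apply: le_trans (normr_coord_le_enorm _ _) (le_trans xe _).
  by rewrite lerDr ltW.
- by move=> x y; exact: thick.
- by rewrite vol_star_shaped// aE.
- by rewrite volB.
Qed.

End isoperimetric_inequality.

Section isoperimetric_ge0.
Context {R : realType}.
Variable k : nat.
Local Notation V := ('rV[R]_k.+2).
Implicit Types P : V -> R.

(** The Euclidean area element of the graph of [P] over the n-sphere, with n = k + 1. *)
Definition area_density P (x : V) : R :=
  P x ^+ k * Num.sqrt (P x ^+ 2 + sph_grad_sq P x).

Lemma area_density_factor P x : 0 < P x ->
  area_density P x = area_factor P x * P x ^+ k.+1.
Proof.
move=> P0; rewrite /area_density /area_factor (exprSr _ k) mulrCA; congr (_ * _).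
have -> : P x ^+ 2 + sph_grad_sq P x = (1 + sph_grad_sq P x / P x ^+ 2) * P x ^+ 2.
  by rewrite mulrDl mul1r mulfVK// expf_neq0// gt_eqF.
by rewrite sqrtrM ?sqrtr_sqr ?ger0_norm ?(ltW P0)// addr_ge0// divr_ge0 ?sqr_ge0// sph_grad_sq_ge0.
Qed.

Lemma sph_cont_area_density P : sph_C1 P -> sph_cont (area_density P).
Proof.
move=> cP; have [cP0 _ _] := cP; apply: sph_contM; first exact: sph_contX.
by apply/sph_cont_sqrt/sph_contD; [exact: sph_contX|exact: sph_cont_grad_sq].
Qed.

Lemma bint_cst (c : R) : 0 <= c -> bint (fun _ : V => c) = c * bint (fun _ : V => 1).
Proof.
move=> c0; rewrite -bintZ; [|by []|exact: sph_cont_cst|by move=> x _; exact: ler01].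
by apply: eq_bint => x _; rewrite mulr1.
Qed.

Lemma thicken_expansion P (eta : R) : sph_C1 P -> (forall x, x != 0 -> 0 < P x) ->
  0 < eta <= 1 -> exists2 K : R, 0 <= K & forall e x, 0 < e <= 1 -> x != 0 ->
    (P x + e * (area_factor P x + eta)) ^+ k.+2 <=
    P x ^+ k.+2 + k.+2%:R * e * (area_density P x + eta * P x ^+ k.+1 + e * K).
Proof.
move=> cP Ppos /andP[eta0 eta1]; have [cP0 _ _] := cP.
have caf := sph_cont_area_factor cP Ppos.
have [M M0 PM] := sph_bounded cP0.
have [W W0 aW] := sph_bounded caf.
have af0 x : 0 <= area_factor P x by exact: sqrtr_ge0.
pose w x := area_factor P x + eta.
have w0 x : 0 <= w x by rewrite addr_ge0// ltW.
have wW x : x != 0 -> w x <= W + 1.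
  by move=> x0; rewrite lerD//; apply: le_trans (aW x x0); exact: ler_norm.
have PM' x : x != 0 -> P x <= M by move=> /PM; apply: le_trans; exact: ler_norm.
(* Second-order remainder: [w] is at most W + 1, and (P + e w)^(k+1) - P^(k+1) is at most [e] times
   the remaining factor. *)
pose K := (W + 1) * (k.+1%:R * (W + 1) * (M + (W + 1)) ^+ k).
have W10 : 0 < W + 1 by rewrite addr_gt0.
have K0 : 0 < K by rewrite !mulr_gt0// exprn_gt0// addr_gt0.
exists K => [|e x /andP[e_gt0 e1] x0]; first exact: ltW.
have Px0 := ltW (Ppos x x0).
have ew0 : 0 <= e * w x by rewrite mulr_ge0// ltW.
apply: le_trans (exprnD_le k.+1 Px0 ew0) _; rewrite lerD2l -!mulrA.
apply: ler_wpM2l => //; apply: ler_wpM2l; first exact: ltW.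
rewrite area_density_factor ?Ppos// -mulrDl -/(w x).
have h : (P x + e * w x) ^+ k.+1 <= P x ^+ k.+1 + e * (k.+1%:R * (W + 1) * (M + (W + 1)) ^+ k).
  apply: le_trans (exprnD_le k Px0 ew0) _; rewrite lerD2l.
  rewrite mulrCA -!mulrA; apply: ler_wpM2l; first exact: ltW.
  apply: ler_wpM2l => //; apply: ler_pM => //; [exact: exprn_ge0 (addr_ge0 _ _)|exact: wW|].
  rewrite lerXn2r ?nnegrE ?addr_ge0//; [exact: ltW|exact: ltW|].
  apply: lerD; first exact: PM'.
  by apply: le_trans (wW x x0); rewrite ler_piMl.
apply: le_trans (ler_wpM2l (w0 x) h) _; rewrite mulrDr lerD2l /K mulrCA.
apply: ler_wpM2l; first exact: ltW.
apply: ler_wpM2r; last exact: wW.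
by rewrite !mulr_ge0// ?exprn_ge0// ltW// addr_gt0.
Qed.

(** The thickened volume is at least a^(k+2) + (k+2) e b a^(k+1) by Brunn-Minkowski, and is bounded
    above by [thicken_expansion]. The volumes a^(k+2) cancel and division by (k+2) e leaves the
    coefficients of order one. *)
Lemma isoperimetric_thicken P (eta a b : R) :
  sph_C1 P -> (forall x, x != 0 -> 0 < P x) -> 0 < eta <= 1 ->
  0 < a -> 0 < b -> a ^+ k.+2 = bint (fun x => P x ^+ k.+2) ->
  b ^+ k.+2 = bint (fun _ : V => 1) ->
  exists2 K : R, 0 <= K & exists2 e0 : R, 0 < e0 & forall e : R, 0 < e <= e0 ->
    a ^+ k.+1 * b <= bint (area_density P) + eta * bint (fun x => P x ^+ k.+1) +
      e * K * bint (fun _ : V => 1).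
Proof.
move=> cP Ppos eta01 a0 b0 aE bE; have [cP0 _ _] := cP.
have [eta0 _] := andP eta01.
have P0 : sph_nneg P by move=> x /Ppos /ltW.
have [e0 e00 BM] := brunn_minkowski_thicken cP Ppos eta0 a0 b0 aE bE.
have [K K0 key] := thicken_expansion cP Ppos eta01.
exists K => //; exists (Num.min 1 e0); first by rewrite lt_min ltr01.
move=> e /andP[e_gt0]; rewrite le_min => /andP[e1 ee0].
have caf := sph_cont_area_factor cP Ppos.
have cad := sph_cont_area_density cP.
have af0 x : 0 <= area_factor P x by exact: sqrtr_ge0.
have ad0 : sph_nneg (area_density P).
  by move=> x x0; rewrite mulr_ge0 ?exprn_ge0 ?P0// sqrtr_ge0.
have ccst (c : R) : sph_cont (fun _ : V => c) by exact: sph_cont_cst.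
have cPk n : sph_cont (fun x => P x ^+ n) by exact: sph_contX.
have Pk0 n : sph_nneg (fun x => P x ^+ n) by move=> x x0; rewrite exprn_ge0// P0.
have eb0 : 0 <= e * b by rewrite mulr_ge0// ltW.
have eK0 : 0 <= e * K by rewrite mulr_ge0// ltW.
have e01 : 0 < e <= 1 by rewrite e_gt0.
have hBM := BM e (introT andP (conj e_gt0 ee0)).
have low := exprD_ge k.+1 (ltW a0) eb0.
have c1 : sph_cont (fun x => area_density P x + eta * P x ^+ k.+1).
  by apply: sph_contD => //; apply: sph_contM.
have n1 : sph_nneg (fun x => area_density P x + eta * P x ^+ k.+1).
  by move=> x x0; rewrite addr_ge0 ?ad0// mulr_ge0 ?Pk0// ltW.
have c2 : sph_cont (fun x => area_density P x + eta * P x ^+ k.+1 + e * K).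
  exact: sph_contD.
have n2 : sph_nneg (fun x => area_density P x + eta * P x ^+ k.+1 + e * K).
  by move=> x x0; rewrite addr_ge0 ?n1// mulr_ge0// ltW.
have ne0 : 0 <= k.+2%:R * e by rewrite mulr_ge0// ltW.
have up : bint (fun x => (P x + e * (area_factor P x + eta)) ^+ k.+2) <=
    bint (fun x => P x ^+ k.+2) + k.+2%:R * e * (bint (area_density P) +
      eta * bint (fun x => P x ^+ k.+1) + e * K * bint (fun _ : V => 1)).
  apply: (@le_trans _ _ (bint (fun x => P x ^+ k.+2 + k.+2%:R * e *
      (area_density P x + eta * P x ^+ k.+1 + e * K)))).
    apply: le_bint; last by move=> x x0; exact: key.
    - apply/sph_contX/sph_contD => //; apply: sph_contM; first exact: ccst.
      exact: sph_contD.
    - apply: sph_contD; first exact: cPk.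
      by apply: sph_contM; first exact: ccst.
    - move=> x x0; rewrite exprn_ge0// addr_ge0 ?P0// mulr_ge0 ?(ltW e_gt0)//.
      by rewrite addr_ge0// ltW.
  rewrite bintD//; last 2 first.
  - by apply: sph_contM; first exact: ccst.
  - by move=> x x0; rewrite mulr_ge0// n2.
  rewrite lerD2l bintZ// bintD//.
  rewrite bintD//; last 2 first.
  - by apply: sph_contM; [exact: ccst|exact: cPk].
  - by move=> x x0; rewrite mulr_ge0 ?Pk0// ltW.
  by rewrite (bintZ (ltW eta0))// (bint_cst eK0).
have := le_trans low (le_trans hBM up).
rewrite aE lerD2l -[X in X <= _]mulrA -[X in _ <= X]mulrA ler_pM2l//.
by rewrite -mulrA ler_pM2l// mulrC.
Qed.

(** An iterated limit: [K] and [e0] depend on [eta], so [eta] is chosen first and [e] afterwards,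
    each for half of the tolerance. *)
Lemma le_of_two_scale (X Y I1 I0 : R) : 0 <= I1 -> 0 <= I0 ->
  (forall eta : R, 0 < eta <= 1 -> exists2 K : R, 0 <= K & exists2 e0 : R, 0 < e0 &
    forall e : R, 0 < e <= e0 -> X <= Y + eta * I1 + e * K * I0) -> X <= Y.
Proof.
move=> I10 I00 H; apply/ler_addgt0Pr => d d0.
have small (c J : R) : 0 < c -> 0 <= J ->
    let t := Num.min c (d / 2 / (J + 1)) in [/\ 0 < t, t <= c & t * J <= d / 2].
  move=> c0 J0 t; have J1 : 0 < J + 1 by rewrite ltr_wpDl.
  split; first by rewrite lt_min c0 !divr_gt0.
    by rewrite ge_min lexx.
  apply: (@le_trans _ _ (d / 2 / (J + 1) * J)).
    by apply: ler_wpM2r => //; rewrite /t ge_min lexx orbT.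
  by rewrite mulrAC ler_pdivrMr// mulrDr mulr1 lerDl ltW// divr_gt0.
have [t0 t1 tI] := small 1 I1 ltr01 I10.
have [|K K0 [e0 e00 He]] := H (Num.min 1 (d / 2 / (I1 + 1))); first by rewrite t0.
have [s0 s1 sI] := small e0 (K * I0) e00 (mulr_ge0 K0 I00).
have := He (Num.min e0 (d / 2 / (K * I0 + 1))); rewrite s0 s1 => /(_ isT) h.
apply: le_trans h _; rewrite -addrA lerD2l [leRHS]splitr.
by apply: lerD => //; rewrite -mulrA.
Qed.

Lemma isoperimetric_gt0 P (a b : R) : sph_C1 P -> (forall x, x != 0 -> 0 < P x) ->
  0 < a -> 0 < b -> a ^+ k.+2 = bint (fun x => P x ^+ k.+2) ->
  b ^+ k.+2 = bint (fun _ : V => 1) -> a ^+ k.+1 * b <= bint (area_density P).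
Proof.
move=> cP Ppos a0 b0 aE bE.
apply: (@le_of_two_scale _ _ (bint (fun x => P x ^+ k.+1)) (bint (fun _ : V => 1))).
- by apply: bint_ge0 => x /Ppos /ltW Px; exact: exprn_ge0.
- by apply: bint_ge0 => x _; exact: ler01.
- by move=> eta eta01; exact: isoperimetric_thicken.
Qed.

End isoperimetric_ge0.


(** * Isoperimetric inequality when the radius may vanish *)

Section isoperimetric_degenerate.
Context {R : realType}.
Variable k : nat.
Local Notation V := ('rV[R]_k.+2).
Implicit Types P : V -> R.

Lemma derive_addr_cst P (c : R) (v x : V) : 'D_v (fun y => P y + c) x = 'D_v P x.
Proof.
rewrite /derive (_ : (fun h : R => h^-1 *: (((fun y => P y + c) \o shift x) (h *: v) - (P x + c))) =
  (fun h => h^-1 *: ((P \o shift x) (h *: v) - P x)))//.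
by apply/funext => h /=; rewrite opprD addrACA subrr addr0.
Qed.

Lemma sph_C1_addr_cst P (c : R) : sph_C1 P -> sph_C1 (fun x => P x + c).
Proof.
move=> [cP dP cD]; split.
- by apply: sph_contD => //; exact: sph_cont_cst.
- by move=> x /dP dPx; apply: differentiableD => //; exact: differentiable_cst.
- move=> i x x0; rewrite (_ : (fun y => _) = (fun y => 'D_(delta_mx ord0 i) P y)).
    exact: cD.
  by apply/funext => y; exact: derive_addr_cst.
Qed.

Lemma sph_grad_sq_addr_cst P (c : R) x :
  sph_grad_sq (fun y => P y + c) x = sph_grad_sq P x.
Proof. by apply: eq_bigr => i _; rewrite derive_addr_cst. Qed.

Lemma exprD_le_bound (p h M : R) n : 0 <= p <= M -> 0 <= h <= 1 ->
  (p + h) ^+ n <= p ^+ n + h * (n%:R * (M + 1) ^+ n).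
Proof.
move=> /andP[p0 pM] /andP[h0 h1]; case: n => [|n]; first by rewrite !expr0 mul0r mulr0 addr0.
apply: le_trans (exprnD_le n p0 h0) _; rewrite lerD2l (mulrC _ h) -mulrA.
have M1 : 1 <= M + 1 by rewrite lerDr (le_trans p0).
apply: ler_wpM2l => //; apply: ler_wpM2l => //.
apply: (@le_trans _ _ ((M + 1) ^+ n)).
  have ph0 : 0 <= p + h by exact: addr_ge0.
  have phM : p + h <= M + 1 by exact: lerD.
  by rewrite lerXn2r ?nnegrE// (le_trans ph0).
by rewrite exprS ler_peMl// exprn_ge0// (le_trans ler01).
Qed.

(** Triangle inequality in the plane for (p, sqrt q) and (h, 0). *)
Lemma sqrt_addr_sqr_le (p q h : R) : 0 <= p -> 0 <= q -> 0 <= h ->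
  Num.sqrt ((p + h) ^+ 2 + q) <= Num.sqrt (p ^+ 2 + q) + h.
Proof.
move=> p0 q0 h0; have s0 : 0 <= p ^+ 2 + q by rewrite addr_ge0 ?sqr_ge0.
set s := Num.sqrt (p ^+ 2 + q); have sge0 : 0 <= s by exact: sqrtr_ge0.
have ps : p <= s by rewrite -[p]ger0_norm// -sqrtr_sqr ler_sqrt// lerDl.
have sE : s ^+ 2 = p ^+ 2 + q by rewrite sqr_sqrtr.
rewrite -(@ler_pXn2r _ 2) ?nnegrE ?addr_ge0 ?sqrtr_ge0// sqr_sqrtr ?addr_ge0 ?sqr_ge0//.
have := ler_wpM2r h0 ps; rewrite !sqrrD sE => hp; clear -hp; lra.
Qed.

Lemma area_density_addr_cst_le P : sph_C1 P -> sph_nneg P ->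
  exists2 C : R, 0 <= C & forall d x, 0 < d <= 1 -> x != 0 ->
    area_density (fun y => P y + d) x <= area_density P x + d * C.
Proof.
move=> cP P0; have [cP0 _ _] := cP.
have [M M0 PM] := sph_bounded cP0.
have cS : sph_cont (fun x => Num.sqrt (P x ^+ 2 + sph_grad_sq P x)).
  by apply/sph_cont_sqrt/sph_contD; [exact: sph_contX|exact: sph_cont_grad_sq].
have [W W0 SW] := sph_bounded cS.
have M10 : 0 <= M + 1 by rewrite addr_ge0// ltW.
pose C1 := k%:R * (M + 1) ^+ k.
have C10 : 0 <= C1 by rewrite mulr_ge0// exprn_ge0.
exists (C1 * W + (M + 1) ^+ k).
  by rewrite addr_ge0 ?exprn_ge0// mulr_ge0// ltW.
move=> d x /andP[d0 d1] x0; have Px := P0 x x0.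
have PxM : P x <= M by apply: le_trans (PM x x0); exact: ler_norm.
rewrite /area_density sph_grad_sq_addr_cst.
set s := Num.sqrt (P x ^+ 2 + _).
have s0 : 0 <= s by exact: sqrtr_ge0.
have sW : s <= W by apply: le_trans (SW x x0); exact: ler_norm.
have Pd0 : 0 <= P x + d by rewrite addr_ge0// ltW.
apply: (@le_trans _ _ ((P x + d) ^+ k * (s + d))).
  apply: ler_wpM2l; first exact: exprn_ge0.
  by apply: sqrt_addr_sqr_le; rewrite ?sph_grad_sq_ge0// ltW.
rewrite mulrDr mulrDr addrA; apply: lerD; last first.
  rewrite mulrC; apply: ler_wpM2l; first exact: ltW.
  by rewrite lerXn2r ?nnegrE// lerD.
have Pb : 0 <= P x <= M by rewrite Px.
have db : 0 <= d <= 1 by rewrite ltW.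
apply: le_trans (ler_wpM2r s0 (exprD_le_bound k Pb db)) _.
rewrite mulrDl lerD2l -mulrA -/C1; apply: ler_wpM2l; first exact: ltW.
exact: ler_wpM2l.
Qed.

(** The shifted radius P + d is positive, has the same gradient and encloses no less volume; its
    area density exceeds that of [P] by at most d C, and [d] tends to 0. *)
Lemma isoperimetric P (a b : R) : sph_C1 P -> sph_nneg P -> 0 <= a -> 0 < b ->
  a ^+ k.+2 = bint (fun x => P x ^+ k.+2) -> b ^+ k.+2 = bint (fun _ : V => 1) ->
  a ^+ k.+1 * b <= bint (area_density P).
Proof.
move=> cP P0 a0 b0 aE bE; have [cP0 _ _] := cP.
have ad0 : sph_nneg (area_density P).
  by move=> x x0; rewrite mulr_ge0 ?exprn_ge0 ?P0// sqrtr_ge0.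
move: a0; rewrite le_eqVlt => /orP[/eqP <-|a0].
  by rewrite exprS !mul0r; exact: bint_ge0.
have [C C0 adC] := area_density_addr_cst_le cP P0.
have cad := sph_cont_area_density cP.
apply: (@le_of_two_scale _ _ _ 0 (bint (fun _ : V => 1))) => //.
  by apply: bint_ge0 => x _; exact: ler01.
move=> eta _; exists C => //; exists 1 => // d /andP[d0 d1]; rewrite mulr0 addr0.
have Pdpos x : x != 0 -> 0 < P x + d by move=> x0; rewrite ltr_wpDl// P0.
have cPd : sph_C1 (fun x => P x + d) by exact: sph_C1_addr_cst.
have [cPd0 _ _] := cPd.
pose ad := bint (fun x => (P x + d) ^+ k.+2).
have leI : a ^+ k.+2 <= ad.
  rewrite aE; apply: le_bint; [exact: sph_contX|exact: sph_contX| |].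
    by move=> x x0; rewrite exprn_ge0// P0.
  move=> x x0; rewrite lerXn2r ?nnegrE ?P0//; first exact: ltW (Pdpos x x0).
  by rewrite lerDl ltW.
have ad_gt0 : 0 < ad by apply: lt_le_trans leI; rewrite exprn_gt0.
have [r r0 rE] := root_exists k.+1 ad_gt0.
have ar : a <= r.
  by rewrite -(@ler_pXn2r _ k.+2) ?nnegrE ?rE//; exact: ltW.
apply: (@le_trans _ _ (r ^+ k.+1 * b)).
  apply: ler_wpM2r; first exact: ltW.
  by rewrite lerXn2r ?nnegrE// ltW.
apply: le_trans (isoperimetric_gt0 cPd Pdpos r0 b0 rE bE) _.
have dC0 : 0 <= d * C by rewrite mulr_ge0// ltW.
rewrite -(bint_cst _ dC0) -bintD;
  [|exact: cad|exact: sph_cont_cst|exact: ad0|by move=> x _].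
apply: le_bint; first exact: sph_cont_area_density.
- by apply: sph_contD => //; exact: sph_cont_cst.
- move=> x x0; rewrite mulr_ge0 ?sqrtr_ge0// exprn_ge0//.
  exact: ltW (Pdpos x x0).
- by move=> x x0; apply: adC => //; rewrite d0.
Qed.

End isoperimetric_degenerate.


(** * The warping function *)

Section fundamental_theorem.
Context {R : realType}.
Implicit Types f F g : R -> R.
Local Notation mu := (@lebesgue_measure R).

Lemma is_derive_continuous F (s d : R) : is_derive s 1 F d -> {for s, continuous F}.
Proof. by case=> dF _; apply: differentiable_continuous; exact/derivable1_diffP. Qed.

Lemma eq_rint f g (c t : R) : (forall s, c <= s <= t -> f s = g s) ->
  rint c t f = rint c t g.
Proof.
move=> fg; rewrite /rint; congr fine; apply: eq_integral => s.
by rewrite inE/= in_itv/= => /fg ->.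
Qed.

Lemma rint_ge0 f (c t : R) : (forall s, c <= s <= t -> 0 <= f s) -> 0 <= rint c t f.
Proof.
move=> f0; apply/fine_ge0/integral_ge0 => s /=; rewrite in_itv/= => /f0.
by rewrite lee_fin.
Qed.

Lemma rint_xx f (c : R) : rint c c f = 0.
Proof. by rewrite /rint set_itv1 integral_set1. Qed.

Lemma rint_FTC f F (c t : R) : c <= t ->
  (forall s, c <= s <= t -> {for s, continuous f}) ->
  (forall s, c <= s <= t -> is_derive s 1 F (f s)) -> rint c t f = F t - F c.
Proof.
rewrite le_eqVlt => /orP[/eqP <- _ _|ct cf dF]; first by rewrite rint_xx subrr.
have cF s : c <= s <= t -> {for s, continuous F}.
  by move=> /dF; exact: is_derive_continuous.
rewrite /rint (@continuous_FTC2 _ f F)//.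
- by apply: continuous_in_subspaceT => s; rewrite inE/= in_itv/= => /cf.
- split.
  + by move=> s; rewrite in_itv/= => /andP[cs st]; case: (dF s) => //; rewrite !ltW.
  + by apply: cvg_at_right_filter; apply: cF; rewrite lexx ltW.
  + by apply: cvg_at_left_filter; apply: cF; rewrite lexx ltW.
- move=> s; rewrite in_itv/= => /andP[cs st]; rewrite derive1E.
  by case: (dF s) => //; rewrite !ltW.
Qed.

Lemma antiderivative_exists f (c : R) : continuous f ->
  exists F : R -> R, forall s, c < s -> is_derive s 1 F (f s).
Proof.
move=> cf; exists (fun x => \int[mu]_(t in `[c, x]) f t)%R => s cs.
have su : s < s + 1 by rewrite ltrDl.
have fi : mu.-integrable `[c, s + 1] (EFin \o f).
  apply: continuous_compact_integrable; first exact: segment_compact.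
  by apply: continuous_subspaceT.
have [dF FE] := continuous_FTC1_closed su fi cs (cf s).
by split; [exact: dF|rewrite -derive1E; exact: FE].
Qed.

(** The integrand may blow up at [c]. Monotone convergence along the intervals [b_i, t], with b_i
    decreasing to [c], needs only its sign and the continuity of the primitive at [c]. *)
Lemma rint_FTC_improper f F (c t : R) : c <= t ->
  (forall s, c < s <= t -> {for s, continuous f}) ->
  (forall s, c < s <= t -> 0 <= f s) ->
  (forall s, c < s <= t -> is_derive s 1 F (f s)) -> {for c, continuous F} ->
  rint c t f = F t - F c.
Proof.
rewrite le_eqVlt => /orP[/eqP <- _ _ _ _|ct cf f0 dF cF]; first by rewrite rint_xx subrr.
pose b_ (i : nat) : R := c + (t - c) / i.+1%:R.
have tc0 : 0 < t - c by rewrite subr_gt0.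
have cb i : c < b_ i by rewrite ltrDl divr_gt0.
have bt i : b_ i <= t.
  by rewrite /b_ -lerBrDl; apply: ler_piMr; [exact: ltW|rewrite invf_le1// ler1n].
have bnd i j : (i <= j)%N -> b_ j <= b_ i.
  move=> ij; rewrite lerD2l; apply: ler_wpM2l; first exact: ltW.
  by rewrite lef_pV2 ?posrE// ler_nat.
have bc : b_ i @[i --> \oo] --> c.
  rewrite -[X in _ --> X]addr0; apply: cvgD; first exact: cvg_cst.
  rewrite -[X in _ --> X](mulr0 (t - c)); apply: cvgMl_tmp.
  exact: cvg_harmonic.
have mf : measurable_fun `]c, t] f.
  apply: subspace_continuous_measurable_fun => //.
  by apply: continuous_in_subspaceT => s; rewrite inE/= in_itv/= => /cf.
pose g_ i (s : R) : \bar R := ((EFin \o f) \_ `[b_ i, t]) s.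
have sub i : `[b_ i, t] `<=` `]c, t].
  by move=> s /=; rewrite !in_itv/= => /andP[bs ->]; rewrite (lt_le_trans (cb i)).
have mg i : measurable_fun `]c, t] (g_ i).
  apply: measurable_funTS; apply/(measurable_restrictT _ _).1 => //.
  by apply/measurable_EFinP; apply: measurable_funS (sub i) mf.
have g0 i s : `]c, t]%classic s -> (0 <= g_ i s)%E.
  rewrite /g_ patchE => /= _; case: ifP => //; rewrite inE => /(sub i).
  by rewrite /= in_itv/= lee_fin => /f0.
have gnd s : `]c, t]%classic s -> {homo g_ ^~ s : i j / (i <= j)%N >-> (i <= j)%E}.
  move=> cst i j ij; rewrite /g_ !patchE; case: ifPn => bi; last first.
    by have := g0 j s cst; rewrite /g_ patchE.
  rewrite ifT//; move: bi; rewrite !inE/= !in_itv/= => /andP[bs ->].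
  by rewrite (le_trans (bnd _ _ ij)).
have := monotone_convergence mu (measurable_itv _) mg g0 gnd.
rewrite /rint -integral_itv_obnd_cbnd; last exact/measurable_EFinP.
have -> : (\int[mu]_(x in `]c, t]) limn (g_ ^~ x) = \int[mu]_(x in `]c, t]) (f x)%:E)%E.
  apply: eq_integral => s; rewrite inE/= in_itv/= => /andP[cs st].
  apply/cvg_lim => //; apply: cvg_near_cst; near=> i.
  rewrite /g_ patchE ifT// inE/= in_itv/= st andbT; apply/ltW; near: i.
  by apply: (cvgr_lt c).
move=> ->; have -> : (fun i => \int[mu]_(x in `]c, t]) g_ i x)%E =
    (fun i => (F t - F (b_ i))%:E).
  apply/funext => i; rewrite /g_ -integral_mkcondr.
  rewrite (_ : _ `&` _ = `[b_ i, t]%classic); last first.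
    by apply/setIidPr; exact: sub.
  have bpos s : b_ i <= s <= t -> c < s <= t.
    by move=> /andP[bs ->]; rewrite (lt_le_trans (cb i)).
  have Fi : rint (b_ i) t f = F t - F (b_ i).
    by apply: rint_FTC => // [s /bpos /cf|s /bpos /dF].
  rewrite -Fi /rint fineK//; apply: integrable_fin_num => //.
  apply: continuous_compact_integrable; first exact: segment_compact.
  by apply: continuous_in_subspaceT => s; rewrite inE/= in_itv/= => /bpos /cf.
rewrite (_ : limn _ = (F t - F c)%:E)//; apply/cvg_lim => //.
apply: cvg_EFin; first by near=> i.
apply: cvgB; first exact: cvg_cst.
by apply: (@continuous_cvg _ _ _ _ _ b_ F c).
Unshelve. all: by end_near.
Qed.

End fundamental_theorem.


Section warping_function.
Context {R : realType}.
Variables (k : nat) (m a : R) (lam : R -> R).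
Let rho0 := m `^ (k.+2%:R)^-1.
Hypothesis m0 : 0 <= m.
Hypothesis lam_a : lam a = rho0.

(** The square of lambda' as a function of lambda, with k = n - 1. *)
Definition slope_sq (t : R) : R := 1 + t ^+ 2 - m * t ^- k.

Hypothesis dlam : forall s, a <= s -> is_derive s 1 lam (Num.sqrt (slope_sq (lam s))).

(* [flux t = t^n Lambda(t)], where Lambda(t) = sqrt (1 - m t^(-n-1)) and n = k + 1. *)
Definition flux (t : R) : R := Num.sqrt (t ^+ k.+1 ^+ 2 - m * t ^+ k).

Lemma rho0_ge0 : 0 <= rho0. Proof. exact: powR_ge0. Qed.

Lemma rho0X : rho0 ^+ k.+2 = m.
Proof. by rewrite -powR_mulrn ?powR_ge0// -powRrM mulVf ?powRr1// pnatr_eq0. Qed.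

Lemma rho0_gt0 : 0 < m -> 0 < rho0. Proof. exact: powR_gt0. Qed.

Lemma m_le_exp t : rho0 <= t -> m <= t ^+ k.+2.
Proof.
move=> rt; rewrite -rho0X lerXn2r ?nnegrE ?rho0_ge0//.
exact: le_trans rho0_ge0 rt.
Qed.

Lemma m_exprN_le_sqr t : rho0 <= t -> m * t ^- k <= t ^+ 2.
Proof.
move=> rt; have t0 : 0 <= t by exact: le_trans rho0_ge0 rt.
move: t0; rewrite le_eqVlt => /orP[/eqP t0|t0].
  have -> : m = 0.
    apply/eqP; rewrite eq_le m0 andbT; apply: le_trans (m_le_exp rt) _.
    by rewrite -t0 expr0n.
  by rewrite mul0r sqr_ge0.
by rewrite ler_pdivrMr ?exprn_gt0// -exprD addnC addn2 m_le_exp.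
Qed.

Lemma slope_sq_ge1 t : rho0 <= t -> 1 <= slope_sq t.
Proof. by move=> /m_exprN_le_sqr h; rewrite /slope_sq -addrA lerDl subr_ge0. Qed.

Lemma slope_sqE t : rho0 <= t -> Num.sqrt (slope_sq t) ^+ 2 = slope_sq t.
Proof. by move=> /slope_sq_ge1 h; rewrite sqr_sqrtr// (le_trans ler01). Qed.

Lemma lam_continuous s : a <= s -> {for s, continuous lam}.
Proof. by move=> /dlam; exact: is_derive_continuous. Qed.

Lemma derive1_lam s : a <= s -> derive1 lam s = Num.sqrt (slope_sq (lam s)).
Proof. by move=> /dlam ds; rewrite derive1E derive_val. Qed.

Lemma lam_mvt s t : a <= s -> s <= t ->
  exists2 c, s <= c <= t & lam t - lam s = Num.sqrt (slope_sq (lam c)) * (t - s).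
Proof.
move=> as_ st; have [c] : exists2 c, c \in `[s, t] &
    lam t - lam s = Num.sqrt (slope_sq (lam c)) * (t - s).
  apply: (MVT_segment (df := fun c => Num.sqrt (slope_sq (lam c)))) => // [c|].
    by rewrite in_itv/= => /andP[sc _]; apply: dlam; rewrite (le_trans as_)// ltW.
  apply: continuous_in_subspaceT => c; rewrite inE/= in_itv/= => /andP[sc _].
  by apply: lam_continuous; exact: le_trans sc.
by rewrite in_itv/= => sct h; exists c.
Qed.

Lemma lam_nondecreasing s t : a <= s -> s <= t -> lam s <= lam t.
Proof.
move=> as_ st; have [c _ h] := lam_mvt as_ st.
by rewrite -subr_ge0 h mulr_ge0 ?sqrtr_ge0// subr_ge0.
Qed.

Lemma lam_ge_rho0 s : a <= s -> rho0 <= lam s.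
Proof. by move=> as_; rewrite -lam_a; apply: lam_nondecreasing. Qed.

Lemma lam_ge0 s : a <= s -> 0 <= lam s.
Proof. by move=> /lam_ge_rho0; apply: le_trans; exact: rho0_ge0. Qed.

(** [slope_sq] is at least 1 above [rho0], so lambda' >= 1. This gives injectivity of [lam] and, by
    the intermediate value theorem, its inverse on all values above [rho0]. *)
Lemma lam_expanding s t : a <= s -> s <= t -> t - s <= lam t - lam s.
Proof.
move=> as_ st; have [c /andP[sc _] ->] := lam_mvt as_ st.
rewrite ler_peMl ?subr_ge0// -[leLHS]sqrtr1 ler_sqrt.
  by apply/slope_sq_ge1/lam_ge_rho0; exact: le_trans sc.
by apply: le_trans ler01 _; apply/slope_sq_ge1/lam_ge_rho0; exact: le_trans sc.
Qed.

Lemma lam_inj s t : a <= s -> a <= t -> lam s = lam t -> s = t.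
Proof.
move=> as_ at_ st; apply/eqP; rewrite eq_le; apply/andP; split; rewrite leNgt; apply/negP => h.
  have := lam_expanding at_ (ltW h); rewrite st subrr; lra.
have := lam_expanding as_ (ltW h); rewrite st subrr; lra.
Qed.

Lemma lam_inv_spec t : rho0 <= t -> a <= lam_inv lam a t /\ lam (lam_inv lam a t) = t.
Proof.
move=> rt; apply: (@xgetPex _ a [set s | a <= s /\ lam s = t]).
have tr : a <= a + (t - rho0) by rewrite lerDl subr_ge0.
have [|||s] := @IVT R lam a (a + (t - rho0)) t => //.
- apply: continuous_in_subspaceT => s; rewrite inE/= in_itv/= => /andP[as_ _].
  exact: lam_continuous.
- have := lam_expanding (lexx a) tr; rewrite lam_a => h.
  have rl : t <= lam (a + (t - rho0)) by lra.
  by rewrite min_l ?max_r ?rt ?rl// (le_trans rt).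
- by rewrite in_itv/= => /andP[as_ _] st; exists s.
Qed.

Lemma Lambda_flux t : rho0 <= t -> Lambda lam a t * t ^+ k.+1 = flux t.
Proof.
move=> rt; have [ai li] := lam_inv_spec rt.
have t0 : 0 <= t by exact: le_trans rho0_ge0 rt.
rewrite /Lambda /Psi derive1_lam// li slope_sqE//.
(* [t = 0] is possible only for m = 0; division by zero in [Lambda] is harmless since the factor
   t^(k+1) is 0. *)
have [t_0|tN0] := eqVneq t 0.
  rewrite /flux t_0 exprS mul0r mulr0 expr0n/= sub0r.
  have -> : m = 0.
    apply/eqP; rewrite eq_le m0 andbT; apply: le_trans (m_le_exp rt) _.
    by rewrite t_0 expr0n.
  by rewrite mul0r oppr0 sqrtr0.
have tk0 : 0 <= t ^+ k by exact: exprn_ge0.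
have -> : slope_sq t - 1 = t ^+ 2 - m * t ^- k by rewrite /slope_sq; ring.
rewrite (exprS t k) mulrA mulfVK// -[X in _ * X]ger0_norm// -sqrtr_sqr -sqrtrM.
  congr Num.sqrt; rewrite (exprS t k).
  by have := expf_neq0 k tN0; move: (t ^+ k) => X X0; field.
by rewrite subr_ge0 m_exprN_le_sqr.
Qed.

Lemma flux_sq t : rho0 <= t -> flux t ^+ 2 = t ^+ k.+1 ^+ 2 - m * t ^+ k.
Proof.
move=> rt; have t0 : 0 <= t by exact: le_trans rho0_ge0 rt.
rewrite sqr_sqrtr// subr_ge0 -exprM muln2 -addnn addSnnS exprD [leRHS]mulrC.
by apply: ler_wpM2r; [exact: exprn_ge0|exact: m_le_exp].
Qed.

Lemma slope_flux t : rho0 <= t -> slope_sq t * t ^+ k.+1 ^+ 2 =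
  t ^+ k.+1 ^+ 2 + t ^+ 2 * flux t ^+ 2.
Proof.
move=> rt; rewrite flux_sq//; have t0 : 0 <= t by exact: le_trans rho0_ge0 rt.
rewrite /slope_sq; have [t_0|tN0] := eqVneq t 0.
  by rewrite t_0 (exprS (0 : R) k) mul0r expr2 !(mul0r, mulr0, expr0n, addr0)/=.
rewrite (exprS t k).
by have := expf_neq0 k tN0; move: (t ^+ k) => X X0; field.
Qed.

Lemma flux_continuous : continuous flux.
Proof.
have cg : continuous (fun t : R => t ^+ k.+1 ^+ 2 - m * t ^+ k).
  move=> t; apply: (cvgB (FF := nbhs_filter t)).
    by apply: (cvg_exprn (FF := nbhs_filter t)); exact: exprn_continuous.
  by apply: (cvgMl_tmp (FF := nbhs_filter t)); exact: exprn_continuous.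
have -> : flux = Num.sqrt \o (fun t => t ^+ k.+1 ^+ 2 - m * t ^+ k) by [].
by move=> t; apply: continuous_comp; [exact: cg|exact: sqrt_continuous].
Qed.

Lemma flux_ge0 t : 0 <= flux t. Proof. exact: sqrtr_ge0. Qed.

End warping_function.


Section derivative_rules.
Context {R : realType}.
Implicit Types f g : R -> R.

Lemma is_derive_exprn f (s d : R) n : is_derive s 1 f d ->
  is_derive s 1 (fun x => f x ^+ n.+1) (n.+1%:R * f s ^+ n * d).
Proof.
move=> df; have -> : (fun x => f x ^+ n.+1) = (f ^+ n.+1 : R -> R).
  by apply/funext => x; rewrite fctE.
exact: is_deriveX.
Qed.

Lemma is_derive_cmul f (c s d : R) : is_derive s 1 f d ->
  is_derive s 1 (fun x => c * f x) (c * d).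
Proof. by move=> df; exact: (is_deriveZ c df). Qed.

Lemma is_derive_sub f g (s d e : R) : is_derive s 1 f d -> is_derive s 1 g e ->
  is_derive s 1 (fun x => f x - g x) (d - e).
Proof. by move=> df dg; exact: (is_deriveB df dg). Qed.

Lemma is_derive_mvt f (d : R -> R) (s t : R) : s <= t ->
  (forall u, s <= u <= t -> is_derive u 1 f (d u)) ->
  exists2 c, s <= c <= t & f t - f s = d c * (t - s).
Proof.
move=> st df; have [c] : exists2 c, c \in `[s, t] & f t - f s = d c * (t - s).
  apply: MVT_segment => // [u|].
    by rewrite in_itv/= => /andP[su ut]; apply: df; rewrite !ltW.
  apply: continuous_in_subspaceT => u; rewrite inE/= in_itv/= => /df.
  exact: is_derive_continuous.
by rewrite in_itv/=; exists c.
Qed.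

End derivative_rules.

(** * Primitives of the flux and of the singular integrand *)

Section warping_integrals.
Context {R : realType}.
Variables (k : nat) (m a : R) (lam : R -> R).
Local Notation rho0 := (m `^ (k.+2%:R)^-1).
Hypothesis m0 : 0 <= m.
Hypothesis lam_a : lam a = rho0.
Hypothesis dlam : forall s, a <= s -> is_derive s 1 lam (Num.sqrt (slope_sq k m (lam s))).
Local Notation flux := (flux k m).

Lemma rint_expr t : rho0 <= t ->
  rint rho0 t (fun s => s ^+ k.+1) = (t ^+ k.+2 - m) / k.+2%:R.
Proof.
move=> rt; pose F (s : R) := k.+2%:R^-1 * s ^+ k.+2.
have -> : rint rho0 t (fun s => s ^+ k.+1) = F t - F rho0; last first.
  by rewrite /F (rho0X k m0); ring.
apply: rint_FTC => //.
- by move=> s _; exact: exprn_continuous.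
- move=> s _.
  apply: is_derive_eq (is_derive_cmul _ (is_derive_exprn k.+1 (is_derive_id s (1 : R)))) _.
  by rewrite mulr1 mulrA mulVf ?mul1r// pnatr_eq0.
Qed.

Lemma sqrt_slope_continuous s : a <= s ->
  {for s, continuous (fun u => Num.sqrt (slope_sq k m (lam u)))}.
Proof.
move=> as_; have cl := lam_continuous dlam as_.
apply: (@continuous_comp _ _ _ (fun u => slope_sq k m (lam u)) Num.sqrt);
  last exact: sqrt_continuous.
(* For m = 0 the function [lam] vanishes at [a] and its negative power may be discontinuous there,
   but the term carrying it disappears. *)
have [mz|mN0] := eqVneq m 0.
  rewrite (_ : (fun u => _) = (fun u => 1 + lam u ^+ 2)); last first.
    by apply/funext => u; rewrite /slope_sq mz mul0r subr0.
  apply: (cvgD (FF := nbhs_filter s)); first exact: cvg_cst.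
  exact: (cvg_exprn (FF := nbhs_filter s)).
have m_gt0 : 0 < m by rewrite lt_neqAle eq_sym mN0.
apply: (cvgB (FF := nbhs_filter s)).
  apply: (cvgD (FF := nbhs_filter s)); first exact: cvg_cst.
  exact: (cvg_exprn (FF := nbhs_filter s)).
apply: (cvgMl_tmp (FF := nbhs_filter s)); apply: (cvgV (FF := nbhs_filter s)).
  rewrite expf_neq0// gt_eqF// (lt_le_trans (rho0_gt0 k m_gt0))//.
  exact: (lam_ge_rho0 lam_a dlam).
exact: (cvg_exprn (FF := nbhs_filter s)).
Qed.

Lemma rint_derive1_lam s : a <= s ->
  rint a s (fun u => derive1 lam u * lam u ^+ k.+1) = (lam s ^+ k.+2 - m) / k.+2%:R.
Proof.
move=> as_.
rewrite (@eq_rint _ _ (fun u => Num.sqrt (slope_sq k m (lam u)) * lam u ^+ k.+1)); last first.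
  by move=> u /andP[au _]; rewrite (derive1_lam dlam).
pose F (u : R) := k.+2%:R^-1 * lam u ^+ k.+2.
set g := fun u : R => _; have -> : rint a s g = F s - F a; last first.
  by rewrite /F lam_a (rho0X k m0); ring.
apply: rint_FTC => //; rewrite /g.
- move=> u /andP[au _]; apply: (cvgM (FF := nbhs_filter u)).
    exact: sqrt_slope_continuous.
  by apply: (cvg_exprn (FF := nbhs_filter u)); exact: (lam_continuous dlam).
- move=> u /andP[au _].
  apply: is_derive_eq (is_derive_cmul _ (is_derive_exprn k.+1 (dlam au))) _.
  by rewrite !mulrA mulVf ?mul1r 1?mulrC// pnatr_eq0.
Qed.

(** Lambda = flux / t^(k+1) = sqrt (1 - m t^(-k-2)) is nondecreasing; the cross-multiplied form also
    covers s = 0. *)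
Lemma flux_mono s t : rho0 <= s -> s <= t -> flux s * t ^+ k.+1 <= flux t * s ^+ k.+1.
Proof.
move=> rs st; have rt := le_trans rs st.
have s0 : 0 <= s by exact: le_trans (rho0_ge0 k m) rs.
have t0 : 0 <= t by exact: le_trans st.
rewrite -(@ler_pXn2r _ 2) ?nnegrE ?mulr_ge0 ?flux_ge0 ?exprn_ge0//.
rewrite !exprMn !(flux_sq m0)// !mulrBl (mulrC (t ^+ _ ^+ 2)) lerD2l lerN2 -!mulrA.
apply: ler_wpM2l => //.
have h : s * (s * s ^+ k) <= t * (t * t ^+ k) by rewrite -!exprS lerXn2r.
have sk0 : 0 <= s ^+ k by exact: exprn_ge0.
have tk0 : 0 <= t ^+ k by exact: exprn_ge0.
have := ler_wpM2l (mulr_ge0 sk0 tk0) h.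
rewrite !(exprS _ k); move: (s ^+ k) (t ^+ k) => S T h'.
by rewrite [leLHS](_ : _ = S * T * (s * (s * S))) ?[leRHS](_ : _ = S * T * (t * (t * T)))//; ring.
Qed.

Lemma flux_gt0 t : rho0 < t -> 0 < flux t.
Proof.
move=> rt; have t0 : 0 < t by exact: le_lt_trans (rho0_ge0 k m) rt.
rewrite sqrtr_gt0 subr_gt0 -exprM (_ : (k.+1 * 2 = k.+2 + k)%N); last first.
  by rewrite muln2 -addnn addSnnS addnC.
rewrite exprD ltr_pM2r ?exprn_gt0// -{1}(rho0X k m0).
by rewrite ltrXn2r// ?rho0_ge0// ltW.
Qed.

Lemma mul_flux t : 0 <= t -> t * flux t = Num.sqrt (t ^+ k.+2 ^+ 2 - m * t ^+ k.+2).
Proof.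
move=> t0; rewrite -{1}[t]ger0_norm// -sqrtr_sqr -sqrtrM ?sqr_ge0//.
by congr Num.sqrt; rewrite !(exprS _ k.+1) !(exprS _ k); ring.
Qed.

(** [T] is the primitive of [flux] that vanishes at [rho0]. The last clause is convexity as a
    function of t^(k+2), stated as a supporting line of slope [c] at [t0]. *)
Definition growth_profile (T : R -> R) :=
  [/\ (forall t, rho0 <= t -> {for t, continuous T}),
      (forall t, rho0 <= t ->
         rint rho0 t (fun s => Lambda lam a s * s ^+ k.+1) = T t),
      (forall t, rho0 <= t -> 0 <= T t) &
      (forall t0, rho0 <= t0 -> exists2 c : R, 0 <= c &
         forall t, rho0 <= t -> T t0 + c * t ^+ k.+2 <= T t + c * t0 ^+ k.+2) ].

Definition singular_integrand (u : R) : R :=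
  derive1 lam u / (lam u ^+ k.+1 * Num.sqrt (derive1 lam u ^+ 2 - 1)) * lam u ^+ k.+1.

Lemma growth_profile_exists : exists2 T : R -> R, growth_profile T &
  forall s, a <= s ->
    k.+2%:R * T (lam s) + m * k.+2%:R / 2 * rint a s singular_integrand =
    lam s * flux (lam s).
Proof.
(* Starting below [rho0] makes [H] differentiable at [rho0] itself; [flux] is continuous on the
   whole line since square roots of negative numbers are 0. *)
have [H dH] := antiderivative_exists (rho0 - 1) (@flux_continuous R k m).
have dH' t : rho0 <= t -> is_derive t 1 H (flux t).
  by move=> rt; apply: dH; rewrite ltrBlDr (le_lt_trans rt)// ltrDl.
have TE t : rho0 <= t ->
    rint rho0 t (fun s => Lambda lam a s * s ^+ k.+1) = H t - H rho0.
  move=> rt; rewrite (@eq_rint _ _ flux); last first.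
    by move=> s /andP[rs _]; exact: (Lambda_flux m0 lam_a dlam).
  apply: rint_FTC => // s; first by move=> _; exact: (@flux_continuous R k m).
  by move=> /andP[rs _]; exact: dH'.
exists (fun t => H t - H rho0).
  split=> //.
  - move=> t rt; apply: (cvgB (FF := nbhs_filter t)); last exact: cvg_cst.
    exact: is_derive_continuous (dH' t rt).
  - move=> t rt; rewrite -TE//; apply: rint_ge0 => s /andP[rs _].
    by rewrite (Lambda_flux m0 lam_a dlam)// flux_ge0.
  - move=> t0 rt0; have t00 : 0 <= t0 by exact: le_trans (rho0_ge0 k m) rt0.
    (* The slope is Lambda(t0) / N. The derivative of H - c u^N is then u^(k+1) (Lambda(u) -
       Lambda(t0)) for u > 0, which changes sign at [t0], where the minimum lies. *)
    exists (k.+2%:R^-1 * (flux t0 / t0 ^+ k.+1)).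
      by rewrite mulr_ge0// divr_ge0 ?flux_ge0 ?exprn_ge0.
    set c := k.+2%:R^-1 * _ => t rt.
    have t_0 : 0 <= t by exact: le_trans (rho0_ge0 k m) rt.
    pose D u := H u - c * u ^+ k.+2.
    pose d u := flux u - flux t0 / t0 ^+ k.+1 * u ^+ k.+1.
    have dD u : rho0 <= u -> is_derive u 1 D (d u).
      move=> ru; have dX := is_derive_exprn k.+1 (is_derive_id u (1 : R)).
      have dcX := is_derive_cmul c dX; have dDu := is_derive_sub (dH' u ru) dcX.
      apply: is_derive_eq dDu _; rewrite mulr1 /d /c; congr (_ - _).
      have : k.+2%:R != 0 :> R by rewrite pnatr_eq0.
      move: (k.+2%:R : R) (flux t0 / _) (u ^+ k.+1) => N A B N0.
      by field.
    suff : D t0 <= D t by rewrite /D; lra.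
    have tN0 : 0 < t0 -> 0 < t0 ^+ k.+1 by move=> h; rewrite exprn_gt0.
    case: (leP t0 t) => tt0.
      have [|u /andP[tu _] DE] := @is_derive_mvt _ D d _ _ tt0.
        by move=> u /andP[tu _]; apply: dD; exact: le_trans tu.
      rewrite -subr_ge0 DE; apply: mulr_ge0; last by rewrite subr_ge0.
      rewrite /d subr_ge0.
      move: t00; rewrite le_eqVlt => /orP[/eqP t0_0|t0_gt0].
        (* At t0 = 0 the inverse is 0 by convention, so the line is horizontal and [flux] being
           nonnegative suffices. *)
        by rewrite -t0_0 exprS mul0r invr0 mulr0 mul0r flux_ge0.
      by rewrite mulrAC ler_pdivrMr ?tN0//; exact: flux_mono.
    have [|u /andP[tu ut] DE] := @is_derive_mvt _ D d _ _ (ltW tt0).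
      by move=> u /andP[tu _]; apply: dD; exact: le_trans tu.
    rewrite -subr_le0 DE; apply: mulr_le0_ge0; last by rewrite subr_ge0 ltW.
    rewrite /d subr_le0.
    have t0_gt0 : 0 < t0 by exact: le_lt_trans tt0.
    by rewrite mulrAC ler_pdivlMr ?tN0//; apply: flux_mono => //; exact: le_trans tu.
move=> s as_; have rs := lam_ge_rho0 lam_a dlam as_.
have ls0 : 0 <= lam s by exact: le_trans (rho0_ge0 k m) rs.
have Nn0 : k.+2%:R != 0 :> R by rewrite pnatr_eq0.
(* For m = 0 the flux is u^(k+1), so N T(t) = t^N equals t times the flux and the singular term has
   coefficient 0. *)
have [mz|mN0] := eqVneq m 0.
  have fluxE u : 0 <= u -> flux u = u ^+ k.+1.
    move=> u0; rewrite /flux [X in _ - X * _]mz mul0r subr0 sqrtr_sqr.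
    by rewrite ger0_norm// exprn_ge0.
  rewrite [X in X * _ / 2 * _]mz !mul0r addr0 fluxE// -TE//.
  rewrite (@eq_rint _ _ (fun u => u ^+ k.+1)); last first.
    move=> u /andP[ru _]; rewrite (Lambda_flux m0 lam_a dlam)//.
    by apply: fluxE; exact: le_trans (rho0_ge0 k m) ru.
  by rewrite rint_expr// mulrC divfK// [X in _ - X]mz subr0 exprS.
have m_gt0 : 0 < m by rewrite lt_neqAle eq_sym mN0.
have r_gt0 := rho0_gt0 k m_gt0.
pose g u := Num.sqrt (slope_sq k m (lam u)) * (lam u ^+ k / flux (lam u)).
have lam_gt u : a < u -> rho0 < lam u.
  move=> au; rewrite -lam_a; have := lam_expanding m0 lam_a dlam (lexx a) (ltW au).
  by rewrite -subr_gt0 in au; move/(lt_le_trans au); rewrite subr_gt0.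
have wg u : a <= u <= s -> singular_integrand u = g u.
  move=> /andP[au _]; rewrite /singular_integrand (derive1_lam dlam)//.
  have ru := lam_ge_rho0 lam_a dlam au.
  have l0 : 0 < lam u by exact: lt_le_trans ru.
  rewrite (slope_sqE m0 ru) /g.
  have -> : Num.sqrt (slope_sq k m (lam u) - 1) = flux (lam u) / lam u ^+ k.
    rewrite -[X in _ / X]ger0_norm ?exprn_ge0 ?(ltW l0)// -sqrtr_sqr.
    rewrite -sqrtrV ?sqr_ge0// -sqrtrM; last first.
      by rewrite -(flux_sq m0 ru) sqr_ge0.
    congr Num.sqrt; rewrite /slope_sq (exprS _ k).
    have : lam u ^+ k != 0 by rewrite expf_neq0// gt_eqF.
    by move: (lam u ^+ k) (gt_eqF l0) => X /negbT l0' X0; field.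
  rewrite !invfM invrK -!mulrA; congr (_ * _).
  have : lam u ^+ k.+1 != 0 by rewrite expf_neq0// gt_eqF.
  by move: (lam u ^+ k.+1) => X X0; rewrite mulrCA (mulrCA _ _ X) mulVf// mulr1 mulrC.
(* From (t flux)' - N flux = (m N / 2) t^k / flux: dividing by m N / 2 gives a primitive of t^k /
   flux, continuous down to [rho0]. *)
pose Phi t := 2 / (m * k.+2%:R) *
  (Num.sqrt (t ^+ k.+2 ^+ 2 - m * t ^+ k.+2) - k.+2%:R * H t).
have cs : continuous (fun t : R => Num.sqrt (t ^+ k.+2 ^+ 2 - m * t ^+ k.+2)).
  have cE : continuous (fun t : R => t ^+ k.+2 ^+ 2 - m * t ^+ k.+2).
    move=> t; apply: (cvgB (FF := nbhs_filter t)).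
      by apply: (cvg_exprn (FF := nbhs_filter t)); exact: exprn_continuous.
    by apply: (cvgMl_tmp (FF := nbhs_filter t)); exact: exprn_continuous.
  by move=> t; apply: (continuous_comp (cE t)); exact: sqrt_continuous.
have dPhi t : rho0 < t -> is_derive t 1 Phi (t ^+ k / flux t).
  move=> rt; have t0 : 0 < t by exact: lt_trans rt.
  have f0 : 0 < flux t by exact: flux_gt0.
  have tf0 : 0 < t * flux t by exact: mulr_gt0.
  have p0 : 0 < t ^+ k.+2 ^+ 2 - m * t ^+ k.+2.
    by move: tf0; rewrite (mul_flux (ltW t0)) sqrtr_gt0.
  have dE := is_derive_exprn k.+1 (is_derive_id t (1 : R)).
  have dp := is_derive_sub (is_derive_exprn 1 dE) (is_derive_cmul m dE).
  have ds := @is_derive1_comp _ Num.sqrt (fun x => x ^+ k.+2 ^+ 2 - m * x ^+ k.+2)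
    t _ _ (is_derive1_sqrt p0) dp.
  have dN := is_derive_cmul k.+2%:R (dH' t (ltW rt)).
  have dP := is_derive_cmul (2 / (m * k.+2%:R)) (is_derive_sub ds dN).
  apply: is_derive_eq dP _; rewrite -(mul_flux (ltW t0)).
  have X0 : t ^+ k != 0 by rewrite expf_neq0// gt_eqF.
  (* Written as flux^2 / flux, with the square expanded, the last term gets the same denominator as
     the derivative of the root, and [field] can conclude. *)
  have fE : flux t = (t ^+ k.+1 ^+ 2 - m * t ^+ k) / flux t.
    by rewrite -(flux_sq m0 (ltW rt)) expr2 mulfK// gt_eqF.
  rewrite [X in _ - _ * X]fE !(exprS _ k.+1) !(exprS _ k) ?expr1.
  move: (t ^+ k) X0 (k.+2%:R : R) Nn0 (flux t) f0 => X X0 N N0 f f0.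
  have t1 : t != 0 by rewrite gt_eqF.
  have f1 : f != 0 by rewrite gt_eqF.
  by field; rewrite t1 f1 mN0 N0.
have -> : rint a s singular_integrand = Phi (lam s) - Phi (lam a).
  rewrite (eq_rint wg).
  apply: (@rint_FTC_improper _ g (Phi \o lam) _ _ as_).
  - move=> u /andP[au us]; have ru := lam_gt u au.
    apply: (cvgM (FF := nbhs_filter u)); first exact: sqrt_slope_continuous (ltW au).
    have cl := lam_continuous dlam (ltW au).
    apply: (cvgM (FF := nbhs_filter u)); first exact: (cvg_exprn (FF := nbhs_filter u)).
    apply: (cvgV (FF := nbhs_filter u)); first by rewrite gt_eqF// flux_gt0.
    apply: (@continuous_comp _ _ _ lam flux) => //; exact: (@flux_continuous R k m).
  - move=> u /andP[au us]; rewrite mulr_ge0 ?sqrtr_ge0// divr_ge0 ?flux_ge0 ?exprn_ge0//.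
    by apply: le_trans (ltW (lam_gt u au)); exact: rho0_ge0.
  - move=> u /andP[au us]; rewrite /g mulrC; apply: is_derive1_comp.
      exact: dPhi (lam_gt u au).
    exact: dlam (ltW au).
  - apply: continuous_comp; first exact: (lam_continuous dlam).
    rewrite lam_a; apply: (cvgMl_tmp (FF := nbhs_filter rho0)).
    apply: (cvgB (FF := nbhs_filter rho0)).
      exact: cs.
    apply: (cvgMl_tmp (FF := nbhs_filter rho0)).
    exact: is_derive_continuous (dH' _ (lexx _)).
rewrite lam_a /Phi (rho0X k m0) -(mul_flux ls0) expr2 subrr sqrtr0.
move: (lam s * flux (lam s)) (H (lam s)) (H rho0) => A B C.
by move: (k.+2%:R : R) Nn0 => N N0; field; rewrite mN0 N0.
Qed.

End warping_integrals.


(** * Cauchy-Schwarz inequality and rigidity *)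

Section sphere_integrals.
Context {R : realType}.
Variable k : nat.
Local Notation V := ('rV[R]_k.+1).
Implicit Types f g : V -> R.

Lemma sphere_intE (h : V -> R) f : sph_cont f -> sph_nneg f ->
  (forall x, x != 0 -> h (unitize x) = f x) -> sphere_int h = k.+1%:R * bint f.
Proof.
move=> cf f0 hf; rewrite /sphere_int.
rewrite (_ : leb_iint _ = leb_iint (bint_fun f)).
  by rewrite leb_iint_bint.
by apply: eq_leb_iint => x; rewrite /bint_fun; case: ifP => // /andP[/hf ->].
Qed.

Lemma bint_eq0 f : sph_cont f -> sph_nneg f -> bint f = 0 ->
  forall x, x != 0 -> f x = 0.
Proof.
move=> cf f0 If x x0; apply/eqP; rewrite eq_le f0// andbT leNgt; apply/negP => fx.
by have := bint_gt0 cf f0 x0 fx; rewrite If ltxx.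
Qed.

Lemma bint1_gt0 : 0 < bint (fun _ : V => 1).
Proof.
have [t t1 _] := sph_max (@sph_cont_cst R k 1).
have t0 : t != 0 by rewrite -enorm_gt0 t1.
by apply: (bint_gt0 (t := t)); [exact: sph_cont_cst|move=> x _; exact: ler01|..].
Qed.

Lemma cauchy_pair (a b c d : R) :
  a * c + b * d <= Num.sqrt (a ^+ 2 + b ^+ 2) * Num.sqrt (c ^+ 2 + d ^+ 2).
Proof.
rewrite -sqrtrM ?addr_ge0 ?sqr_ge0//.
apply: le_trans (ler_norm _) _; rewrite -sqrtr_sqr ler_sqrt; last first.
  by rewrite mulr_ge0// addr_ge0 ?sqr_ge0.
by have := sqr_ge0 (a * d - b * c); rewrite !sqrrD; lra.
Qed.

(** By Lagrange's identity the defect of the squared inequality is (a d - b c)^2. *)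
Lemma cauchy_pair_eq (a b c d : R) :
  a * c + b * d = Num.sqrt (a ^+ 2 + b ^+ 2) * Num.sqrt (c ^+ 2 + d ^+ 2) ->
  a * d = b * c.
Proof.
move=> /(congr1 (fun x => x ^+ 2)); rewrite exprMn !sqr_sqrtr ?addr_ge0 ?sqr_ge0//.
move=> h; apply/eqP; rewrite -subr_eq0 -sqrf_eq0; apply/eqP.
by rewrite !sqrrD in h *; lra.
Qed.

(** The vector (f x, g x) is paired with the constant vector of the two integrals and the result is
    integrated. In the equality case the pointwise defect is continuous, nonnegative and has
    integral 0, so it vanishes everywhere. *)
Lemma cauchy_bint f g : sph_cont f -> sph_cont g -> sph_nneg f -> sph_nneg g ->
  let I := bint (fun x => Num.sqrt (f x ^+ 2 + g x ^+ 2)) in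
  bint f ^+ 2 + bint g ^+ 2 <= I ^+ 2 /\
  (I ^+ 2 = bint f ^+ 2 + bint g ^+ 2 ->
    forall x, x != 0 -> f x * bint g = g x * bint f).
Proof.
move=> cf cg f0 g0 I.
pose S x := Num.sqrt (f x ^+ 2 + g x ^+ 2).
have cS : sph_cont S by apply/sph_cont_sqrt/sph_contD; exact: sph_contX.
have S0 : sph_nneg S by move=> x _; exact: sqrtr_ge0.
have I0 : 0 <= I by exact: bint_ge0.
have F0 : 0 <= bint f by exact: bint_ge0.
have G0 : 0 <= bint g by exact: bint_ge0.
have cst (c : R) : sph_cont (fun _ : V => c) by exact: sph_cont_cst.
have cFf : sph_cont (fun x => bint f * f x) by apply: sph_contM.
have cGg : sph_cont (fun x => bint g * g x) by apply: sph_contM.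
have nFf : sph_nneg (fun x => bint f * f x) by move=> x x0; rewrite mulr_ge0// f0.
have nGg : sph_nneg (fun x => bint g * g x) by move=> x x0; rewrite mulr_ge0// g0.
pose u x := bint f * f x + bint g * g x.
have cu : sph_cont u by exact: sph_contD.
have nu : sph_nneg u by move=> x x0; rewrite addr_ge0 ?nFf ?nGg.
have Iu : bint u = bint f ^+ 2 + bint g ^+ 2.
  by rewrite bintD; [rewrite !bintZ|exact: cFf|exact: cGg|exact: nFf|exact: nGg].
pose D := Num.sqrt (bint f ^+ 2 + bint g ^+ 2).
have D0 : 0 <= D by exact: sqrtr_ge0.
have DE : D ^+ 2 = bint f ^+ 2 + bint g ^+ 2 by rewrite sqr_sqrtr// addr_ge0 ?sqr_ge0.
have cDS : sph_cont (fun x => D * S x) by apply: sph_contM.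
have uDS x : u x <= D * S x by exact: cauchy_pair.
have IDS : bint (fun x => D * S x) = D * I by rewrite bintZ.
have D2 : D ^+ 2 <= D * I.
  by rewrite DE -Iu -IDS; apply: le_bint => // x _; exact: uDS.
have DI : D <= I.
  move: D0; rewrite le_eqVlt => /orP[/eqP <-//|D_gt0].
  by move: D2; rewrite expr2 ler_pM2l.
split; first by rewrite -DE lerXn2r.
rewrite -DE => IE x x0.
have ID : I = D by apply/eqP; rewrite -(@eqrXn2 _ 2) ?IE.
pose e x := D * S x + -1 * u x.
have ce : sph_cont e by apply: sph_contD => //; exact: sph_contM.
have ne : sph_nneg e by move=> y _; rewrite /e mulN1r subr_ge0.
have Ie : bint e = 0.
  have : bint (fun x => e x + u x) = bint (fun x => D * S x).
    by apply: eq_bint => y _; rewrite /e mulN1r subrK.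
  rewrite (bintD ce cu ne nu) IDS Iu -DE ID expr2; lra.
have := bint_eq0 ce ne Ie x0; rewrite /e mulN1r => /eqP; rewrite subr_eq0 => /eqP h.
by have := cauchy_pair_eq (esym h); rewrite mulrC => ->; rewrite mulrC.
Qed.

End sphere_integrals.


(** * The equality case *)

Section rigidity.
Context {R : realType}.
Variable k : nat.
Local Notation V := ('rV[R]_k.+2).
Implicit Types P f : V -> R.

Lemma enorm_delta (i : 'I_k.+2) : enorm (delta_mx ord0 i : V) = 1.
Proof.
apply/eqP; rewrite -(@eqrXn2 _ 2) ?enorm_ge0// sqr_enorm /dotr (bigD1 i)//= big1.
  by rewrite !mxE !eqxx mulr1 addr0 expr1n.
by move=> j /negbTE ji; rewrite !mxE ji andbF mul0r.
Qed.

(** The homogeneous extension is maximal at [t] in the whole punctured space, hence along each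
    coordinate line; parameters in ]-1, 1[ keep the line off the origin because |t| = 1. *)
Lemma sph_grad_sq_at_max P t : sph_C1 P -> enorm t = 1 ->
  (forall x, x != 0 -> P x <= P t) -> sph_grad_sq P t = 0.
Proof.
move=> [_ dP _] t1 Pt; rewrite /sph_grad_sq unitize_id//.
apply: big1 => i _; set e : V := delta_mx ord0 i.
have ne0 (s : R) : s \in `](-1), 1[ -> t + s *: e != 0.
  rewrite in_itv/= -ltr_norml => s1; rewrite addr_eq0; apply/eqP => te.
  have := enormZ s e; rewrite enorm_delta mulr1 => es.
  by move: s1; rewrite -es -enormN -te t1 ltxx.
pose phi (s : R) : R := P (t + s *: e).
have dphi (s : R) : s \in `](-1), 1[ -> is_derive s (1 : R) phi ('D_e P (t + s *: e)).
  by move=> /ne0 /dP; exact: is_derive_line.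
have z01 : (0 : R) \in `](-1), 1[ by rewrite in_itv/= ltrN10 ltr01.
have le11 : (-1 : R) <= 1 by apply: ltW; rewrite gtrN.
have dd (s : R) : s \in `](-1), 1[ -> derivable phi s 1 by case/dphi.
have mx (s : R) : s \in `](-1), 1[ -> phi s <= phi 0.
  by move=> /ne0 /Pt; rewrite /phi scale0r addr0.
have [_ h0] := derive1_at_max le11 dd z01 mx.
by have [_] := dphi 0 z01; rewrite h0 scale0r addr0 => <-; rewrite expr0n.
Qed.

Lemma two_valued_segment f (c : R) (u v : V) : sph_cont f -> 0 < c ->
  (forall x, x != 0 -> f x = 0 \/ f x = c) ->
  (forall s : R, 0 <= s <= 1 -> u + s *: (v - u) != 0) -> f u = f v.
Proof.
move=> [cf _] c0 f2 seg.
pose phi (s : R) := f (u + s *: (v - u)).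
have cphi : {within `[0, 1], continuous phi}.
  apply: continuous_in_subspaceT => s; rewrite inE/= in_itv/= => s01.
  apply: (@continuous_comp _ _ _ (fun s : R => u + s *: (v - u)) f); last first.
    by apply: cf; exact: seg.
  apply: (cvgD (FF := nbhs_filter s)); first exact: cvg_cst.
  by apply: (cvgZ (FF := nbhs_filter s)); [exact: cvg_id|exact: cvg_cst].
have phi0 : phi 0 = f u by rewrite /phi scale0r addr0.
have phi1 : phi 1 = f v by rewrite /phi scale1r addrC subrK.
have nhalf : ~ exists2 s, s \in `[0, 1] & phi s = c / 2.
  move=> [s]; rewrite in_itv/= => s01 h.
  by case: (f2 _ (seg s s01)); rewrite -/(phi s) h; lra.
have u0 : u != 0 by have := seg 0; rewrite lexx ler01 scale0r addr0; apply.
have v0 : v != 0.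
  by have := seg 1; rewrite lexx ler01 scale1r addrC subrK; apply.
have c2 : 0 <= c / 2 by rewrite divr_ge0// ltW.
have c2c : c / 2 <= c by rewrite ler_pdivrMr// ler_pMr// ler1n.
case: (eqVneq (f u) (f v)) => // fuv; exfalso; apply: nhalf.
apply: (IVT ler01 cphi); rewrite phi0 phi1 ge_min le_max.
case: (f2 u u0) (f2 v v0) fuv => -> [] ->; rewrite ?eqxx// => _.
  by rewrite c2 c2c orbT.
by rewrite c2 c2c !orbT.
Qed.

Lemma segment_delta_neq0 (x : V) (i j : 'I_k.+2) : x ord0 j != 0 -> i != j ->
  forall s : R, 0 <= s <= 1 -> x + s *: (delta_mx ord0 i - x) != 0.
Proof.
move=> xj ij s _; apply/eqP => /rowP h.
have := h j; have := h i; rewrite !mxE !eqxx (eq_sym j) (negbTE ij)/= => hi hj.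
have s1 : s = 1.
  have : (1 - s) * x ord0 j = 0 by rewrite -hj; ring.
  by move/eqP; rewrite mulf_eq0 (negbTE xj) orbF subr_eq0 => /eqP.
by move: hi; rewrite s1 => /eqP; rewrite mul1r addrC subrK oner_eq0.
Qed.

(** Connectedness of the punctured space by explicit segments. A point with nonzero j-th coordinate
    sees each basis vector of another index without crossing the origin, basis vectors see one
    another, and a segment cannot skip the value c/2. Two coordinates are always available here. *)
Lemma two_valued_const f (c : R) : sph_cont f -> 0 < c ->
  (forall x, x != 0 -> f x = 0 \/ f x = c) ->
  forall x y, x != 0 -> y != 0 -> f x = f y.
Proof.
move=> cf c0 f2.
have conn (x : V) (i j : 'I_k.+2) : x ord0 j != 0 -> i != j -> f x = f (delta_mx ord0 i).
  by move=> xj ij; apply: (two_valued_segment cf c0 f2); exact: segment_delta_neq0 ij.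
have edge (i j : 'I_k.+2) : f (delta_mx ord0 i) = f (delta_mx ord0 j).
  have [->//|ij] := eqVneq i j.
  by apply: (conn _ j i); rewrite ?mxE ?eqxx ?oner_eq0 1?eq_sym.
have base x : x != 0 -> f x = f (delta_mx ord0 ord0).
  move=> x0; have [j xj] : exists j, x ord0 j != 0.
    apply: contrapT => /forallNP h; move/eqP: x0; apply.
    by apply/rowP => j; rewrite mxE; apply/eqP; apply: contrapT => /negP; exact: h.
  have [i ij] : exists i : 'I_k.+2, i != j.
    have [->|j0] := eqVneq j ord0; first by exists (lift ord0 ord0).
    by exists ord0; rewrite eq_sym.
  by rewrite (conn x i j)// (edge i ord0).
by move=> x y x0 y0; rewrite (base x x0) (base y y0).
Qed.

Lemma equality_rigidity P (m : R) : sph_C1 P -> 0 <= m ->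
  (forall x, x != 0 -> m `^ (k.+2%:R)^-1 <= P x) ->
  (forall x, x != 0 -> P x * flux k m (P x) * bint (area_density P) =
     area_density P x * bint (fun x => P x * flux k m (P x))) ->
  forall x y, x != 0 -> y != 0 -> P x = P y.
Proof.
move=> cP m0 rP eqP_; have [cP0 _ _] := cP.
have P0 : sph_nneg P by move=> x /rP; apply: le_trans; exact: powR_ge0.
have [t t1 Pt] := sph_max cP0.
have t0 : t != 0 by rewrite -enorm_gt0 t1.
set IG := bint (area_density P) in eqP_; set IF := bint _ in eqP_.
have cad := sph_cont_area_density cP.
have ad0 : sph_nneg (area_density P).
  by move=> x x0; rewrite mulr_ge0 ?exprn_ge0 ?P0// sqrtr_ge0.
have IF0 : 0 <= IF.
  by apply: bint_ge0 => x x0; rewrite mulr_ge0 ?P0// flux_ge0.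
have adt : area_density P t = P t ^+ k.+1.
  rewrite /area_density sph_grad_sq_at_max// addr0 sqrtr_sqr ger0_norm ?P0//.
  by rewrite -exprSr.
have := P0 t t0; rewrite le_eqVlt => /orP[/eqP Pt0|Pt_gt0].
  have Pz x : x != 0 -> P x = 0.
    by move=> x0; apply/eqP; rewrite eq_le P0// andbT [leRHS]Pt0 Pt.
  by move=> x y x0 y0; rewrite !Pz.
have IG0 : 0 < IG.
  by apply: (bint_gt0 cad ad0 t0); rewrite adt exprn_gt0.
have Ptn : 0 < P t ^+ k.+1 by rewrite exprn_gt0.
(* If 0 < P x < P t, proportionality and the area bound at [x] give P t Lambda(P t) <= P x Lambda(P
   x), against the monotonicity of Lambda and P x < P t. *)
have main x : x != 0 -> 0 < P x -> P x = P t.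
  move=> x0 Px; apply/eqP; rewrite eq_le Pt//= leNgt; apply/negP => lt.
  have ft : 0 < flux k m (P t).
    by apply: flux_gt0 => //; exact: le_lt_trans (rP x x0) lt.
  have adx : P x ^+ k.+1 <= area_density P x.
    rewrite exprSr; apply: ler_wpM2l; first by rewrite exprn_ge0// ltW.
    rewrite -[leLHS]ger0_norm ?P0// -sqrtr_sqr ler_sqrt ?addr_ge0 ?sqr_ge0 ?sph_grad_sq_ge0//.
    by rewrite lerDl sph_grad_sq_ge0.
  have h1 : P x ^+ k.+1 * IF <= P x * flux k m (P x) * IG.
    by rewrite eqP_//; exact: ler_wpM2r.
  have h2 : P t ^+ k.+1 * IF = P t * flux k m (P t) * IG by rewrite -adt -eqP_.
  have h3 := flux_mono m0 (rP x x0) (ltW lt).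
  have h4 : P x ^+ k.+1 * (P t * flux k m (P t) * IG) <=
      P t ^+ k.+1 * (P x * flux k m (P x) * IG).
    by rewrite -h2 mulrCA; apply: ler_wpM2l; [exact: ltW|exact: h1].
  have h5 : P t * (flux k m (P t) * P x ^+ k.+1) <= P x * (flux k m (P x) * P t ^+ k.+1).
    rewrite -(ler_pM2r IG0); apply: etrans h4; congr (_ <= _); ring.
  have h6 : P x * (flux k m (P t) * P x ^+ k.+1) < P t * (flux k m (P t) * P x ^+ k.+1).
    by rewrite ltr_pM2r// mulr_gt0// exprn_gt0.
  have h7 := ler_wpM2l (ltW Px) h3.
  by have := lt_le_trans h6 (le_trans h5 h7); rewrite ltxx.
(* The argument above requires P x > 0, so zeros of [P] remain as a second value to be excluded. *)
apply: (two_valued_const cP0 Pt_gt0) => x x0.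
have := P0 x x0; rewrite le_eqVlt => /orP[/eqP <-|]; first by left.
by move=> Px; right; exact: main.
Qed.

End rigidity.


(** * The inequality for the Euclidean profile *)

Section core_inequality.
Context {R : realType}.
Variables (k : nat) (m a : R) (lam : R -> R) (T : R -> R).
Local Notation V := ('rV[R]_k.+2).
Local Notation rho0 := (m `^ (k.+2%:R)^-1).
Local Notation flux := (flux k m).
Local Notation N := (k.+2%:R : R).
Local Notation bone := (bint (fun _ : V => 1)).
Hypothesis m0 : 0 <= m.
Hypothesis growthT : growth_profile k m a lam T.
Variable P : V -> R.
Hypothesis cP : sph_C1 P.
Hypothesis rP : forall x, x != 0 -> rho0 <= P x.
Hypothesis TP : forall x, x != 0 -> N * T (P x) <= P x * flux (P x).
Variables (tau al be : R).
Hypothesis rtau : rho0 <= tau.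
Hypothesis tauE : tau ^+ k.+2 * bone = bint (fun x => P x ^+ k.+2).
Hypothesis al0 : 0 <= al.
Hypothesis be0 : 0 < be.
Hypothesis alE : al ^+ k.+2 = bint (fun x => P x ^+ k.+2).
Hypothesis beE : be ^+ k.+2 = bone.

Let f x := P x * flux (P x).
Let g := area_density P.
Let y x := f x + (- N) * T (P x).

Let P0 : sph_nneg P.
Proof. by move=> x /rP; apply: le_trans; exact: powR_ge0. Qed.

Let cP0 : sph_cont P. Proof. by case: cP. Qed.

Let sph_cont_T : sph_cont (fun x => T (P x)).
Proof. by apply: sph_cont_comp => // x /rP; case: growthT => cT _ _ _; exact: cT. Qed.

Let sph_cont_f : sph_cont f.
Proof.
apply: sph_contM => //; apply: sph_cont_comp => // x _.
exact: (@flux_continuous R k m).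
Qed.

Let sph_nneg_f : sph_nneg f.
Proof. by move=> x x0; rewrite mulr_ge0 ?P0// flux_ge0. Qed.

Let sph_cont_g : sph_cont g. Proof. exact: sph_cont_area_density. Qed.

Let sph_nneg_g : sph_nneg g.
Proof. by move=> x x0; rewrite mulr_ge0 ?exprn_ge0 ?P0// sqrtr_ge0. Qed.

Let sph_cont_y : sph_cont y.
Proof. by apply: sph_contD => //; apply: sph_contM => //; exact: sph_cont_cst. Qed.

Let sph_nneg_y : sph_nneg y.
Proof. by move=> x x0; rewrite /y mulNr subr_ge0 TP. Qed.

Let sph_nneg_T : sph_nneg (fun x => T (P x)).
Proof. by move=> x /rP; case: growthT => _ _ + _; exact. Qed.

Let bone0 : 0 < bone. Proof. exact: bint1_gt0. Qed.

Lemma bint_y : bint y + N * bint (fun x => T (P x)) = bint f.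
Proof.
rewrite -bintZ// -bintD//; last 2 first.
- by apply: sph_contM => //; exact: sph_cont_cst.
- by move=> x x0; rewrite mulr_ge0// sph_nneg_T.
by apply: eq_bint => x _; rewrite /y mulNr subrK.
Qed.

(** Jensen's inequality: the supporting line at [tau] is integrated, and its two power terms cancel
    because tau^N is the mean of P^N over the unit ball. *)
Lemma jensen_T : bone * T tau <= bint (fun x => T (P x)).
Proof.
have [_ _ T0 tan] := growthT; have [c c0 cT] := tan tau rtau.
have Tt0 : 0 <= T tau by exact: T0.
have cX : sph_cont (fun x => P x ^+ k.+2) by exact: sph_contX.
have nX : sph_nneg (fun x => P x ^+ k.+2) by move=> x x0; rewrite exprn_ge0// P0.
have cst (e : R) : sph_cont (fun _ : V => e) by exact: sph_cont_cst.
have tau0 : 0 <= tau by exact: le_trans (powR_ge0 _ _) rtau.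
have ct0 : 0 <= c * tau ^+ k.+2 by rewrite mulr_ge0// exprn_ge0.
have ccX : sph_cont (fun x => c * P x ^+ k.+2) by apply: sph_contM.
have ncX : sph_nneg (fun x => c * P x ^+ k.+2) by move=> x x0; rewrite mulr_ge0// nX.
have : bint (fun x => T tau + c * P x ^+ k.+2) <=
    bint (fun x => T (P x) + c * tau ^+ k.+2).
  apply: le_bint; [exact: sph_contD|exact: sph_contD| |].
    by move=> x x0; rewrite addr_ge0// ncX.
  by move=> x /rP; exact: cT.
have nT : sph_nneg (fun _ : V => T tau) by move=> x _.
have nct : sph_nneg (fun _ : V => c * tau ^+ k.+2) by move=> x _.
rewrite (bintD (cst _) ccX nT ncX) (bintD sph_cont_T (cst _) sph_nneg_T nct).
rewrite (bint_cst _ Tt0) (bint_cst _ ct0) bintZ// -tauE mulrC -mulrA.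
by rewrite lerD2r.
Qed.

Lemma core_inequality :
  let I := bint (fun x => Num.sqrt (f x ^+ 2 + g x ^+ 2)) in
  (N * (bone * T tau) + bint y) ^+ 2 + (al ^+ k.+1 * be) ^+ 2 <= I ^+ 2 /\
  (I ^+ 2 = (N * (bone * T tau) + bint y) ^+ 2 + (al ^+ k.+1 * be) ^+ 2 <->
    forall x x', x != 0 -> x' != 0 -> P x = P x').
Proof.
move=> I; have [cauchy cauchy_eq] := cauchy_bint sph_cont_f sph_cont_g sph_nneg_f sph_nneg_g.
have T0 : 0 <= T tau by case: growthT => _ _ + _; exact.
have y0 : 0 <= bint y by exact: bint_ge0.
have u0 : 0 <= N * (bone * T tau) + bint y.
  by rewrite addr_ge0// !mulr_ge0// ltW.
have uf : N * (bone * T tau) + bint y <= bint f.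
  by rewrite -bint_y addrC lerD2l; apply: ler_wpM2l => //; exact: jensen_T.
have ug : al ^+ k.+1 * be <= bint g by exact: isoperimetric.
have v0 : 0 <= al ^+ k.+1 * be by rewrite mulr_ge0 ?exprn_ge0// ltW.
have f0 : 0 <= bint f by exact: le_trans uf.
have g0 : 0 <= bint g by exact: le_trans ug.
have uf2 : (N * (bone * T tau) + bint y) ^+ 2 <= bint f ^+ 2 by rewrite lerXn2r.
have ug2 : (al ^+ k.+1 * be) ^+ 2 <= bint g ^+ 2 by rewrite lerXn2r.
split; first by apply: le_trans (lerD uf2 ug2) cauchy.
split=> [IE|Pc].
  (* I^2 dominates the squares of [bint f] and [bint g], which dominate the assumed value of I^2;
     this forces equality in Cauchy-Schwarz. *)
  apply: (equality_rigidity cP m0 rP).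
  apply: cauchy_eq; apply/eqP; rewrite eq_le cauchy andbT.
  by rewrite -/I IE; exact: lerD.
(* For constant P = p the gradient vanishes and every integral is a value times [bone]; this forces
   tau = p and al = p be, and both sides agree. *)
have [t t1 Pt] := sph_max cP0.
have t0 : t != 0 by rewrite -enorm_gt0 t1.
set p := P t; have Pp x : x != 0 -> P x = p by move=> x0; exact: Pc.
have p0 : 0 <= p by exact: P0.
have gE x : x != 0 -> g x = p ^+ k.+1.
  move=> x0; rewrite /g /area_density Pp//.
  have -> : sph_grad_sq P x = sph_grad_sq P (unitize x).
    by rewrite /sph_grad_sq (unitize_id (enorm_unitize x0)).
  rewrite sph_grad_sq_at_max ?enorm_unitize//; last first.
    by move=> z z0; rewrite (Pc _ (unitize x))// unitize_neq0.
  by rewrite addr0 sqrtr_sqr ger0_norm// -exprSr.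
have bcst (h : V -> R) (c : R) : 0 <= c -> (forall x, x != 0 -> h x = c) ->
    bint h = c * bone.
  by move=> c0 hc; rewrite -(bint_cst _ c0); apply: eq_bint.
have pf0 : 0 <= p * flux p by rewrite mulr_ge0// flux_ge0.
have bf : bint f = p * flux p * bone by apply: bcst => // x x0; rewrite /f Pp.
have bg : bint g = p ^+ k.+1 * bone by apply: bcst; [exact: exprn_ge0|].
have bX : bint (fun x => P x ^+ k.+2) = p ^+ k.+2 * bone.
  by apply: bcst => [|x x0]; [exact: exprn_ge0|rewrite Pp].
have Tp0 : 0 <= T p by exact: (sph_nneg_T t0).
have bT : bint (fun x => T (P x)) = T p * bone.
  by apply: bcst => // x x0; rewrite Pp.
have tau0 : 0 <= tau by exact: le_trans (powR_ge0 _ _) rtau.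
have tp : tau = p.
  have : tau ^+ k.+2 * bone = p ^+ k.+2 * bone by rewrite tauE bX.
  move/(mulIf (lt0r_neq0 bone0)) => /eqP; rewrite eqrXn2//.
  by move/eqP.
have alp : al = p * be.
  apply/eqP; rewrite -(@eqrXn2 _ k.+2) ?mulr_ge0// ?(ltW be0)//.
  by rewrite exprMn alE bX beE.
have -> : N * (bone * T tau) + bint y = bint f.
  by rewrite -bint_y bT tp addrC (mulrC bone).
have -> : al ^+ k.+1 * be = bint g.
  by rewrite alp exprMn -mulrA -exprSr beE bg.
rewrite /I (bcst _ (Num.sqrt ((p * flux p) ^+ 2 + p ^+ k.+1 ^+ 2))) ?sqrtr_ge0//; last first.
  by move=> x x0; rewrite gE// /f Pp.
rewrite exprMn sqr_sqrtr ?addr_ge0 ?sqr_ge0// bf bg !exprMn; ring.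
Qed.

End core_inequality.


(** * Back to the hypersurface *)

Section radial_profile.
Context {R : realType}.
Variables (k : nat) (m a : R) (lam : R -> R) (r : 'rV[R]_k.+2 -> R).
Local Notation V := ('rV[R]_k.+2).
Local Notation rho0 := (m `^ (k.+2%:R)^-1).
Hypothesis m0 : 0 <= m.
Hypothesis lam_a : lam a = rho0.
Hypothesis dlam : forall s, a <= s ->
  is_derive s 1 lam (Num.sqrt (slope_sq k m (lam s))).
Hypothesis star_r : star_shaped_C1 a r.

Local Notation q := (homog r).

Definition profile (x : V) : R := lam (homog r x).

Lemma homog_ge x : x != 0 -> a <= q x.
Proof. by move=> x0; case: star_r => ra _; exact/ra/enorm_unitize. Qed.

Lemma sph_C1_homog : sph_C1 q.
Proof.
case: star_r => _ [dq cq]; split => //; split=> [x x0|c x c0].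
  exact/differentiable_continuous/dq.
by rewrite /homog unitizeZ.
Qed.

Lemma profile_ge x : x != 0 -> rho0 <= profile x.
Proof. by move=> /homog_ge; exact: (lam_ge_rho0 lam_a dlam). Qed.

(** Restricting to the line through [x] in direction [v] reduces this to the one-variable chain
    rule. *)
Lemma derive_profile x (v : V) : x != 0 ->
  'D_v profile x = Num.sqrt (slope_sq k m (profile x)) * 'D_v q x.
Proof.
move=> x0; have [_ dq _] := sph_C1_homog.
have E (g : V -> R) : 'D_v g x = 'D_1 (fun s : R => g (x + s *: v)) 0.
  have F : (fun h : R => h^-1 *: ((g \o shift x) (h *: v) - g x)) = (fun h : R =>
      h^-1 *: (((fun s : R => g (x + s *: v)) \o shift 0) (h *: 1) - g (x + 0 *: v))).
    apply/funext => h /=; congr (_ *: (g _ - g _)); last by rewrite scale0r addr0.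
    by rewrite addr0 [h *: 1]mulr1 addrC.
  by rewrite /derive F.
have d0 : is_derive (0 : R) (1 : R) (fun s => q (x + s *: v)) ('D_v q x).
  have dl : differentiable q (x + (0 : R) *: v) by rewrite scale0r addr0; exact: dq.
  by move: (is_derive_line dl); rewrite scale0r addr0.
have l0 : is_derive (q (x + (0 : R) *: v)) 1 lam (Num.sqrt (slope_sq k m (profile x))).
  by rewrite scale0r addr0; apply: dlam; exact: homog_ge.
rewrite E; have := @is_derive1_comp _ lam (fun s : R => q (x + s *: v)) 0 _ _ l0 d0.
by move=> ?; rewrite derive_val.
Qed.

Lemma sph_C1_profile : sph_C1 profile.
Proof.
have [cq dq cdq] := sph_C1_homog.
have cp : sph_cont profile.
  by apply: sph_cont_comp => // x /homog_ge; exact: (lam_continuous dlam).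
have cs (x : V) : x != 0 ->
    {for x, continuous (fun y => Num.sqrt (slope_sq k m (profile y)))}.
  move=> x0; pose h := fun s => Num.sqrt (slope_sq k m (lam s)).
  have [ch _] : sph_cont (fun y => h (q y)).
    by apply: sph_cont_comp => // y /homog_ge; exact: (sqrt_slope_continuous m0 lam_a dlam).
  exact: ch.
split => // [x x0|i x x0].
  apply: (differentiable_comp (dq _ x0)).
  by apply/derivable1_diffP; case: (dlam (homog_ge x0)).
have h : {near x, (fun y => Num.sqrt (slope_sq k m (profile y)) * 'D_(delta_mx ord0 i) q y)
    =1 (fun y => 'D_(delta_mx ord0 i) profile y)}.
  have : \forall y \near x, 0 < enorm y.
    by apply: (@enorm_continuous _ _ x [set s | 0 < s]); apply: lt_nbhsr; rewrite enorm_gt0.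
  by apply: filterS => y; rewrite enorm_gt0 => y0; rewrite derive_profile.
rewrite /prop_for /continuous_at derive_profile//.
apply: cvg_trans; first exact: (near_eq_cvg h).
apply: (cvgM (FF := nbhs_filter x)); first exact: cs.
exact: cdq.
Qed.

Lemma sph_grad_sq_profile x : x != 0 ->
  sph_grad_sq profile x = slope_sq k m (profile x) * sph_grad_sq q x.
Proof.
move=> x0; rewrite mulr_sumr; apply: eq_bigr => i _.
have ux := unitize_neq0 x0; have [cp _ _] := sph_C1_profile.
by rewrite derive_profile// (sph_cont_unitize cp x0) exprMn slope_sqE// profile_ge.
Qed.

End radial_profile.


Section surface_and_volume.
Context {R : realType}.
Variables (k : nat) (m a : R) (lam : R -> R) (r : 'rV[R]_k.+2 -> R).
Local Notation V := ('rV[R]_k.+2).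
Local Notation rho0 := (m `^ (k.+2%:R)^-1).
Local Notation N := (k.+2%:R : R).
Local Notation flux := (flux k m).
Local Notation bone := (bint (fun _ : V => 1)).
Hypothesis m0 : 0 <= m.
Hypothesis lam_a : lam a = rho0.
Hypothesis dlam : forall s, a <= s ->
  is_derive s 1 lam (Num.sqrt (slope_sq k m (lam s))).
Hypothesis star_r : star_shaped_C1 a r.
Local Notation P := (profile lam r).

Let rP x : x != 0 -> rho0 <= P x.
Proof. exact: (profile_ge lam_a dlam star_r). Qed.

Let P0 : sph_nneg P.
Proof. by move=> x /rP; apply: le_trans; exact: powR_ge0. Qed.

Let cP : sph_C1 P. Proof. exact: (sph_C1_profile m0 lam_a dlam star_r). Qed.

Let cP0 : sph_cont P. Proof. by case: cP. Qed.

Let N0 : 0 < N. Proof. by rewrite ltr0n. Qed.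

(** Moving lambda' under the square root turns |grad r|^2 into |grad P|^2 by the chain rule, while
    [slope_flux] splits the remaining lambda'^2 P^(2n) into the flux square and the Euclidean
    part. *)
Lemma surf_int_slope : surf_int lam r (fun s => derive1 lam s) =
  N * bint (fun x => Num.sqrt ((P x * flux (P x)) ^+ 2 + area_density P x ^+ 2)).
Proof.
apply: sphere_intE.
- apply/sph_cont_sqrt/sph_contD; apply: sph_contX.
    apply: sph_contM => //; apply: sph_cont_comp => // x _; exact: (@flux_continuous R k m).
  exact: sph_cont_area_density.
- by move=> x _; exact: sqrtr_ge0.
move=> x x0; have qa := homog_ge star_r x0; have p0 := P0 x0.
rewrite (derive1_lam dlam qa) subn1/=.
rewrite -[r _]/(homog r x) -[lam _]/(P x) -[grad_sq _ _]/(sph_grad_sq (homog r) x).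
have -> : P x ^+ k = Num.sqrt (P x ^+ k ^+ 2) by rewrite sqrtr_sqr ger0_norm// exprn_ge0.
have s0 : 0 <= slope_sq k m (P x) by exact: le_trans ler01 (slope_sq_ge1 m0 (rP x0)).
rewrite -!sqrtrM ?(mulr_ge0 s0 (sqr_ge0 _))//; congr Num.sqrt.
have g0 : 0 <= P x ^+ 2 + sph_grad_sq P x by rewrite addr_ge0 ?sqr_ge0 ?sph_grad_sq_ge0.
rewrite /area_density [(P x ^+ k * _) ^+ 2]exprMn sqr_sqrtr//.
rewrite (sph_grad_sq_profile m0 lam_a dlam star_r x0).
have := slope_flux m0 (rP x0); rewrite (exprS _ k).
move: (P x) (P x ^+ k) (slope_sq _ _ _) (flux _) (sph_grad_sq _ _) => p K s F G h.
transitivity (s * (p * K) ^+ 2 + K ^+ 2 * (s * G)); first by ring.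
by rewrite h; ring.
Qed.

Lemma mass_le_bint : m * bone <= bint (fun x => P x ^+ k.+2).
Proof.
rewrite -(bint_cst _ m0); apply: le_bint => //; first exact: sph_cont_cst.
  exact: sph_contX.
by move=> x /rP; exact: m_le_exp.
Qed.

(** The radial integral is (P^N - m) / N, since lambda(a)^N = m; adding the missing [m] completes
    the Euclidean volume. *)
Lemma vol_int_slope : vol_int lam a r (fun s => derive1 lam s) + m * bone =
  bint (fun x => P x ^+ k.+2).
Proof.
have ex x : x != 0 -> m <= P x ^+ k.+2 by move=> /rP; exact: m_le_exp.
have cX : sph_cont (fun x => P x ^+ k.+2) by exact: sph_contX.
pose f x := N^-1 * (P x ^+ k.+2 + (- m)).
have cXm : sph_cont (fun x => P x ^+ k.+2 + (- m)).
  by apply: sph_contD => //; exact: sph_cont_cst.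
have nXm : sph_nneg (fun x => P x ^+ k.+2 + (- m)).
  by move=> x /ex; rewrite subr_ge0.
have cf : sph_cont f by apply: sph_contM => //; exact: sph_cont_cst.
have nf : sph_nneg f by move=> x /nXm ?; rewrite mulr_ge0// invr_ge0 ltW.
rewrite /vol_int (sphere_intE cf nf); last first.
  by move=> x /(homog_ge star_r)/(rint_derive1_lam m0 lam_a dlam) ->; rewrite mulrC.
rewrite bintZ// ?invr_ge0 ?ltW// mulrA divff ?gt_eqF// mul1r -(bint_cst _ m0).
rewrite -bintD//; last by exact: sph_cont_cst.
by apply: eq_bint => x _; rewrite subrK.
Qed.

Variable T : R -> R.
Hypothesis growthT : growth_profile k m a lam T.
Hypothesis TE : forall s, a <= s ->
  N * T (lam s) + m * N / 2 * rint a s (singular_integrand k lam) = lam s * flux (lam s).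

Lemma rint_singular_ge0 s : 0 <= rint a s (singular_integrand k lam).
Proof.
apply: rint_ge0 => u /andP[au _]; have l0 := lam_ge0 lam_a dlam au.
by rewrite mulr_ge0 ?exprn_ge0// divr_ge0 ?mulr_ge0 ?sqrtr_ge0 ?exprn_ge0// derive1_lam ?sqrtr_ge0.
Qed.

Lemma growth_le_flux x : x != 0 -> N * T (P x) <= P x * flux (P x).
Proof.
move=> /(homog_ge star_r)/TE; rewrite -/(P x) => <-.
by rewrite lerDl !mulr_ge0 ?rint_singular_ge0// ltW.
Qed.

Lemma vol_int_singular :
  m * N / 2 * vol_int lam a r (fun s =>
    derive1 lam s / (lam s ^+ k.+1 * Num.sqrt (derive1 lam s ^+ 2 - 1))) =
  N * bint (fun x => P x * flux (P x) + (- N) * T (P x)).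
Proof.
set y := fun x : V => _; set c := m * N / 2.
have c0 : 0 <= c by rewrite divr_ge0// mulr_ge0// ltW.
have yE x : x != 0 -> y x = c * rint a (homog r x) (singular_integrand k lam).
  by move=> /(homog_ge star_r)/TE h; rewrite /y mulNr -h addrAC subrr add0r.
have cy : sph_cont y.
  apply: sph_contD.
    apply: sph_contM => //; apply: sph_cont_comp => // x _; exact: (@flux_continuous R k m).
  apply: sph_contM; first exact: sph_cont_cst.
  by apply: sph_cont_comp => // x /rP; case: growthT => cT _ _ _; exact: cT.
have ny : sph_nneg y by move=> x x0; rewrite /y mulNr subr_ge0 growth_le_flux.
(* [c] vanishes exactly when m = 0, and then both sides are 0; otherwise the radial integral is
   recovered as y / c, which also shows its continuity. *)
have [cE|cN] := eqVneq c 0.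
  rewrite cE mul0r (_ : bint y = 0) ?mulr0//.
  rewrite -(mul0r bone) -(bint_cst _ (lexx 0)).
  by apply: eq_bint => x /yE ->; rewrite cE mul0r.
have cV : 0 <= c^-1 by rewrite invr_ge0.
rewrite /vol_int (@sphere_intE _ _ _ (fun x => c^-1 * y x)).
- by rewrite bintZ// mulrCA mulVKf.
- by apply: sph_contM => //; exact: sph_cont_cst.
- by move=> x /ny ?; rewrite mulr_ge0.
by move=> x x0; rewrite yE// mulKf.
Qed.

End surface_and_volume.


(* Here [al ^+ k.+2 = int P^(n+1)] and [be ^+ k.+2 = omega / (n+1)], in the notation of
   [core_inequality]. *)
Lemma isoperimetric_power (R : realType) (k : nat) (w b v m al be : R) :
  let N := k.+2%:R in
  0 < b -> w = N * b -> 0 <= al -> 0 <= be -> be ^+ k.+2 = b -> v + m * b = al ^+ k.+2 ->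
  (N * w `^ (k.+1%:R)^-1 * v + w `^ (N / k.+1%:R) * m) `^ (2 * k.+1%:R / N) =
  (N * (al ^+ k.+1 * be)) ^+ 2.
Proof.
move=> N b0 wE al0 be0 beE vE; have N0 : 0 < N by rewrite ltr0n.
have n0 : k.+1%:R != 0 :> R by rewrite pnatr_eq0.
have NN0 : N != 0 by rewrite gt_eqF.
have w0 : 0 < w by rewrite wE mulr_gt0.
pose Z := N * (al ^+ k.+1 * be).
have Z0 : 0 <= Z by rewrite !mulr_ge0 ?exprn_ge0// ltW.
have Nal0 : 0 <= N * al ^+ k.+2 by rewrite mulr_ge0 ?exprn_ge0// ltW.
have ZN : Z ^+ k.+2 = w * (N * al ^+ k.+2) ^+ k.+1.
  rewrite /Z [LHS]exprMn [X in _ * X]exprMn beE wE [in RHS]exprMn (exprS N k.+1).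
  rewrite -[(al ^+ k.+1) ^+ k.+2]exprM -[(al ^+ k.+2) ^+ k.+1]exprM (mulnC k.+1).
  by move: (N ^+ _) (al ^+ _) => A B; ring.
(* As w = N b, the bracket is N w^(1/n) (v + m b) with n = k + 1, that is Z^(N/n); the outer
   exponent 2n/N then leaves Z^2. *)
have -> : N * w `^ (k.+1%:R)^-1 * v + w `^ (N / k.+1%:R) * m = Z `^ (N / k.+1%:R).
  have -> : w `^ (N / k.+1%:R) = w `^ (k.+1%:R)^-1 * w.
    rewrite -{3}(powRr1 (ltW w0)) -powRD; last by rewrite (gt_eqF w0) implybT.
    by congr (_ `^ _); rewrite /N -natr1 mulrDl divff// mul1r addrC.
  rewrite powRrM powR_mulrn// ZN powRM ?exprn_ge0// ?(ltW w0)//.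
  rewrite -(powR_mulrn k.+1 Nal0) -powRrM divff// powRr1// -vE. by rewrite wE; ring.
have cancel (x y : R) : x != 0 -> y != 0 -> y / x * (2 * x / y) = 2.
  by move=> x0 y0; field; rewrite x0 y0.
by rewrite -powRrM cancel// powR_mulrn.
Qed.
Theorem theorem1p6 (R : realType) (n : nat) (m a : R) (lam eta : R -> R)
    (r : 'rV[R]_n.+1 -> R) :
  (1 <= n)%N -> 0 <= m ->
  (* lambda(a) = m^(1/(n+1)) and lambda' = sqrt(1 + lambda^2 - m lambda^(1-n)) on [a,oo) *)
  lam a = m `^ (n.+1%:R)^-1 ->
  (forall s, a <= s ->
     is_derive s 1 lam (Num.sqrt (1 + lam s ^+ 2 - m * lam s ^- (n - 1)))) ->
  (* definition of eta-hat *)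
  (forall t, m `^ (n.+1%:R)^-1 <= t ->
     eta (omega R n * rint (m `^ (n.+1%:R)^-1) t (fun s => s ^+ n))
     = omega R n * rint (m `^ (n.+1%:R)^-1) t (fun s => Lambda lam a s * s ^+ n)) ->
  star_shaped_C1 a r ->
  let A := surf_int lam r (fun s => derive1 lam s) in
  let V := vol_int lam a r (fun s => derive1 lam s) in
  let W := vol_int lam a r
             (fun s => derive1 lam s / (lam s ^+ n * Num.sqrt (derive1 lam s ^+ 2 - 1))) in
  let RHS := (n.+1%:R * eta V + m * n.+1%:R / 2 * W) ^+ 2
             + (n.+1%:R * omega R n `^ (n%:R)^-1 * V
                + omega R n `^ (n.+1%:R / n%:R) * m) `^ (2 * n%:R / n.+1%:R) in
  RHS <= A ^+ 2 /\
  (A ^+ 2 = RHS <->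
     exists r0 : R, a <= r0 /\ forall th : 'rV[R]_n.+1, enorm th = 1 -> r th = r0).
Proof.
case: n r => [//|k] r _ m0 lam_a dlam0 etaE star_r A V W RHS.
have dlam s : a <= s -> is_derive s 1 lam (Num.sqrt (slope_sq k m (lam s))).
  by move=> /dlam0; rewrite subn1.
have [T growthT TE] := growth_profile_exists m0 lam_a dlam.
pose P := profile lam r; pose N := k.+2%:R : R.
pose bone := bint (fun _ : 'rV[R]_k.+2 => 1); pose IP := bint (fun x => P x ^+ k.+2).
have N0 : 0 < N by rewrite ltr0n.
have bone0 : 0 < bone by exact: bint1_gt0.
have rP x : x != 0 -> m `^ (k.+2%:R)^-1 <= P x by exact: (profile_ge lam_a dlam star_r).
have VE : V + m * bone = IP by exact: (vol_int_slope m0 lam_a dlam star_r).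
have AE := surf_int_slope m0 lam_a dlam star_r.
have WE := vol_int_singular m0 lam_a dlam star_r growthT TE.
have omegaE : omega R k.+1 = N * bone.
  by apply: sphere_intE => //; exact: sph_cont_cst.
have IP0 : 0 <= IP.
  by apply: bint_ge0 => x x0; rewrite exprn_ge0// (le_trans _ (rP x x0))// powR_ge0.
(* [root (IP / bone)] is the radius of the ball with the Euclidean volume enclosed by the graph of
   [P]; it plays the part of [tau]. *)
pose root (x : R) := x `^ (k.+2%:R)^-1.
have root0 x : 0 <= root x by exact: powR_ge0.
have rootX x : 0 <= x -> root x ^+ k.+2 = x by exact: rho0X.
have IPb0 : 0 <= IP / bone by rewrite divr_ge0// ltW.
have mIP : m <= IP / bone by rewrite ler_pdivlMr//; exact: (mass_le_bint m0 lam_a dlam star_r).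
have rtau : m `^ (k.+2%:R)^-1 <= root (IP / bone).
  by rewrite /root ge0_ler_powR ?nnegrE ?invr_ge0// ltW.
(* The defining relation of eta-hat is used at t = tau: its argument omega (tau^N - m) / N equals IP
   - m bone, which is [V]. *)
have etaV : eta V = N * bone * T (root (IP / bone)).
  have [_ TE' _ _] := growthT.
  have := etaE _ rtau; rewrite omegaE (rint_expr m0 rtau) rootX// (TE' _ rtau) => <-.
  congr eta; rewrite mulrC -mulrA [_ * (N * _)]mulrA mulVf ?gt_eqF// mul1r.
  by rewrite mulrBl divfK ?gt_eqF// -VE addrK.
have tauE : root (IP / bone) ^+ k.+2 * bone = IP by rewrite rootX// divfK// gt_eqF.
have rb0 : 0 < root bone by exact: powR_gt0.
have [le_core eq_core] := core_inequality m0 growthT (sph_C1_profile m0 lam_a dlam star_r)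
  rP (growth_le_flux m0 lam_a dlam star_r TE) rtau tauE (root0 IP) rb0
  (rootX _ IP0) (rootX _ (ltW bone0)).
rewrite -/bone in le_core eq_core.
(* The common factor N^2 comes from the two sphere integrals, each N times a ball integral; removing
   it reduces the theorem to [core_inequality]. *)
have RHSE : RHS = N ^+ 2 * ((N * (bone * T (root (IP / bone))) +
     bint (fun x => P x * flux k m (P x) + (- N) * T (P x))) ^+ 2 +
     (root IP ^+ k.+1 * root bone) ^+ 2).
  rewrite mulrDr -!exprMn /RHS; congr (_ ^+ 2 + _).
    by rewrite etaV /W WE -/N; ring.
  apply: (isoperimetric_power bone0 omegaE (root0 IP) (ltW rb0)); first exact: rootX (ltW bone0).
  by rewrite VE rootX.
have NN0 : 0 < N ^+ 2 by rewrite exprn_gt0.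
have A2 : A ^+ 2 = N ^+ 2 * bint (fun x => Num.sqrt ((P x * flux k m (P x)) ^+ 2 +
    area_density P x ^+ 2)) ^+ 2 by rewrite /A AE exprMn.
rewrite RHSE A2 ler_pM2l//; split=> //.
split=> [h|[r0 [ar0 rc]]].
  have Pc := eq_core.1 (mulfI (lt0r_neq0 NN0) h).
  have [t t1 _] := sph_max (@sph_cont_cst R k.+1 1).
  have sphN0 (th : 'rV[R]_k.+2) : enorm th = 1 -> th != 0.
    by move=> th1; rewrite -enorm_gt0 th1.
  have [ra _] := star_r.
  exists (r t); split=> [|th th1]; first exact: ra.
  apply: (lam_inj m0 lam_a dlam); [exact: ra|exact: ra|].
  by have := Pc _ _ (sphN0 _ th1) (sphN0 _ t1); rewrite /P /profile /homog !unitize_id.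
congr (_ * _); apply/eq_core => x x' x0 x'0.
by rewrite /P /profile /homog !rc// enorm_unitize.
Qed.
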